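(* Let $n\ge 1$ and $r_+>r_->0$. Then there exist a smooth function $F:S^1\times\mathbb{R}^{2n}\to\mathbb{R}$ and a compatible complex structure $J\in\mathcal{J}(S^1\times\mathbb{R}^{2n},\xi_0)$ such that through every point $(\theta_0,p,z)\in S^1\times\mathbb{R}^{2(n-1)}\times\mathbb{R}^2$ with $|z|\in(r_-,r_+)$ there passes a finite-energy pseudoholomorphic cylinder for the data $(e^F\lambda_0,J)$ (i.e. the point lies in the image of the $S^1\times\mathbb{R}^{2n}$-component of the map) with limit set equal to the union of tori $$S^1\times\{p\}\times\bigl(\{|z|=r_-\}\cup\{|z|=r_+\}\bigr)\subset S^1\times\mathbb{R}^{2(n-1)}\times\mathbb{R}^2.$$
   Context: Notation. $S^1=\mathbb{R}/2\pi\mathbb{Z}$. On $S^1\times\mathbb{R}^{2n}$ with coordinates $(\theta,x_1,y_1,\dots,x_n,y_n)$ let $\alpha_n=\sum_{i=1}^n x_i\,dy_i-y_i\,dx_i$, $\lambda_0=d\theta+\alpha_n$ (a contact form), and $\xi_0=\ker\lambda_0$. In the splitting $\mathbb{R}^{2n}=\mathbb{R}^{2(n-1)}\times\mathbb{R}^2$ the last factor has coordinates $z=(x_n,y_n)$. Contact forms. For a contact form $\lambda$ on $M$, with $\xi=\ker\lambda$, the Reeb vector field $X_\lambda$ is defined by $i_{X_\lambda}d\lambda=0$, $i_{X_\lambda}\lambda=1$, and $\pi_\lambda:TM=\mathbb{R}X_\lambda\oplus\xi\to\xi$ is the projection along $X_\lambda$. $\mathcal{J}(M,\xi)$ is the set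 of $J\in\operatorname{End}(\xi)$ with $J^2=-\mathrm{Id}$ such that $d\lambda(\cdot,J\cdot)$ is symmetric and positive definite on $\xi$; this set is unchanged when $\lambda$ is replaced by $e^f\lambda$. Pseudoholomorphic maps. Let $(\Sigma,j)$ be a closed Riemann surface, $\Gamma\subset\Sigma$ a finite set (the punctures), and $a:\Sigma\setminus\Gamma\to\mathbb{R}$, $u:\Sigma\setminus\Gamma\to M$ smooth. The map $\tilde u=(a,u)$ is pseudoholomorphic for the data $(\lambda,J)$ if $\pi_\lambda\circ du\circ j=J\circ\pi_\lambda\circ du$ and $u^*\lambda\circ j=da$. Its Hofer energy is $E(u)=\sup_{\varphi\in\Xi}\int_{\Sigma\setminus\Gamma}d(\varphi(a)\,u^*\lambda)$, where $\Xi$ is the set of smooth $\varphi:\mathbb{R}\to[0,1]$ with $\varphi'\ge 0$, $\lim_{s\to-\infty}\varphi(s)=0$, $\lim_{s\to\infty}\varphi(s)=1$; finite-energy means $E(u)<\infty$. A cylinder is the case of the Riemann sphere with two punctures (domain $\mathbb{R}\times\mathbb{R}/\mathbb{Z}\approx\mathbb{C}/i\mathbb{Z}$). Limit sets. A holomorphic cylindrical coordinate system around $z_0\in\Gamma$ is a holomorphic embedding $\psi:[0,\infty)\times\mathbb{R}/\mathbb{Z}\subset\mathbb{C}/i\mathbb{Z}\to\Sigma\setminus\Gamma$ with $\lim_{s\to\infty}\psi(s,t)=z_0$. The mass of $z_0$ is $m(z_0)=\lim_{s\to\infty}\int_{\mathbb{R}/\mathbb{Z}}(u\circ\psi(s,\cdot))^*\lambda$.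 The limit set of the map is the collection of all periodic orbits, i.e. smooth loops $\gamma:\mathbb{R}/\mathbb{Z}\to M$ with $\dot\gamma=T\cdot X_\lambda\circ\gamma$, $T=m(z_0)\ne0$, obtained at the punctures $z_0$ as $C^\infty$-limits of loops $u\circ\psi(s_k,\cdot)$ for some sequence $s_k\to\infty$. Saying that the limit set equals a subset of $M$ means that the union of the images of these orbits is that subset. *)

(* Defs.v *)
From HB Require Import structures.
From mathcomp Require Import all_boot all_order all_algebra.
From mathcomp Require Import all_classical all_reals all_analysis.

Set Implicit Arguments.
Unset Strict Implicit.
Unset Printing Implicit Defensive.

Import Order.TTheory GRing.Theory Num.Theory numFieldNormedType.Exports.

Local Open Scope classical_set_scope.
Local Open Scope ring_scope.

(** * Smooth maps and exterior derivatives of 1-forms on vector spaces *)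

Fixpoint C_k (R : realType) (V W : normedModType R) (k : nat) (f : V -> W) : Prop :=
  match k with
  | 0 => continuous f
  | k'.+1 => (forall x, differentiable f x) /\
             (forall v, C_k k' (fun x => 'D_v f x))
  end.

(** Meant for finite-dimensional [V] and [W], where this is the usual notion. *)
Definition smooth (R : realType) (V W : normedModType R) (f : V -> W) : Prop :=
  forall k, C_k k f.

(** A 1-form is a map [b : V -> V -> R] (base point, tangent vector).  This is
    [db(v, w) = v(b(w)) - w(b(v)) - b([v, w])] for constant fields [v], [w],
    whose bracket vanishes. *)
Definition ext_d (R : realType) (V : normedModType R) (b : V -> V -> R)
    (x v w : V) : R :=
  'D_v (fun y => b y w) x - 'D_w (fun y => b y v) x.

Definition pullback (R : realType) (V W : normedModType R) (u : V -> W)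
    (b : W -> W -> R) (x v : V) : R :=
  b (u x) ('d u x v).

(** * The manifold S^1 x R^{2n}, through its universal cover

    A point [(theta, (x, y))] of [Mcov R n] represents the point
    [(theta mod 2 pi, x_1, y_1, ..., x_n, y_n)] of [S^1 x R^{2n}].  Functions
    and tensors on [S^1 x R^{2n}] are those on [Mcov R n] that are invariant
    under translation of [theta] by [2 pi]; maps from a cylinder or a circle
    to [S^1 x R^{2n}] are given by lifts to the universal covers. *)

Definition Mcov (R : realType) (n : nat) : normedModType R :=
  (R * ('rV[R]_n * 'rV[R]_n))%type.

(** The deck transformation of index [k]. *)
Definition deck (R : realType) (n : nat) (k : int) (q : Mcov R n) : Mcov R n :=
  (q.1 + k%:~R * (2 * pi), q.2).

Definition same_point (R : realType) (n : nat) (q q' : Mcov R n) : Prop :=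
  exists k : int, q' = deck k q.

Definition alpha (R : realType) (n : nat) (q v : Mcov R n) : R :=
  \sum_(i < n) (q.2.1 0 i * v.2.2 0 i - q.2.2 0 i * v.2.1 0 i).

Definition lambda0 (R : realType) (n : nat) (q v : Mcov R n) : R :=
  v.1 + alpha q v.

Definition exp_scaled (R : realType) (n : nat) (F : Mcov R n -> R)
    (l : Mcov R n -> Mcov R n -> R) (q v : Mcov R n) : R :=
  expR (F q) * l q v.

Definition smooth_function (R : realType) (n : nat) (F : Mcov R n -> R) : Prop :=
  smooth F /\ forall k q, F (deck k q) = F q.

(** * Reeb vector field, projection to the contact structure, J(M, xi) *)

(** The two conditions have exactly one solution if [l] is a contact form. *)
Definition reeb (R : realType) (n : nat) (l : Mcov R n -> Mcov R n -> R)
    (q : Mcov R n) : Mcov R n :=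
  xget 0 [set X | (forall v, ext_d l q X v = 0) /\ l q X = 1].

Definition proj_xi (R : realType) (n : nat) (l : Mcov R n -> Mcov R n -> R)
    (q v : Mcov R n) : Mcov R n :=
  v - l q v *: reeb l q.

(** [J q v] is relevant only for [v] in [xi_q = ker (l q)].  Smoothness of the
    bundle endomorphism: it maps smooth sections of [xi] to smooth sections. *)
Definition compatible_cs (R : realType) (n : nat)
    (l : Mcov R n -> Mcov R n -> R) (J : Mcov R n -> Mcov R n -> Mcov R n) : Prop :=
  [/\ (forall k q v, l q v = 0 -> J (deck k q) v = J q v),
      (forall Y : Mcov R n -> Mcov R n, smooth Y -> (forall q, l q (Y q) = 0) ->
         smooth (fun q => J q (Y q))),
      (forall q (c : R) v w, l q v = 0 -> l q w = 0 ->
         J q (c *: v + w) = c *: J q v + J q w),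
      (forall q v, l q v = 0 -> l q (J q v) = 0 /\ J q (J q v) = - v) &
      (forall q v w, l q v = 0 -> l q w = 0 ->
         ext_d l q v (J q w) = ext_d l q w (J q v)) /\
      (forall q v, l q v = 0 -> v != 0 -> 0 < ext_d l q v (J q v))].

(** * Pseudoholomorphic cylinders

    The cylinder [R x R/Z = C/iZ] has coordinates [(s, t)] and complex
    structure [j d/ds = d/dt].  Its universal cover is [Ccov R]. *)

Definition Ccov (R : realType) : normedModType R := (R * R)%type.

Definition cyl_shift (R : realType) (k : int) (x : Ccov R) : Ccov R :=
  (x.1, x.2 + k%:~R).

Definition cyl_j (R : realType) (v : Ccov R) : Ccov R := (- v.2, v.1).

Definition smooth_cylinder_map (R : realType) (n : nat)
    (a : Ccov R -> R) (u : Ccov R -> Mcov R n) : Prop :=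
  [/\ smooth a, smooth u,
      (forall k x, a (cyl_shift k x) = a x) &
      (forall k x, same_point (u x) (u (cyl_shift k x)))].

Definition pseudoholomorphic (R : realType) (n : nat)
    (l : Mcov R n -> Mcov R n -> R) (J : Mcov R n -> Mcov R n -> Mcov R n)
    (a : Ccov R -> R) (u : Ccov R -> Mcov R n) : Prop :=
  (forall x v, proj_xi l (u x) ('d u x (cyl_j v)) =
               J (u x) (proj_xi l (u x) ('d u x v))) /\
  (forall x v, pullback u l x (cyl_j v) = 'd a x v).

Definition Xi (R : realType) : set (R -> R) :=
  [set phi : R -> R | [/\ smooth phi, (forall s, 0 <= phi s <= 1),
     (forall s, 0 <= (phi^`())%classic s),
     phi s @[s --> -oo] --> (0 : R) & phi s @[s --> +oo] --> (1 : R)]].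

(** The integral is over the fundamental domain [R x [0, 1[], with respect to
    the orientation [(d/ds, d/dt)] determined by the complex structure. *)
Definition hofer_energy (R : realType) (n : nat)
    (l : Mcov R n -> Mcov R n -> R) (a : Ccov R -> R) (u : Ccov R -> Mcov R n)
    : \bar R :=
  ereal_sup [set (\int[lebesgue_measure \x lebesgue_measure]_(x in
                    [set x : R * R | 0 <= x.2 < 1]%R)
                  (ext_d (fun y v : Ccov R => phi (a y) * pullback u l y v)
                     x (1, 0) (0, 1))%R%:E)%E | phi in @Xi R].

Definition finite_energy_cylinder (R : realType) (n : nat)
    (l : Mcov R n -> Mcov R n -> R) (J : Mcov R n -> Mcov R n -> Mcov R n)
    (a : Ccov R -> R) (u : Ccov R -> Mcov R n) : Prop :=
  [/\ smooth_cylinder_map a u, pseudoholomorphic l J a u &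
      (hofer_energy l a u < +oo)%E].

(** * Limit sets *)

(** The two punctures of the cylinder are [true], at [s = +oo], and [false],
    at [s = -oo]; the convergence is uniform in [t]. *)
Definition tends_to_puncture (R : realType) (z0 : bool) (psi : Ccov R -> Ccov R)
    : Prop :=
  forall A : R, \forall s \near +oo,
    forall t, A < (if z0 then (psi (s, t)).1 else - (psi (s, t)).1).

(** [psi] is a lift of the coordinate system.  As usual, holomorphic on the
    half-cylinder [s >= 0] means holomorphic on a neighbourhood of it.  An
    injective immersion tending to [z0] is proper, hence an embedding. *)
Definition cylindrical_coordinates (R : realType) (z0 : bool)
    (psi : Ccov R -> Ccov R) : Prop :=
  [/\ exists2 e : R, 0 < e & forall x : Ccov R, - e < x.1 ->
        differentiable psi x /\
        forall v : Ccov R, 'd psi x (cyl_j v) = cyl_j ('d psi x v),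
      (forall (x : Ccov R), 0 <= x.1 ->
         forall k, exists m, psi (cyl_shift k x) = cyl_shift m (psi x)),
      (forall x y : Ccov R, 0 <= x.1 -> 0 <= y.1 ->
         (exists m, psi y = cyl_shift m (psi x)) ->
         exists k, y = cyl_shift k x),
      (forall x v : Ccov R, 0 <= x.1 -> v != 0 -> 'd psi x v != 0) &
      tends_to_puncture z0 psi].

Definition has_mass (R : realType) (n : nat) (l : Mcov R n -> Mcov R n -> R)
    (u : Ccov R -> Mcov R n) (psi : Ccov R -> Ccov R) (T : R) : Prop :=
  (\int[lebesgue_measure]_(t in `[0, 1])
     pullback (fun t : R => u (psi (s, t))) l t 1)%R @[s --> +oo] --> T.

Definition periodic_orbit (R : realType) (n : nat)
    (l : Mcov R n -> Mcov R n -> R) (T : R) (g : R -> Mcov R n) : Prop :=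
  [/\ smooth g, (forall t, same_point (g t) (g (t + 1))) &
      (forall t, (g^`())%classic t = T *: reeb l (g t))].

(** Loops in [S^1 x R^{2n}] converge in [C^oo] iff suitable lifts, here
    [deck (k i) \o f i], converge uniformly with all derivatives. *)
Definition Cinfty_loop_cvg (R : realType) (n : nat)
    (f : nat -> R -> Mcov R n) (g : R -> Mcov R n) : Prop :=
  exists k : nat -> int, forall (m : nat) (e : R), 0 < e ->
    \forall i \near \oo, forall t,
      `| derive1n m (fun t0 => deck (k i) (f i t0)) t - derive1n m g t | < e.

Definition limit_orbits (R : realType) (n : nat)
    (l : Mcov R n -> Mcov R n -> R) (u : Ccov R -> Mcov R n)
    : set (R -> Mcov R n) :=
  [set g | exists (z0 : bool) (psi : Ccov R -> Ccov R) (T : R) (s : nat -> R),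
     [/\ cylindrical_coordinates z0 psi,
         has_mass l u psi T /\ T != 0,
         periodic_orbit l T g,
         (forall i, 0 <= s i) /\ s i @[i --> \oo] --> +oo &
         Cinfty_loop_cvg (fun i t => u (psi (s i, t))) g]].

(** The preimage in the universal cover of the union of the images of the
    limit orbits. *)
Definition limit_set (R : realType) (n : nat)
    (l : Mcov R n -> Mcov R n -> R) (u : Ccov R -> Mcov R n) : set (Mcov R n) :=
  [set q | exists2 g, limit_orbits l u g & exists t, same_point (g t) q].

(** * The splitting R^{2(n+1)} = R^{2n} x R^2 *)

Definition same_p (R : realType) (n : nat) (q q' : Mcov R n.+1) : Prop :=
  forall i : 'I_n.+1, i != ord_max ->
    q.2.1 0 i = q'.2.1 0 i /\ q.2.2 0 i = q'.2.2 0 i.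

Definition norm_z (R : realType) (n : nat) (q : Mcov R n.+1) : R :=
  Num.sqrt (q.2.1 0 ord_max ^+ 2 + q.2.2 0 ord_max ^+ 2).

(** The preimage in the universal cover of
    [S^1 x {p} x ({|z| = r1} U {|z| = r2})], where [p] is taken from [q0]. *)
Definition union_of_tori (R : realType) (n : nat) (q0 : Mcov R n.+1) (r1 r2 : R)
    : set (Mcov R n.+1) :=
  [set q | same_p q q0 /\ (norm_z q = r1 \/ norm_z q = r2)].

(* Main.v *)
From HB Require Import structures.
Require Import Defs.
From mathcomp Require Import all_boot all_order all_algebra.
From mathcomp Require Import all_classical all_reals all_analysis.
From mathcomp Require Import measurable_realfun ring lra.
Import Order.TTheory GRing.Theory Num.Theory numFieldNormedType.Exports.
Set Implicit Arguments.
Unset Strict Implicit.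
Unset Printing Implicit Defensive.
Local Open Scope classical_set_scope.
Local Open Scope ring_scope.

(** The proof takes [F] to depend on [z] alone and [J] to be the standard complex
    structure, transported to the contact hyperplanes by the projection
    [(theta, x, y) |-> (x, y)].  The Reeb field of [e^F lambda0] is then, up to
    scaling, [d/dtheta] plus the contact lift of half the gradient of [F] rotated
    by a quarter turn ([reeb_exp_scaled]).  Consequently every solution of
    [z' = pi grad F(z)] yields a pseudoholomorphic cylinder
    [u(s, t) = (2 pi t + g(s), p, z(s))], where [g] makes [du/ds] tangent to the
    contact hyperplanes: the Reeb component of [du/dt] has to be discarded, and
    what remains is [J] applied to [du/ds] ([pseudoholomorphic_cyl]).  The
    pullback of the contact form is [2 pi e^F(z(s)) dt], so the Hofer energy is at
    most [2 pi e] as soon as [F] stays below [1] along [z]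
    ([hofer_energy_finite]).  A critical point of [F] gives a periodic orbit, the
    circle over it ([periodic_fibre]).

    So it suffices to find a smooth [F] on the plane whose gradient lines in the
    open annulus [rm < |z| < rp] spiral infinitely often towards both boundary
    circles: each gradient line then accumulates on whole circles of critical
    points, and the cylinder on the tori over them.  Write [q = |z|^2] and let
    [tau] be the function [1/(qp - q) - 1/(q - qm)], which runs through the real
    line as [q] crosses the annulus.  The potential is
    [f + amp r^3 f (1 - f) cos (phi - freq tau)] with [f] the logistic function of
    [tau]: a step from [0] to [1] with a small oscillation along spirals.  All
    terms are flat on the boundary circles, hence [F] extends smoothly by
    constants ([smooth_flat], [smooth_step], [smooth_waves]).

    The field [pi grad F], written in polar coordinates, is smooth with support in
    the annulus, hence bounded and Lipschitz, and has global solutions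
    ([global_solution]).  Let [psi = phi - freq tau].  Where [sin psi = 0] the
    step pushes the radius outwards and [psi] decreases ([crossing_down]); where
    [sin psi = -1] the frequency is high enough for the oscillation to overcome
    the step and [psi] increases ([crossing_up]).  Hence [psi] is trapped between
    barriers ([phase_trapped]).  The gradient is bounded below in terms of
    [F (1 - F)] ([potential_rate]), so [F] runs from [0] to [1] and [tau] from
    minus to plus infinity; as [psi] is bounded, the angle [phi] is unbounded at
    both ends ([spiral_trajectory]).

    For the limit set, the angle takes every value modulo [2 pi] at arbitrarily
    late times while the radius converges.  At such times the loops [u(s, .)] are
    circles over points that converge to any prescribed point of the boundary
    circle, and after passing to a subsequence for which their offsets [g(s)]
    converge modulo [2 pi], they converge smoothly ([tori_in_limit_set]).
    Conversely only points over the boundary circles can arise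
    ([limit_set_in_tori]). *)

(** * Smooth maps between normed spaces *)

Section Toolkit.
Variable R : realType.
Implicit Types V W : normedModType R.

Lemma eq_C_k V W k (f g : V -> W) : f =1 g -> C_k k f -> C_k k g.
Proof. by move=> /funext ->. Qed.

Lemma C_kS V W k (f : V -> W) : C_k k.+1 f <->
  (forall x, differentiable f x) /\ (forall v, C_k k (fun x => 'D_v f x)).
Proof. by []. Qed.

Lemma C_k_continuous V W k (f : V -> W) : C_k k f -> continuous f.
Proof.
by case: k => [//|k] [df _] x; apply: differentiable_continuous.
Qed.

Lemma C_k_pred V W k (f : V -> W) : C_k k.+1 f -> C_k k f.
Proof.
elim: k f => [|k IH] f; first by move=> H; exact: (C_k_continuous H).
by move=> /C_kS[df Hf]; split => // v; apply: IH; exact: Hf.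
Qed.

Lemma C_k_cst V W k (c : W) : C_k k (fun _ : V => c).
Proof.
elim: k c => [|k IH] c; first exact: cst_continuous.
apply/C_kS; split=> [x|v]; first exact: differentiable_cst.
apply: (eq_C_k (f := fun _ => 0)) => // x.
by rewrite derive_cst.
Qed.

Lemma C_kD V W k (f g : V -> W) :
  C_k k f -> C_k k g -> C_k k (fun x => f x + g x).
Proof.
elim: k f g => [|k IH] f g.
  by move=> cf cg x; apply: cvgD; [exact: cf|exact: cg].
move=> /C_kS[df Hf] /C_kS[dg Hg]; apply/C_kS; split=> [x|v]; first exact: differentiableD.
apply: (eq_C_k (f := fun x => 'D_v f x + 'D_v g x)); last exact: IH.
by move=> x; rewrite deriveD //; exact: diff_derivable.
Qed.

Lemma C_kM V k (f g : V -> R) :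
  C_k k f -> C_k k g -> C_k k (fun x => f x * g x).
Proof.
elim: k f g => [|k IH] f g.
  by move=> cf cg x; apply: cvgM; [exact: cf|exact: cg].
move=> /[dup] /C_k_pred Cf /C_kS[df Hf] /[dup] /C_k_pred Cg /C_kS[dg Hg].
apply/C_kS; split=> [x|v]; first exact: differentiableM.
apply: (eq_C_k (f := fun x => f x * 'D_v g x + g x * 'D_v f x)).
  by move=> x; rewrite deriveM //; exact: diff_derivable.
by apply: C_kD; apply: IH.
Qed.

Lemma C_kZl V W k (f : V -> R) (w : W) :
  C_k k f -> C_k k (fun x => f x *: w).
Proof.
elim: k f => [|k IH] f.
  by move=> cf x; apply: cvgZr_tmp; exact: cf.
move=> /C_kS[df Hf]; apply/C_kS; split=> [x|v]; first exact: differentiableZl.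
apply: (eq_C_k (f := fun x => 'D_v f x *: w)); last exact: IH.
move=> x; rewrite [RHS]deriveE; last exact: differentiableZl.
by rewrite diffZl // deriveE.
Qed.

Lemma C_k_sum V W k n (f : 'I_n -> V -> W) :
  (forall i, C_k k (f i)) -> C_k k (fun x => \sum_(i < n) f i x).
Proof.
elim: n f => [|n IH] f H.
  under eq_fun do rewrite big_ord0.
  exact: C_k_cst.
under eq_fun do rewrite big_ord_recl.
by apply: C_kD => //; apply: IH.
Qed.

(** A continuous linear map commutes with directional derivatives, so the order
    of smoothness passes through it by induction. *)
Lemma C_k_linear_comp V W W' k (l : W -> W') (f : V -> W) :
  linear l -> continuous l -> C_k k f -> C_k k (fun x => l (f x)).
Proof.
move=> ll cl.
pose L : {linear W -> W'} := HB.pack l (GRing.isLinear.Build R W W' *:%R l ll).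
elim: k f => [|k IH] f.
  by move=> cf x; apply: continuous_comp; [exact: cf|exact: cl].
move=> /C_kS[df Hf].
have dl y : differentiable l y by exact: (@linear_differentiable _ _ _ L).
apply/C_kS; split=> [x|v]; first exact: (@differentiable_comp _ _ _ _ f l).
apply: (eq_C_k (f := fun x => l ('D_v f x))); last exact: IH.
move=> x; rewrite [RHS]deriveE; last exact: (@differentiable_comp _ _ _ _ f l).
rewrite (@diff_comp _ _ _ _ f l) //= deriveE //.
by have -> : 'd l (f x) = l :> (W -> W') by exact: (@diff_lin _ _ _ L).
Qed.

Lemma C_k_id V k : C_k k (fun x : V => x).
Proof.
case: k => [x|k]; first exact: cvg_id.
apply/C_kS; split=> [x|v]; first by apply: ex_diff.
apply: (eq_C_k (f := fun _ => v)); last exact: C_k_cst.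
by move=> x; rewrite derive_id.
Qed.

Lemma derive_scale_R W (f : R -> W) (x v : R) : differentiable f x ->
  'D_v f x = v *: (derive1 f) x.
Proof.
by move=> df; rewrite deriveE // derive1E' // -linearZ /= [v%:A](mulr1 v).
Qed.

Lemma C_kS_R W k (f : R -> W) :
  (forall x, derivable f x 1) -> C_k k ((derive1 f)) -> C_k k.+1 f.
Proof.
move=> df Cf; have df' x : differentiable f x by exact/derivable1_diffP.
split=> // v; apply: (eq_C_k (f := fun x => v *: (derive1 f) x)).
  by move=> x; rewrite derive_scale_R.
have cl : continuous (fun y : W => v *: y) by exact: scaler_continuous.
apply: (@C_k_linear_comp _ _ _ _ (GRing.scale v)) => //; exact: linearP.
Qed.

Lemma C_kS_R_inv W k (f : R -> W) :
  C_k k.+1 f -> (forall x, derivable f x 1) /\ C_k k ((derive1 f)).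
Proof.
move=> /C_kS[df Hf]; split; first by move=> x; exact/derivable1_diffP.
by apply: (eq_C_k (f := fun x => 'D_1 f x)) => // x; rewrite derive1E.
Qed.

Lemma derive_comp_R V (a : R -> R) (h : V -> R) x v :
  differentiable h x -> derivable a (h x) 1 ->
  'D_v (fun y => a (h y)) x = (derive1 a) (h x) * 'D_v h x.
Proof.
move=> dh /derivable1_diffP da.
rewrite deriveE; last exact: (@differentiable_comp _ _ _ _ h a).
rewrite (@diff_comp _ _ _ _ h a) //= -deriveE // -deriveE //.
by rewrite derive_scale_R // mulrC.
Qed.

Lemma C_k_comp V k (a : R -> R) (h : V -> R) :
  C_k k a -> C_k k h -> C_k k (fun x => a (h x)).
Proof.
elim: k a h => [|k IH] a h.
  by move=> ca ch x; apply: continuous_comp; [exact: ch|exact: ca].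
move=> /C_kS_R_inv [da Ca] /[dup] /C_k_pred Ch /C_kS[dh Hh]; apply/C_kS; split=> [x|v].
  by apply: (@differentiable_comp _ _ _ _ h a) => //; exact/derivable1_diffP.
apply: (eq_C_k (f := fun x => (derive1 a) (h x) * 'D_v h x)).
  by move=> x; rewrite derive_comp_R.
by apply: C_kM => //; apply: IH.
Qed.

Lemma C_k_pair V W W' k (f : V -> W) (g : V -> W') :
  C_k k f -> C_k k g -> C_k k (fun x => (f x, g x)).
Proof.
elim: k f g => [|k IH] f g.
  by move=> cf cg x; apply: cvg_pair; [exact: cf|exact: cg].
move=> /C_kS[df Hf] /C_kS[dg Hg]; apply/C_kS; split=> [x|v]; first exact: differentiable_pair.
apply: (eq_C_k (f := fun x => ('D_v f x, 'D_v g x))); last exact: IH.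
move=> x; rewrite [RHS]deriveE; last exact: differentiable_pair.
by rewrite diff_pair // !deriveE.
Qed.

Lemma continuous_fst V W : continuous (fst : V * W -> V).
Proof. by move=> x; exact: cvg_fst. Qed.

Lemma continuous_snd V W : continuous (snd : V * W -> W).
Proof. by move=> x; exact: cvg_snd. Qed.

Lemma C_k_fst V W W' k (f : V -> (W * W')%type) :
  C_k k f -> C_k k (fun x => (f x).1).
Proof. by apply: (@C_k_linear_comp _ _ _ _ fst) => //; exact: continuous_fst. Qed.

Lemma C_k_snd V W W' k (f : V -> (W * W')%type) :
  C_k k f -> C_k k (fun x => (f x).2).
Proof. by apply: (@C_k_linear_comp _ _ _ _ snd) => //; exact: continuous_snd. Qed.

Lemma C_k_coord V k n (f : V -> 'rV[R]_n) i :
  C_k k f -> C_k k (fun x => f x 0 i).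
Proof.
apply: (@C_k_linear_comp _ _ _ _ (fun w : 'rV[R]_n => w 0 i : R)).
  by move=> c v w; rewrite !mxE.
move=> w; apply: differentiable_continuous; exact: differentiable_coord.
Qed.

Lemma smooth1P W (f : R -> W) : smooth f <->
  (forall x, derivable f x 1) /\ smooth ((derive1 f)).
Proof.
split=> [H|[df H]].
  split; first by case: (C_kS_R_inv (H 1%N)).
  by move=> k; case: (C_kS_R_inv (H k.+1)).
by case=> [|k]; [apply: (C_k_pred (k := 0))|]; apply: C_kS_R.
Qed.

End Toolkit.

(** * Oscillating functions that are flat at the origin *)

Section Flat.
Variable R : realType.

Lemma der_cst (c x : R) : is_derive x 1 (fun _ : R => c) 0.
Proof. exact: is_derive_cst. Qed.

Lemma der_id (x : R) : is_derive x 1 (fun y : R => y) 1.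
Proof. exact: is_derive_id. Qed.

Lemma der_D (f g : R -> R) (x a b : R) : is_derive x 1 f a ->
  is_derive x 1 g b -> is_derive x 1 (fun y => f y + g y) (a + b).
Proof. by move=> Hf Hg; exact: is_deriveD. Qed.

Lemma der_N (f : R -> R) (x a : R) : is_derive x 1 f a ->
  is_derive x 1 (fun y => - f y) (- a).
Proof. by move=> Hf; exact: is_deriveN. Qed.

Lemma der_M (f g : R -> R) (x a b : R) : is_derive x 1 f a ->
  is_derive x 1 g b -> is_derive x 1 (fun y => f y * g y) (a * g x + f x * b).
Proof.
move=> Hf Hg; have H := is_deriveM Hf Hg.
by apply: is_derive_eq; rewrite addrC /GRing.scale /= [a * _]mulrC.
Qed.

Lemma der_comp (g f : R -> R) (x a b : R) : is_derive (f x) 1 g b ->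
  is_derive x 1 f a -> is_derive x 1 (fun y => g (f y)) (b * a).
Proof. by move=> Hg Hf; exact: is_derive1_comp. Qed.

Lemma der_X n (f : R -> R) (x a : R) : is_derive x 1 f a ->
  is_derive x 1 (fun y => f y ^+ n) (n%:R * f x ^+ n.-1 * a).
Proof.
move=> Hf; case: n => [|n].
  by rewrite !mul0r; under eq_fun do rewrite expr0; exact: der_cst.
have H := is_deriveX n.+1 Hf; rewrite -[n.+1.-1]/n in H *.
rewrite [_ * a](_ : _ = (n.+1%:R * f x ^+ n) *: a) //.
rewrite (_ : (fun y => f y ^+ n.+1) = f ^+ n.+1) //.
by apply/funext => y; elim: (n.+1) => [|m IH]; rewrite ?expr0 // !exprS IH.
Qed.

Lemma der_V (f : R -> R) (x a : R) : is_derive x 1 f a -> f x != 0 ->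
  is_derive x 1 (fun y => (f y)^-1) (- a / f x ^+ 2).
Proof.
move=> Hf f0; have H := @is_deriveV _ f x a 1 f0 Hf.
apply: is_derive_eq; rewrite /GRing.scale /=; field; exact: f0.
Qed.

Lemma der_expR (f : R -> R) (x a : R) : is_derive x 1 f a ->
  is_derive x 1 (fun y => expR (f y)) (expR (f x) * a).
Proof. exact: der_comp. Qed.

Lemma der_cos (f : R -> R) (x a : R) : is_derive x 1 f a ->
  is_derive x 1 (fun y => cos (f y)) (- sin (f x) * a).
Proof. exact: der_comp. Qed.

Lemma der_sin (f : R -> R) (x a : R) : is_derive x 1 f a ->
  is_derive x 1 (fun y => sin (f y)) (cos (f x) * a).
Proof. exact: der_comp. Qed.

(** [e^(y/n) >= y/n], raised to the power [n]. *)
Lemma exprn_le_expR n (y : R) : 0 <= y -> y ^+ n <= n%:R ^+ n * expR y.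
Proof.
case: n => [|n] y0.
  by rewrite !expr0 mul1r -expR0 ler_expR.
have n0 : (0 : R) < n.+1%:R by rewrite ltr0n.
have -> : expR y = expR (y / n.+1%:R) ^+ n.+1.
  by rewrite -expRM_natl; congr expR; field; rewrite gt_eqF.
rewrite -exprMn; apply: lerXn2r; rewrite ?nnegrE ?mulr_ge0 ?expR_ge0 //.
rewrite mulrC -ler_pdivrMr //; apply: le_trans (expR_ge1Dx _).
by rewrite lerDr.
Qed.

Lemma poly_expR_bounded (p : {poly R}) :
  exists2 C : R, 0 <= C & forall y : R, 0 <= y -> `|p.[y]| * expR (- y) <= C.
Proof.
exists (\sum_(i < size p) `|p`_i| * i%:R ^+ i).
  by apply: sumr_ge0 => i _; rewrite mulr_ge0 // exprn_ge0.
move=> y y0; rewrite expRN ler_pdivrMr ?expR_gt0 // horner_coef.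
apply: le_trans (ler_norm_sum _ _ _) _.
rewrite mulr_suml; apply: ler_sum => i _.
rewrite normrM -mulrA ler_wpM2l // ger0_norm ?exprn_ge0 //.
exact: exprn_le_expR.
Qed.

(** Differentiability at the flat point, where no formula for the function is
    available on both sides. *)
Lemma is_derive0_quadratic (f : R -> R) (C : R) :
  (forall x, `|f x| <= C * x ^+ 2) -> is_derive (0 : R) (1 : R) f (0 : R).
Proof.
move=> H.
have f0 : f 0 = 0.
  by apply/eqP; rewrite -normr_le0; have := H 0; rewrite expr0n mulr0.
have L : (fun h : R => h^-1 *: (f (h *: 1 + 0) - f 0)) @ 0^' --> (0 : R).
  apply/cvgrPdist_le => e e0; near=> h.
  rewrite sub0r normrN f0 subr0 addr0 [h%:A]mulr1 normrZ normfV.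
  have h0 : h != 0 by near: h; exact: nbhs_dnbhs_neq.
  rewrite ler_pdivrMl ?normr_gt0 //; apply: le_trans (H h) _.
  rewrite -real_normK ?num_real // expr2 mulrA [_ * e]mulrC ler_wpM2r //.
  have : `|h| <= e / (`|C| + 1).
    by near: h; apply: dnbhs0_le; rewrite divr_gt0 // ltr_wpDl.
  rewrite ler_pdivlMr ?ltr_wpDl // mulrC => hh.
  by apply: le_trans hh; rewrite ler_wpM2r // (le_trans (ler_norm C)) // lerDl.
by apply: DeriveDef; [apply/cvg_ex; exists 0 | apply: cvg_lim].
Unshelve. all: by end_near. Qed.

(** The two polynomials make the family stable under differentiation, which is
    what an induction on the order of smoothness requires. *)
Definition flat (B : R) (p q : {poly R}) (x : R) : R :=
  if 0 < x then
    expR (- x^-1) * (p.[x^-1] * cos (B * x^-1) + q.[x^-1] * sin (B * x^-1))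
  else 0.

Lemma flat_pos B p q x : 0 < x -> flat B p q x =
  expR (- x^-1) * (p.[x^-1] * cos (B * x^-1) + q.[x^-1] * sin (B * x^-1)).
Proof. by rewrite /flat => ->. Qed.

Lemma flat_neg B p q x : x <= 0 -> flat B p q x = 0.
Proof. by rewrite /flat leNgt => /negbTE ->. Qed.

Lemma hornerX2M (p : {poly R}) y : ('X^2 * p).[y] = y ^+ 2 * p.[y].
Proof. by rewrite hornerM hornerXn. Qed.

(** With [y = 1/x] the claim is that [y^2] times a polynomial in [y] times
    [exp (-y)] stays bounded. *)
Lemma flat_le B p q : exists C : R, forall x, `|flat B p q x| <= C * x ^+ 2.
Proof.
have [C C0 HC] := poly_expR_bounded ('X^2 * p).
have [D D0 HD] := poly_expR_bounded ('X^2 * q).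
exists (C + D) => x; have [x0|x0] := ltP 0 x; last first.
  by rewrite flat_neg // normr0 mulr_ge0 ?addr_ge0 // sqr_ge0.
have y0 : 0 <= x^-1 by rewrite invr_ge0 ltW.
have := HC _ y0; have := HD _ y0.
have y2 : `|x^-1 ^+ 2| = x^-1 ^+ 2 by rewrite ger0_norm // sqr_ge0.
rewrite !hornerX2M 2!(normrM (_ ^+ 2)) y2 => hD hC.
rewrite flat_pos // normrM ger0_norm ?expR_ge0 // -ler_pdivrMr ?exprn_gt0 //.
rewrite -exprVn; apply: le_trans (lerD hC hD).
set e := expR _; set y := x^-1.
have -> : y ^+ 2 * `|p.[y]| * e + y ^+ 2 * `|q.[y]| * e =
  e * (`|p.[y]| + `|q.[y]|) * y ^+ 2 by ring.
rewrite ler_wpM2r ?exprn_ge0 // ler_wpM2l ?expR_ge0 //.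
apply: le_trans (ler_normD _ _) _; rewrite !normrM lerD //.
  by rewrite ler_piMr // cos_max.
by rewrite ler_piMr // sin_max.
Qed.

(** The derivative belongs to the same family, with the factor [1/x^2] from the
    chain rule absorbed into the polynomials; hence [smooth_flat]. *)
Lemma is_derive_flat (B : R) p q (x : R) : is_derive x (1 : R) (flat B p q)
  (flat B ('X^2 * (p - p^`() - B *: q)) ('X^2 * (q - q^`() + B *: p)) x).
Proof.
have [x0|x0|x0] := ltgtP x 0.
- rewrite [X in is_derive _ _ _ X]flat_neg ?ltW //.
  apply: near_eq_is_derive (der_cst 0 x).
  near=> y; rewrite flat_neg // ltW //; near: y; exact: lt_nbhsl.
- rewrite [X in is_derive _ _ _ X]flat_pos //.
  have dV : is_derive x 1 (fun y : R => y^-1) (- 1 / x ^+ 2).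
    by apply: (der_V (der_id x)); rewrite gt_eqF.
  have dB : is_derive x 1 (fun y : R => B * y^-1) (0 * x^-1 + B * (- 1 / x ^+ 2)).
    exact: (der_M (der_cst B x) dV).
  have dp (r : {poly R}) : is_derive x 1 (fun y : R => r.[y^-1]) (r^`().[x^-1] * (- 1 / x ^+ 2)).
    exact: (@der_comp (horner r)).
  have H := der_M (der_expR (der_N dV)) (der_D (der_M (dp p) (der_cos dB)) (der_M (dp q) (der_sin dB))).
  apply: (near_eq_is_derive _ (is_derive_eq H _)).
    near=> y; rewrite flat_pos //; near: y; exact: lt_nbhsr.
  rewrite !(hornerX2M, hornerD, hornerN, hornerZ).
  by field; rewrite gt_eqF.
- rewrite x0 [X in is_derive _ _ _ X]flat_neg //.
  have [C HC] := flat_le B p q; exact: (is_derive0_quadratic HC).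
Unshelve. all: by end_near. Qed.

Lemma smooth_flat B p q : smooth (flat B p q : R -> R).
Proof.
move=> k; elim: k p q => [|k IH] p q.
  move=> x; apply: differentiable_continuous; apply/derivable1_diffP.
  by have [] := is_derive_flat B p q x.
apply: C_kS_R => [x|]; first by have [] := is_derive_flat B p q x.
apply: eq_C_k (IH _ _) => x; rewrite derive1E.
by have [_ ->] := is_derive_flat B p q x.
Qed.

End Flat.

(** * Operations on smooth functions and Lipschitz bounds *)

Section SmoothMore.
Variable R : realType.
Implicit Types V W : normedModType R.

Lemma smooth_derivable W (f : R -> W) x : smooth f -> derivable f x 1.
Proof. by move=> /smooth1P[]. Qed.

Lemma smooth_is_derive (f : R -> R) (x : R) : smooth f ->
  is_derive x (1 : R) f (derive1 f x).
Proof.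
by move=> sf; apply: DeriveDef; [exact: smooth_derivable | rewrite derive1E].
Qed.

Lemma smooth_derive1 W (f : R -> W) : smooth f -> smooth (derive1 f).
Proof. by move=> /smooth1P[]. Qed.

Lemma smooth_continuous V W (f : V -> W) : smooth f -> continuous f.
Proof. by move=> sf; exact: (sf 0). Qed.

Lemma smooth_differentiable V W (f : V -> W) x : smooth f -> differentiable f x.
Proof. by move=> sf; have /C_kS[] := sf 1%N. Qed.

Lemma smooth_id V : smooth (fun x : V => x).
Proof. by move=> k; exact: C_k_id. Qed.

Lemma smooth_cst V W (w : W) : smooth (fun _ : V => w).
Proof. by move=> k; exact: C_k_cst. Qed.

Lemma smoothD V W (f g : V -> W) :
  smooth f -> smooth g -> smooth (fun x => f x + g x).
Proof. by move=> sf sg k; apply: C_kD; [exact: sf | exact: sg]. Qed.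

Lemma smoothM V (f g : V -> R) :
  smooth f -> smooth g -> smooth (fun x => f x * g x).
Proof. by move=> sf sg k; apply: C_kM; [exact: sf | exact: sg]. Qed.

Lemma smooth_comp V (a : R -> R) (h : V -> R) :
  smooth a -> smooth h -> smooth (fun x => a (h x)).
Proof. by move=> sf sg k; apply: C_k_comp; [exact: sf | exact: sg]. Qed.

Lemma smoothN V (f : V -> R) : smooth f -> smooth (fun x => - f x).
Proof.
move=> sf k; apply: (eq_C_k (f := fun x => -1 * f x)) => [x|].
  by rewrite mulN1r.
by apply: C_kM; [exact: C_k_cst | exact: sf].
Qed.

Lemma smoothX V (f : V -> R) n : smooth f -> smooth (fun x => f x ^+ n).
Proof.
move=> sf k; elim: n => [|n IH].
  by under eq_fun do rewrite expr0; exact: C_k_cst.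
by under eq_fun do rewrite exprS; apply: C_kM => //; exact: sf.
Qed.

Lemma smoothV V (f : V -> R) : (forall x, f x != 0) -> smooth f ->
  smooth (fun x => (f x)^-1).
Proof.
move=> f0 sf; elim=> [|k IH].
  by move=> x; apply: cvgV => //; exact: (sf 0%N).
have df x : differentiable f x by exact: smooth_differentiable.
apply/C_kS; split=> [x|v]; first exact: differentiableV.
apply: (eq_C_k (f := fun x => - 'D_v f x * ((f x)^-1 * (f x)^-1))) => [x|].
  rewrite deriveV //; last exact: diff_derivable.
  by rewrite /GRing.scale /=; field; exact: f0.
apply: C_kM; last by apply: C_kM.
have /C_kS[_ Hf] := sf k.+1.
apply: (eq_C_k (f := fun x => -1 * 'D_v f x)) => [x|]; first by rewrite mulN1r.
by apply: C_kM; [exact: C_k_cst | exact: Hf].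
Qed.

Lemma smooth_trig : smooth (@cos R : R -> R) /\ smooth (@sin R : R -> R).
Proof.
suff H k : C_k k (@cos R : R -> R) /\ C_k k (@sin R : R -> R).
  by split=> k; have [] := H k.
elim: k => [|k [IHc IHs]].
  by split; [exact: continuous_cos | exact: continuous_sin].
split; apply: C_kS_R => [x|].
- exact: derivable_cos.
- apply: (eq_C_k (f := fun x => -1 * sin x)) => [x|].
    by rewrite derive1E derive_val mulN1r.
  by apply: C_kM => //; exact: C_k_cst.
- exact: derivable_sin.
- by apply: eq_C_k IHc => x; rewrite derive1E derive_val.
Qed.

Lemma smooth_cos : smooth (@cos R : R -> R). Proof. by case: smooth_trig. Qed.
Lemma smooth_sin : smooth (@sin R : R -> R). Proof. by case: smooth_trig. Qed.

Lemma smooth_expR : smooth (@expR R : R -> R).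
Proof.
elim=> [|k IH]; first exact: continuous_expR.
apply: C_kS_R => [x|]; first exact: derivable_expR.
by apply: eq_C_k IH => x; rewrite derive1E derive_val.
Qed.

Lemma derive1_is_derive (f : R -> R) (x a : R) :
  is_derive x (1 : R) f a -> derive1 f x = a.
Proof. by move=> [_ <-]; rewrite derive1E. Qed.

Lemma derive1_near_cst (f : R -> R) (c x : R) :
  (\forall y \near x, f y = c) -> derive1 f x = 0.
Proof.
move=> H; apply: derive1_is_derive.
apply: near_eq_is_derive (der_cst c x); apply: filterS H => y ->; done.
Qed.

(** Continuity of the derivative carries the vanishing over to the end point
    [a], where [f] is constant on one side only. *)
Lemma derive1_cst_left (f : R -> R) (c a : R) : smooth f ->
  (forall x, x <= a -> f x = c) -> forall x, x <= a -> derive1 f x = 0.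
Proof.
move=> sf H x xa.
have c' : continuous (derive1 f).
  by apply: smooth_continuous; exact: smooth_derive1.
have L : derive1 f y @[y --> x^'-] --> derive1 f x.
  exact: cvg_at_left_filter (c' x).
apply: (cvg_unique _ L) => //.
apply: cvg_near_cst; near=> y.
apply: (@derive1_near_cst _ c); near=> z; apply: H.
apply: le_trans xa; apply: ltW; near: z; apply: lt_nbhsl.
near: y; exact: nbhs_left_lt.
Unshelve. all: by end_near. Qed.

Lemma derive1_cst_right (f : R -> R) (c a : R) : smooth f ->
  (forall x, a <= x -> f x = c) -> forall x, a <= x -> derive1 f x = 0.
Proof.
move=> sf H x ax.
have sg : smooth (fun y => f (- y)).
  by apply: smooth_comp => //; apply: smoothN; exact: smooth_id.
have := @derive1_cst_left (fun y => f (- y)) c (- a) sg.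
move=> /(_ _ (- x)); rewrite lerN2 => /(_ _ ax) E.
have : derive1 (fun y => f (- y)) (- x) = 0.
  by apply: E => y ya; apply: H; rewrite lerNr.
have Hd : is_derive (- x) (1 : R) (fun y => f (- y)) (derive1 f x * -1).
  apply: (der_comp _ (der_N (der_id _))).
  by rewrite opprK; exact: smooth_is_derive.
rewrite (derive1_is_derive Hd) => /eqP.
by rewrite mulf_eq0 oppr_eq0 oner_eq0 orbF => /eqP.
Qed.

Lemma continuous_bounded_support (g : R -> R) (M : R) : 0 <= M ->
  continuous g -> (forall x, M <= `|x| -> g x = 0) ->
  exists2 L : R, 0 <= L & forall x, `|g x| <= L.
Proof.
move=> M0 cg g0.
have [||c _ Hc] := @EVT_max R (fun x => `|g x|) (- M) M.
- by rewrite (le_trans _ M0) // oppr_le0.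
- apply: continuous_subspaceT => x.
  by apply: (@cvg_norm _ _ _ _ _ g); exact: cg.
exists `|g c|; first exact: normr_ge0.
move=> x; have [Mx|xM] := leP M `|x|; first by rewrite g0 // normr0 normr_ge0.
by apply: Hc; rewrite in_itv /= -ler_norml ltW.
Qed.

Lemma derivable_bounded_lipschitz (g : R -> R) (L : R) :
  (forall x, derivable g x 1) -> (forall x, `|derive1 g x| <= L) ->
  forall x y, `|g x - g y| <= L * `|x - y|.
Proof.
move=> dg H.
have W x y : x < y -> `|g y - g x| <= L * `|y - x|.
  move=> xy; have [||c _ ->] := @MVT R g (derive1 g) x y xy.
  - by move=> z _; apply: DeriveDef => //; rewrite derive1E.
  - by apply: derivable_within_continuous => z _.
  by rewrite normrM ler_wpM2r.
move=> x y; have [xy|xy|->] := ltgtP x y; last by rewrite !subrr normr0 mulr0.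
  by rewrite distrC [`|x - y|]distrC; exact: W.
exact: W.
Qed.

(** A smooth function with bounded support has a bounded derivative.  The
    constant serves both bounds, as the existence theorem for differential
    equations asks for a bounded Lipschitz field. *)
Lemma smooth_support_lipschitz (g : R -> R) (M : R) : 0 <= M ->
  smooth g -> (forall x, M <= `|x| -> g x = 0) ->
  exists2 L : R, 0 <= L & forall x, `|g x| <= L /\
     forall y, `|g x - g y| <= L * `|x - y|.
Proof.
move=> M0 sg g0.
have [L L0 HL] := continuous_bounded_support M0 (smooth_continuous sg) g0.
have [||L' L'0 HL'] := @continuous_bounded_support (derive1 g) M M0.
- by apply: smooth_continuous; exact: smooth_derive1.
- move=> x; rewrite ler_normr => /orP[Mx|Mx].
    apply: (@derive1_cst_right g 0 M) => // y My; apply: g0.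
    by rewrite ler_normr My.
  apply: (@derive1_cst_left g 0 (- M)) => //; last by rewrite lerNr.
  by move=> y yM; apply: g0; rewrite ler_normr lerNr yM orbT.
exists (L + L'); first exact: addr_ge0.
move=> x; split; first by rewrite (le_trans (HL x)) // lerDl.
move=> y; apply: le_trans (derivable_bounded_lipschitz _ HL' x y) _.
  by move=> z; exact: smooth_derivable.
by rewrite ler_wpM2r // lerDr.
Qed.

End SmoothMore.

(** * The radial profile and its oscillation *)

Section Profile.
Variables (R : realType) (qm qp B : R).
Hypothesis qmp : qm < qp.

Definition flat_exp : R -> R := flat 0 1 0.
Definition flat_cos : R -> R := flat B 1 0.
Definition flat_sin : R -> R := flat B 0 1.

Lemma flatE x : 0 < x -> [/\ flat_exp x = expR (- x^-1),
  flat_cos x = expR (- x^-1) * cos (B * x^-1) & flat_sin x = expR (- x^-1) * sin (B * x^-1)].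
Proof.
move=> x0; rewrite /flat_exp /flat_cos /flat_sin !flat_pos // !hornerC !mul0r cos0 ?sin0.
by split; ring.
Qed.

Lemma flatE0 x : x <= 0 -> [/\ flat_exp x = 0, flat_cos x = 0 & flat_sin x = 0].
Proof. by move=> x0; rewrite /flat_exp /flat_cos /flat_sin !flat_neg. Qed.

Lemma flatE_ge0 x : 0 <= flat_exp x.
Proof.
have [x0|x0] := ltP 0 x; first by have [-> _ _] := flatE x0; exact: expR_ge0.
by have [-> _ _] := flatE0 x0.
Qed.

Definition denominator (q : R) : R := flat_exp (qp - q) + flat_exp (q - qm).

(** The two flat exponentials never vanish together because [qm < qp]. *)
Lemma denominator_gt0 q : 0 < denominator q.
Proof.
have [q1|q1] := ltP q qp.
  rewrite ltr_wpDr ?flatE_ge0 //.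
  by have [|-> _ _] := @flatE (qp - q); rewrite ?subr_gt0 // expR_gt0.
rewrite ltr_wpDl ?flatE_ge0 //.
have [|-> _ _] := @flatE (q - qm); rewrite ?expR_gt0 // subr_gt0.
exact: lt_le_trans qmp q1.
Qed.

(** Inside the interval this is the logistic function of [tau]
    ([step_inside]); the quotient of flat functions shows the smoothness across
    the end points. *)
Definition step (q : R) : R := flat_exp (q - qm) / denominator q.

(** The addition formulas turn these expressions into [step (1 - step)] times
    the cosine and the sine of [B tau] ([wave_inside]), a phase that is
    unbounded near both end points; in this form they are visibly smooth. *)
Definition wave1 (q : R) : R :=
  (flat_cos (qp - q) * flat_cos (q - qm) + flat_sin (qp - q) * flat_sin (q - qm)) / denominator q ^+ 2.

Definition wave2 (q : R) : R :=
  (flat_sin (qp - q) * flat_cos (q - qm) - flat_cos (qp - q) * flat_sin (q - qm)) / denominator q ^+ 2.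

Lemma smooth_affine : smooth (fun q => qp - q : R) /\ smooth (fun q => q - qm : R).
Proof.
split; apply: smoothD; try exact: smooth_cst; try exact: smooth_id.
by apply: smoothN; exact: smooth_id.
Qed.

Lemma smooth_flat_affine b p r : smooth (fun q => flat b p r (qp - q)) /\
  smooth (fun q => flat b p r (q - qm)).
Proof.
have [sp sm] := smooth_affine.
by split; apply: smooth_comp => //; exact: smooth_flat.
Qed.

Lemma smooth_denominator : smooth denominator.
Proof. by have [? ?] := smooth_flat_affine 0 1 0; exact: smoothD. Qed.

Lemma smooth_step : smooth step.
Proof.
apply: smoothM; first by case: (smooth_flat_affine 0 1 0).
apply: smoothV; first by move=> x; rewrite gt_eqF // denominator_gt0.
exact: smooth_denominator.
Qed.

Lemma smooth_waves : smooth wave1 /\ smooth wave2.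
Proof.
have [Cp Cm] := smooth_flat_affine B 1 0; have [Sp Sm] := smooth_flat_affine B 0 1.
have sd : smooth (fun q => (denominator q ^+ 2)^-1).
  apply: smoothV; last by apply: smoothX; exact: smooth_denominator.
  by move=> x; rewrite expf_neq0 // gt_eqF // denominator_gt0.
split; apply: smoothM => //; apply: smoothD; do ?exact: smoothM.
by apply: smoothN; exact: smoothM.
Qed.

Lemma step_left q : q <= qm -> step q = 0.
Proof.
move=> h; have [|e _ _] := @flatE0 (q - qm); first by rewrite subr_le0.
by rewrite /step e mul0r.
Qed.

Lemma step_right q : qp <= q -> step q = 1.
Proof.
move=> h; have [|e _ _] := @flatE0 (qp - q); first by rewrite subr_le0.
have n0 : denominator q != 0 by rewrite gt_eqF // denominator_gt0.
by rewrite /step -[flat_exp _]add0r -e divff.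
Qed.

Lemma wave_left q : q <= qm -> wave1 q = 0 /\ wave2 q = 0.
Proof.
move=> h; have [|_ e1 e2] := @flatE0 (q - qm); first by rewrite subr_le0.
by rewrite /wave1 /wave2 e1 e2 !mulr0 subr0 addr0 mul0r.
Qed.

Lemma wave_right q : qp <= q -> wave1 q = 0 /\ wave2 q = 0.
Proof.
move=> h; have [|_ e1 e2] := @flatE0 (qp - q); first by rewrite subr_le0.
by rewrite /wave1 /wave2 e1 e2 !mul0r subr0 addr0 mul0r.
Qed.

Definition tau (q : R) : R := (qp - q)^-1 - (q - qm)^-1.

Definition dtau (q : R) : R := (qp - q) ^- 2 + (q - qm) ^- 2.

Lemma der_tau q : qm < q -> q < qp -> is_derive q (1 : R) tau (dtau q).
Proof.
move=> h1 h2.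
have n1 : qp - q != 0 by rewrite gt_eqF // subr_gt0.
have n2 : q - qm != 0 by rewrite gt_eqF // subr_gt0.
have d1 := der_V (der_D (der_cst qp q) (der_N (der_id q))) n1.
have d2 := der_V (der_D (der_id q) (der_cst (- qm) q)) n2.
apply: (is_derive_eq (der_D d1 (der_N d2))).
by rewrite /dtau; field; rewrite n1 n2.
Qed.

Lemma step_inside q : qm < q -> q < qp -> step q = (1 + expR (- tau q))^-1.
Proof.
move=> h1 h2; rewrite /step /denominator.
have [|-> _ _] := @flatE (q - qm); first by rewrite subr_gt0.
have [|-> _ _] := @flatE (qp - q); first by rewrite subr_gt0.
have -> : expR (- tau q) = expR (- (qp - q)^-1) / expR (- (q - qm)^-1).
  by rewrite -expRN -expRD; congr expR; rewrite /tau; ring.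
set a := expR (- (qp - q)^-1); set b := expR _.
have a0 : 0 < a by exact: expR_gt0.
have b0 : 0 < b by exact: expR_gt0.
by field; rewrite !gt_eqF // addr_gt0.
Qed.

Lemma step_gt0_lt1 q : qm < q -> q < qp -> 0 < step q < 1.
Proof.
move=> h1 h2; rewrite step_inside // invr_gt0 invf_lt1 ?ltrDl ?expR_gt0 //.
by rewrite addr_gt0 // expR_gt0.
Qed.

Lemma der_step q : qm < q -> q < qp ->
  is_derive q (1 : R) step (step q * (1 - step q) * dtau q).
Proof.
move=> h1 h2.
have e0 : 0 < expR (- tau q) by exact: expR_gt0.
have n0 : 1 + expR (- tau q) != 0 by rewrite gt_eqF // addr_gt0.
have d := der_V (der_D (der_cst 1 q) (der_expR (der_N (der_tau h1 h2)))) n0.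
apply: (near_eq_is_derive _ (is_derive_eq d _)).
  near=> z; rewrite step_inside //; near: z; [exact: lt_nbhsr | exact: lt_nbhsl].
by rewrite step_inside //; field.
Unshelve. all: by end_near. Qed.

Lemma wave_inside q : qm < q -> q < qp ->
  wave1 q = step q * (1 - step q) * cos (B * tau q) /\
  wave2 q = step q * (1 - step q) * sin (B * tau q).
Proof.
move=> h1 h2; have n0 : denominator q != 0 by rewrite gt_eqF // denominator_gt0.
have sE : step q * (1 - step q) = flat_exp (qp - q) * flat_exp (q - qm) / denominator q ^+ 2.
  rewrite /step; have -> : flat_exp (qp - q) = denominator q - flat_exp (q - qm).
    by rewrite /denominator addrK.
  by field.
rewrite sE /wave1 /wave2 /tau.
have [|-> -> ->] := @flatE (q - qm); first by rewrite subr_gt0.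
have [|-> -> ->] := @flatE (qp - q); first by rewrite subr_gt0.
rewrite mulrBr cosB sinB; split; by field.
Qed.

Lemma der_wave q : qm < q -> q < qp ->
  is_derive q (1 : R) wave1 (step q * (1 - step q) * dtau q *
    ((1 - 2 * step q) * cos (B * tau q) - B * sin (B * tau q))) /\
  is_derive q (1 : R) wave2 (step q * (1 - step q) * dtau q *
    ((1 - 2 * step q) * sin (B * tau q) + B * cos (B * tau q))).
Proof.
move=> h1 h2; have ds := der_step h1 h2.
have dB := der_M (der_cst B q) (der_tau h1 h2).
have ds' := der_M ds (der_D (der_cst 1 q) (der_N ds)).
split.
  apply: (near_eq_is_derive _ (is_derive_eq (der_M ds' (der_cos dB)) _)).
    near=> z; have [||-> _] // := @wave_inside z; near: z;
      [exact: lt_nbhsr | exact: lt_nbhsl].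
  by ring.
apply: (near_eq_is_derive _ (is_derive_eq (der_M ds' (der_sin dB)) _)).
  near=> z; have [||_ ->] // := @wave_inside z; near: z;
    [exact: lt_nbhsr | exact: lt_nbhsl].
by ring.
Unshelve. all: by end_near. Qed.

(** The last two bounds say that a large [|tau|] means closeness to the
    corresponding end point, at an explicit rate. *)
Lemma tau_bounds q : qm < q -> q < qp ->
  [/\ 0 < dtau q, 1 <= dtau q * (qp - qm) ^+ 2,
      0 < tau q -> qp - q < (tau q)^-1 & tau q < 0 -> q - qm < (- tau q)^-1].
Proof.
move=> h1 h2; have x0 : 0 < qp - q by rewrite subr_gt0.
have y0 : 0 < q - qm by rewrite subr_gt0.
have X0 : 0 < (qp - q)^-1 by rewrite invr_gt0.
have Y0 : 0 < (q - qm)^-1 by rewrite invr_gt0.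
split.
- by rewrite addr_gt0 // invr_gt0 exprn_gt0.
- rewrite /dtau mulrDl -(mulVf (_ : (qp - q) ^+ 2 != 0)); last first.
    by rewrite expf_neq0 // gt_eqF.
  rewrite -[leLHS]addr0 lerD //; last first.
    by rewrite mulr_ge0 ?invr_ge0 ?sqr_ge0.
  rewrite ler_wpM2l ?invr_ge0 ?sqr_ge0 // ler_sqr ?nnegrE ?ltW //; last first.
    by rewrite subr_gt0.
  by rewrite ltrD2l ltrN2.
- move=> t0; rewrite -[ltLHS]invrK ltf_pV2 ?posrE //.
  by rewrite /tau ltrBlDr ltrDl.
- move=> t0; rewrite -[ltLHS]invrK ltf_pV2 ?posrE ?oppr_gt0 //.
  by rewrite /tau opprB ltrBlDr ltrDl.
Qed.

End Profile.

(** * Antiderivatives and comparison *)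

Section Calculus.
Variable R : realType.
Implicit Types (f g h dh : R -> R).

Lemma is_derive_continuous h dh :
  (forall t, is_derive t (1 : R) h (dh t)) -> continuous h.
Proof.
move=> Hd t; apply: differentiable_continuous; apply/derivable1_diffP.
by have [] := Hd t.
Qed.

Lemma le_of_derive_ge0 h dh (a b : R) : a <= b ->
  (forall t, is_derive t (1 : R) h (dh t)) ->
  (forall t, a <= t <= b -> 0 <= dh t) -> h a <= h b.
Proof.
move=> ab Hd H.
have [|c cab] := MVT_segment ab (fun t _ => Hd t).
  apply: continuous_subspaceT; exact: is_derive_continuous Hd.
rewrite -subr_ge0 => ->; rewrite mulr_ge0 ?subr_ge0 //; apply: H.
by move: cab; rewrite in_itv.
Qed.

(** Integration of the bound on the derivative: [K e^(c|t|)] dominates on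
    both half-lines.  This is one step of a Picard iteration measured in a norm
    with exponential weight. *)
Lemma exp_bound h dh (c K : R) : 0 <= K -> h 0 = 0 ->
  (forall t, is_derive t (1 : R) h (dh t)) ->
  (forall t, `|dh t| <= c * K * expR (c * `|t|)) ->
  forall t, `|h t| <= K * expR (c * `|t|).
Proof.
move=> K0.
suff W h1 dh1 : h1 0 = 0 -> (forall t, is_derive t (1 : R) h1 (dh1 t)) ->
    (forall t, `|dh1 t| <= c * K * expR (c * `|t|)) ->
    forall t, 0 <= t -> `|h1 t| <= K * expR (c * `|t|).
  move=> h0 Hd H t; have [t0|t0] := leP 0 t; first exact: (W h dh).
  rewrite -[t in h t]opprK -[`|t|]normrN.
  have Hd' s : is_derive s (1 : R) (fun s => h (- s)) (dh (- s) * -1).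
    exact: (der_comp (Hd _) (der_N (der_id s))).
  apply: (W _ _ _ Hd'); last by rewrite oppr_ge0 ltW.
  - by rewrite oppr0.
  - by move=> s; rewrite mulrN1 normrN -[`|s|]normrN.
move=> h0 Hd H t t0; rewrite ler_norml.
have dE s : is_derive s (1 : R) (fun s => K * expR (c * s)) (c * K * expR (c * s)).
  apply: (is_derive_eq (der_M (der_cst K s) (der_expR (der_M (der_cst c s) (der_id s))))).
  by ring.
have tE : `|t| = t by rewrite ger0_norm.
have P s : 0 <= s <= t -> - (c * K * expR (c * s)) <= dh1 s <= c * K * expR (c * s).
  by move=> /andP[s0 _]; have := H s; rewrite ler_norml ger0_norm.
rewrite tE; apply/andP; split.
  have := @le_of_derive_ge0 (fun s => h1 s + K * expR (c * s))
    (fun s => dh1 s + c * K * expR (c * s)) 0 t t0.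
  move=> /(_ (fun s => der_D (Hd s) (dE s))).
  rewrite h0 mulr0 expR0 mulr1 add0r => W.
  rewrite lerNl -subr_ge0 opprK addrC; apply: le_trans K0 (W _) => s st.
  by have /andP[+ _] := P s st; rewrite -subr_ge0 opprK.
have := @le_of_derive_ge0 (fun s => K * expR (c * s) - h1 s)
  (fun s => c * K * expR (c * s) - dh1 s) 0 t t0.
move=> /(_ (fun s => der_D (dE s) (der_N (Hd s)))).
rewrite h0 mulr0 expR0 mulr1 subr0 => W.
rewrite -subr_ge0; apply: le_trans K0 (W _) => s st.
by have /andP[_] := P s st; rewrite subr_ge0.
Qed.

Lemma half_line_antiderivative g (a : R) : continuous g ->
  exists H : R -> R, forall t, a < t -> is_derive t (1 : R) H (g t).
Proof.
move=> cg.
pose F x := (\int[@lebesgue_measure R]_(t in [set` `[a, x]]) g t)%R.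
exists F => t at_.
have [||d e] := @continuous_FTC1_closed R g a t (t + 1) _ _ at_ (cg t).
- by rewrite ltrDl.
- apply: continuous_compact_integrable; first exact: segment_compact.
  exact: continuous_subspaceT.
by apply: DeriveDef; [exact: d | rewrite -derive1E; exact: e].
Qed.

(** The fundamental theorem of calculus gives an antiderivative to the right of
    a base point.  Applied to [g] and to its reflection, it gives two that
    overlap around [0], where their difference is constant, so they glue. *)
Lemma antiderivative g : continuous g ->
  exists G : R -> R, G 0 = 0 /\ forall t, is_derive t (1 : R) G (g t).
Proof.
move=> cg; have [H1 D1] := half_line_antiderivative (-1) cg.
have [H2 D2] : exists H, forall t : R, -1 < t -> is_derive t (1 : R) H (g (- t)).
  apply: (@half_line_antiderivative (fun t => g (- t))) => t.
  by apply: continuous_comp; [exact: opp_continuous | exact: cg].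
have D3 (t : R) : t < 1 -> is_derive t (1 : R) (fun s => - H2 (- s)) (g t).
  move=> t1; have t1' : -1 < - t by rewrite ltrN2.
  apply: (is_derive_eq (der_N (der_comp (D2 _ t1') (der_N (der_id t))))).
  by rewrite opprK mulrN1 opprK.
have cst (t : R) : -1 < t -> t < 1 -> H1 t + H2 (- t) = H1 0 + H2 0.
  move=> t1 t2.
  pose D s := H1 s + - - H2 (- s).
  have dD (s : R) : -1 < s -> s < 1 -> is_derive s (1 : R) D 0.
    move=> s1 s2; apply: (is_derive_eq (der_D (D1 s s1) (der_N (D3 s s2)))).
    by rewrite subrr.
  have W (x y : R) : -1 < x -> x <= y -> y < 1 -> D x = D y.
    move=> x1 xy y1; apply/esym/eqP; rewrite -subr_eq0.
    have [||c cxy ->] := @MVT_segment R D (fun=> 0) x y xy; last by rewrite mul0r.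
    - move=> s; rewrite in_itv /= => /andP[xs sy].
      by apply: dD; [exact: lt_trans xs|exact: lt_trans sy y1].
    - apply: derivable_within_continuous => s; rewrite in_itv /= => /andP[xs sy].
      by have [] := dD s (lt_le_trans x1 xs) (le_lt_trans sy y1).
  have : D t = D 0.
    have [t0|t0] := leP 0 t; last first.
      by apply: W => //; exact: ltW.
    by apply/esym; apply: W => //; lra.
  by rewrite /D oppr0 !opprK.
exists (fun t => if 0 <= t then H1 t - H1 0 else H2 0 - H2 (- t)).
split; first by rewrite lexx subrr.
move=> t; have [t0|t0] := ltP t 0.
  have d : is_derive t (1 : R) (fun s => H2 0 - H2 (- s)) (g t).
    apply: (is_derive_eq (der_D (der_cst (H2 0) t) (D3 t _))); last by rewrite add0r.
    exact: lt_trans t0 ltr01.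
  apply: near_eq_is_derive d; near=> s; rewrite leNgt ifN // negbK.
  by near: s; exact: lt_nbhsl.
have t1 : -1 < t by apply: lt_le_trans t0; rewrite ltrN10.
have d : is_derive t (1 : R) (fun s => H1 s - H1 0) (g t).
  by apply: (is_derive_eq (der_D (D1 t t1) (der_cst (- H1 0) t))); rewrite addr0.
apply: near_eq_is_derive d; near=> s; case: ifPn => //; rewrite -ltNge => s0.
have s1 : -1 < s by near: s; exact: lt_nbhsr.
have := cst s s1 (lt_trans s0 ltr01) => e.
by lra.
Unshelve. all: by end_near. Qed.

(** [X n + e n] decreases and [X n - e n] increases for the tail [e n] of the
    geometric series; the limit comes with a rate, which is needed uniformly in
    a parameter. *)
Lemma geometric_limit (X : nat -> R) (M : R) : 0 <= M ->
  (forall n, `|X n.+1 - X n| <= M / 2 ^+ n) ->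
  exists l, forall n, `|X n - l| <= 2 * M / 2 ^+ n.
Proof.
move=> M0 H.
pose e n : R := 2 * M / 2 ^+ n.
have eS n : e n = e n.+1 + M / 2 ^+ n.
  by rewrite /e exprS; field; rewrite expf_neq0.
have e0 n : 0 <= e n by rewrite /e divr_ge0 ?mulr_ge0 ?exprn_ge0.
pose Y n := X n + e n; pose Z n := X n - e n.
have Yd : nonincreasing_seq Y.
  apply/nonincreasing_seqP => n; rewrite /Y (eS n).
  by have := H n; rewrite ler_norml => /andP[_]; lra.
have Zi : nondecreasing_seq Z.
  apply/nondecreasing_seqP => n; rewrite /Z (eS n).
  by have := H n; rewrite ler_norml => /andP[+ _]; lra.
have ZY n m : Z n <= Y m.
  apply: (@le_trans _ _ (Z (maxn n m))); first by apply: Zi; exact: leq_maxl.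
  apply: (@le_trans _ _ (Y (maxn n m))); last by apply: Yd; exact: leq_maxr.
  by rewrite /Z /Y lerD2l (le_trans _ (e0 _)) // oppr_le0.
have lbY : has_lbound (range Y) by exists (Z 0%N) => _ [m _ <-].
have cY : cvgn Y by exact: nonincreasing_is_cvgn.
exists (limn Y) => n; rewrite ler_norml.
have h1 : limn Y <= Y n by exact: nonincreasing_cvgn_ge.
have h2 : Z n <= limn Y by apply: limr_ge => //; apply: nearW => m.
by move: h1 h2; rewrite /Y /Z -/(e n) => h1 h2; apply/andP; split; lra.
Qed.

Lemma eq0_geometric (d M : R) : (forall n, `|d| <= M / 2 ^+ n) -> d = 0.
Proof.
move=> H; apply/eqP; rewrite -normr_le0 leNgt; apply/negP => d0.
have M0 : 0 < M by apply: lt_le_trans d0 _; have := H 0%N; rewrite expr0 divr1.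
have L : (fun n => M * (2^-1 ^+ n)) @ \oo --> M * 0.
  by apply: cvgMr; apply: cvg_expr; rewrite ger0_norm // invf_lt1 // ltr1n.
rewrite mulr0 in L; move/cvgrPdist_lt : L => /(_ _ d0)[n _ /(_ n (leqnn n))] /=.
rewrite sub0r normrN ger0_norm ?mulr_ge0 ?exprn_ge0 ?invr_ge0 ?ltW //.
by rewrite ltNge exprVn H.
Qed.

Lemma lipschitz_continuous1 h (k : R) :
  (forall s t, `|h s - h t| <= k * `|s - t|) -> continuous h.
Proof.
move=> H t; apply/cvgrPdist_le => e e0; near=> s.
apply: le_trans (H _ _) _; rewrite distrC.
have : `|s - t| <= e / (`|k| + 1).
  near: s; apply/nbhs_ballP; exists (e / (`|k| + 1)).
    by rewrite /= divr_gt0 // ltr_wpDl.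
  by move=> s /ltW; rewrite distrC.
rewrite ler_pdivlMr ?ltr_wpDl // mulrC => hh.
by rewrite distrC in hh *; apply: le_trans hh; rewrite ler_wpM2r // (le_trans (ler_norm k)) // lerDl.
Unshelve. all: by end_near. Qed.

Lemma is_derive_lipschitz h dh (L : R) :
  (forall t, is_derive t (1 : R) h (dh t)) -> (forall t, `|dh t| <= L) ->
  forall s t, `|h s - h t| <= L * `|s - t|.
Proof.
move=> Hd H; apply: derivable_bounded_lipschitz => t; first by have [] := Hd t.
by rewrite (derive1_is_derive (Hd t)).
Qed.

End Calculus.

(** * Global solutions of planar differential equations *)

Section CauchyLipschitz.
Variables (R : realType) (V1 V2 : R -> R -> R) (L : R).
Hypothesis L0 : 0 < L.
Hypothesis bnd : forall a b, `|V1 a b| <= L /\ `|V2 a b| <= L.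
Hypothesis lip : forall a b a' b',
  `|V1 a b - V1 a' b'| <= L * (`|a - a'| + `|b - b'|) /\
  `|V2 a b - V2 a' b'| <= L * (`|a - a'| + `|b - b'|).

Let prim (g : R -> R) : R -> R :=
  xget (fun=> 0) [set G | G 0 = 0 /\ forall t : R, is_derive t (1 : R) G (g t)].

Let primP g : continuous g ->
  prim g 0 = 0 /\ forall t : R, is_derive t (1 : R) (prim g) (g t).
Proof. by move=> /antiderivative; exact: xgetPex. Qed.

Let field_continuous (x y : R -> R) :
  (forall s t, `|x s - x t| <= L * `|s - t|) ->
  (forall s t, `|y s - y t| <= L * `|s - t|) ->
  continuous (fun t => V1 (x t) (y t)) /\ continuous (fun t => V2 (x t) (y t)).
Proof.
move=> lx ly; split; apply: (@lipschitz_continuous1 _ _ (L * (2 * L))) => s t;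
  have [h1 h2] := lip (x s) (y s) (x t) (y t).
  apply: le_trans h1 _; rewrite -mulrA ler_wpM2l ?(ltW L0) // -mulrA.
  by have := lx s t; have := ly s t; lra.
apply: le_trans h2 _; rewrite -mulrA ler_wpM2l ?(ltW L0) // -mulrA.
by have := lx s t; have := ly s t; lra.
Qed.

(** Picard iteration.  In the norm with weight [e^(-4L|t|)] the iteration is a
    contraction on the whole line, so no continuation of local solutions is
    needed.  The limit inherits the Lipschitz bound of the iterates, and is
    within [2^(-n)] of its own image for every [n]. *)
Theorem global_solution (a0 b0 : R) : exists x y : R -> R,
  [/\ x 0 = a0, y 0 = b0,
      forall t : R, is_derive t (1 : R) x (V1 (x t) (y t)) &
      forall t : R, is_derive t (1 : R) y (V2 (x t) (y t))].
Proof.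
pose next (p : (R -> R) * (R -> R)) : (R -> R) * (R -> R) :=
  (fun t => a0 + prim (fun s => V1 (p.1 s) (p.2 s)) t,
   fun t => b0 + prim (fun s => V2 (p.1 s) (p.2 s)) t).
pose Lip (p : (R -> R) * (R -> R)) :=
  (forall s t, `|p.1 s - p.1 t| <= L * `|s - t|) /\
  (forall s t, `|p.2 s - p.2 t| <= L * `|s - t|).
have nextP p : Lip p -> [/\ (next p).1 0 = a0, (next p).2 0 = b0,
    forall t : R, is_derive t (1 : R) (next p).1 (V1 (p.1 t) (p.2 t)) &
    forall t : R, is_derive t (1 : R) (next p).2 (V2 (p.1 t) (p.2 t))].
  move=> [l1 l2]; have [c1 c2] := field_continuous l1 l2.
  have [z1 d1] := primP c1; have [z2 d2] := primP c2.
  split=> /=; rewrite ?z1 ?z2 ?addr0 // => t.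
    by apply: (is_derive_eq (der_D (der_cst a0 t) (d1 t))); rewrite add0r.
  by apply: (is_derive_eq (der_D (der_cst b0 t) (d2 t))); rewrite add0r.
have nextL p : Lip p -> Lip (next p).
  move=> /nextP[_ _ d1 d2]; split.
    by apply: (is_derive_lipschitz d1) => t; have [] := bnd (p.1 t) (p.2 t).
  by apply: (is_derive_lipschitz d2) => t; have [] := bnd (p.1 t) (p.2 t).
pose P n := iter n next (fun=> a0, fun=> b0).
have PL n : Lip (P n).
  elim: n => [|n IH]; last exact: nextL.
  by split=> s t; rewrite subrr normr0 mulr_ge0 // ltW.
(* Two coordinates, times the factor 2 that the contraction has to beat. *)
pose c := 4 * L.
have PP n := nextP _ (PL n).
have e0 (t : R) : 0 < expR (c * `|t|) by exact: expR_gt0.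
have cK (K E : R) : c * K * E = L * (4 * (K * E)) by rewrite /c; ring.
have compare p q (K : R) : Lip p -> Lip q -> 0 <= K ->
    (forall t, `|p.1 t - q.1 t| <= 2 * K * expR (c * `|t|) /\
               `|p.2 t - q.2 t| <= 2 * K * expR (c * `|t|)) ->
    forall t, `|(next p).1 t - (next q).1 t| <= K * expR (c * `|t|) /\
              `|(next p).2 t - (next q).2 t| <= K * expR (c * `|t|).
  move=> /nextP[p1 p2 dp1 dp2] /nextP[q1 q2 dq1 dq2] K0 H t; split.
    apply: (exp_bound K0 _ (fun t => der_D (dp1 t) (der_N (dq1 t)))) => [|s].
      by rewrite p1 q1 subrr.
    have [h1 _] := lip (p.1 s) (p.2 s) (q.1 s) (q.2 s).
    apply: le_trans h1 _; rewrite cK ler_wpM2l ?(ltW L0) //.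
    by have [] := H s; lra.
  apply: (exp_bound K0 _ (fun t => der_D (dp2 t) (der_N (dq2 t)))) => [|s].
    by rewrite p2 q2 subrr.
  have [_ h1] := lip (p.1 s) (p.2 s) (q.1 s) (q.2 s).
  apply: le_trans h1 _; rewrite cK ler_wpM2l ?(ltW L0) //.
  by have [] := H s; lra.
have step n t : `|(P n.+1).1 t - (P n).1 t| <= expR (c * `|t|) / 2 ^+ n /\
                `|(P n.+1).2 t - (P n).2 t| <= expR (c * `|t|) / 2 ^+ n.
  elim: n t => [|n IH] t.
    have [z1 z2 d1 d2] := PP 0%N; rewrite expr0 divr1 -[expR _]mul1r.
    split.
      apply: (exp_bound ler01 _ (fun t => der_D (d1 t) (der_cst (- a0) t))) => [|s].
        by rewrite z1 subrr.
      rewrite addr0 mulr1; have [h _] := bnd a0 b0; apply: le_trans h _.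
      rewrite /c; have : 1 <= expR (4 * L * `|s|).
        by rewrite -expR0 ler_expR !mulr_ge0 // (ltW L0).
      by have := L0; nra.
    apply: (exp_bound ler01 _ (fun t => der_D (d2 t) (der_cst (- b0) t))) => [|s].
      by rewrite z2 subrr.
    rewrite addr0 mulr1; have [_ h] := bnd a0 b0; apply: le_trans h _.
    rewrite /c; have : 1 <= expR (4 * L * `|s|).
      by rewrite -expR0 ler_expR !mulr_ge0 // (ltW L0).
    by have := L0; nra.
  have := @compare (P n.+1) (P n) (2 ^+ n.+1)^-1 (PL _) (PL _).
  rewrite invr_ge0 exprn_ge0 // => /(_ isT) W.
  rewrite ![expR _ / _]mulrC; apply: W => s.
  suff -> : 2 * (2 ^+ n.+1)^-1 = (2 ^+ n)^-1 :> R by rewrite [_^-1 * _]mulrC.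
  by rewrite exprS invfM mulrA divff ?mul1r.
have lims t : exists l : R * R, forall n,
    `|(P n).1 t - l.1| <= 2 * expR (c * `|t|) / 2 ^+ n /\
    `|(P n).2 t - l.2| <= 2 * expR (c * `|t|) / 2 ^+ n.
  have [l1 h1] := geometric_limit (ltW (e0 t)) (fun n => (step n t).1).
  have [l2 h2] := geometric_limit (ltW (e0 t)) (fun n => (step n t).2).
  by exists (l1, l2) => n.
have [l lP] := choice lims.
pose q : (R -> R) * (R -> R) := (fun t => (l t).1, fun t => (l t).2).
(* Passing the Lipschitz bound of the iterates to the limit costs the
   approximation error, which tends to zero. *)
have tends (s t : R) : exists M : R, forall n,
    `|q.1 s - q.1 t| <= L * `|s - t| + M / 2 ^+ n /\
    `|q.2 s - q.2 t| <= L * `|s - t| + M / 2 ^+ n.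
  exists (2 * expR (c * `|s|) + 2 * expR (c * `|t|)) => n.
  have [s1 s2] := lP s n; have [t1 t2] := lP t n; have [p1 p2] := PL n.
  rewrite mulrDl; split.
    have -> : q.1 s - q.1 t = ((P n).1 s - (P n).1 t) +
      (- ((P n).1 s - (l s).1) + ((P n).1 t - (l t).1)) by rewrite /q /=; ring.
    apply: le_trans (ler_normD _ _) _; apply: lerD; first exact: p1.
    by apply: le_trans (ler_normD _ _) _; rewrite normrN; exact: lerD.
  have -> : q.2 s - q.2 t = ((P n).2 s - (P n).2 t) +
    (- ((P n).2 s - (l s).2) + ((P n).2 t - (l t).2)) by rewrite /q /=; ring.
  apply: le_trans (ler_normD _ _) _; apply: lerD; first exact: p2.
  by apply: le_trans (ler_normD _ _) _; rewrite normrN; exact: lerD.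
have qL : Lip q.
  have W (a b M : R) : (forall n, a <= b + M / 2 ^+ n) -> a <= b.
    move=> H; rewrite leNgt; apply/negP => ba.
    have : a - b = 0; last by lra.
    apply: (@eq0_geometric _ _ M) => n; rewrite ger0_norm; last by rewrite subr_ge0 ltW.
    by rewrite lerBlDl; exact: H.
  split=> s t; have [M HM] := tends s t; apply: (W _ _ M) => n;
    by have [] := HM n.
have fixq t : (next q).1 t = q.1 t /\ (next q).2 t = q.2 t.
  have near n : `|(next q).1 t - (P n.+1).1 t| <= expR (c * `|t|) / 2 ^+ n /\
                `|(next q).2 t - (P n.+1).2 t| <= expR (c * `|t|) / 2 ^+ n.
    have := @compare q (P n) (2 ^+ n)^-1 qL (PL _).
    rewrite invr_ge0 exprn_ge0 // => /(_ isT) W.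
    rewrite ![expR _ / _]mulrC; apply: W => s.
    have -> : 2 * (2 ^+ n)^-1 * expR (c * `|s|) = 2 * expR (c * `|s|) / 2 ^+ n by ring.
    by have [h1 h2] := lP s n; split; rewrite distrC.
  have hlf n : 2 * expR (c * `|t|) / 2 ^+ n.+1 = expR (c * `|t|) / 2 ^+ n.
    by rewrite exprS; field; rewrite expf_neq0.
  split; apply/eqP; rewrite -subr_eq0; apply/eqP.
    apply: (@eq0_geometric _ _ (2 * expR (c * `|t|))) => n.
    have [h1 _] := near n; have [h2 _] := lP t n.+1; rewrite hlf in h2.
    have -> : (next q).1 t - q.1 t = ((next q).1 t - (P n.+1).1 t) +
      ((P n.+1).1 t - q.1 t) by ring.
    apply: le_trans (ler_normD _ _) _; apply: le_trans (lerD h1 h2) _.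
    by rewrite -mulrA; lra.
  apply: (@eq0_geometric _ _ (2 * expR (c * `|t|))) => n.
  have [_ h1] := near n; have [_ h2] := lP t n.+1; rewrite hlf in h2.
  have -> : (next q).2 t - q.2 t = ((next q).2 t - (P n.+1).2 t) +
    ((P n.+1).2 t - q.2 t) by ring.
  apply: le_trans (ler_normD _ _) _; apply: le_trans (lerD h1 h2) _.
  by rewrite -mulrA; lra.
have [z1 z2 d1 d2] := nextP q qL.
have e1 : (next q).1 = q.1 by apply/funext => t; case: (fixq t).
have e2 : (next q).2 = q.2 by apply/funext => t; case: (fixq t).
by exists q.1, q.2; rewrite e1 e2 in z1 z2 d1 d2.
Qed.

End CauchyLipschitz.

(** * Scalar differential inequalities *)

Section Dynamics.
Variable R : realType.
Implicit Types (h dh : R -> R).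

Lemma der_reverse h dh : (forall t, is_derive t (1 : R) h (dh t)) ->
  forall t, is_derive t (1 : R) (fun s => h (- s)) (- dh (- t)).
Proof.
move=> Hd t; apply: (is_derive_eq (der_comp (Hd (- t)) (der_N (der_id t)))).
by rewrite mulrN1.
Qed.

Lemma intermediate_value h (a b v : R) : continuous h -> a <= b ->
  h a <= v <= h b -> exists2 c, a <= c <= b & h c = v.
Proof.
move=> ch ab /andP[hav hvb].
have [|c cab <-] := @IVT R h a b v ab (continuous_subspaceT ch).
  by rewrite ge_min hav /= le_max hvb orbT.
by exists c; move: cab; rewrite // in_itv.
Qed.

(** A solution cannot reach a rest point in finite time: [h^2 e^(2Lt)] does not
    decrease for [t >= 0], hence [h] has no zero and keeps its sign.  The past
    is treated by reversing time. *)
Lemma stays_positive h dh (L : R) :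
  (forall t, is_derive t (1 : R) h (dh t)) ->
  (forall t, `|dh t| <= L * `|h t|) -> 0 < h 0 -> forall t, 0 < h t.
Proof.
move=> Hd H h0.
suff W h1 dh1 : (forall t, is_derive t (1 : R) h1 (dh1 t)) ->
  (forall t, `|dh1 t| <= L * `|h1 t|) -> 0 < h1 0 -> forall t, 0 <= t -> 0 < h1 t.
  move=> t; have [t0|t0] := leP 0 t; first exact: (W h dh).
  rewrite -[t]opprK.
  apply: (W _ _ (der_reverse Hd)); rewrite ?oppr0 ?oppr_ge0 ?(ltW t0) // => s.
  by rewrite normrN.
move=> {dh Hd H h0} {}Hd {}H {}h0.
have nz t : 0 <= t -> h1 t != 0.
  move=> t0.
  have dE s : is_derive s (1 : R) (fun s => expR (2 * L * s)) (2 * L * expR (2 * L * s)).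
    apply: (is_derive_eq (der_expR (der_M (der_cst (2 * L) s) (der_id s)))).
    by ring.
  have := le_of_derive_ge0 t0 (fun s => der_M (der_X 2 (Hd s)) (dE s)).
  rewrite mulr0 expR0 mulr1 => W.
  have : 0 < h1 t ^+ 2 * expR (2 * L * t).
    apply: lt_le_trans (W _); first by rewrite exprn_gt0.
    move=> s _; rewrite expr1.
    have -> : 2 * h1 s * dh1 s * expR (2 * L * s) +
       h1 s ^+ 2 * (2 * L * expR (2 * L * s)) =
       2 * expR (2 * L * s) * (h1 s * dh1 s + L * h1 s ^+ 2) by ring.
    rewrite mulr_ge0 ?mulr_ge0 ?expR_ge0 // -[leLHS](subrr (h1 s * dh1 s)) lerD2l.
    apply: le_trans (ler_norm _) _; rewrite normrN normrM.
    apply: le_trans (ler_wpM2l (normr_ge0 _) (H s)) _.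
    by rewrite mulrCA -expr2 real_normK // num_real.
  by rewrite pmulr_lgt0 ?expR_gt0 // exprn_even_gt0.
move=> t t0; rewrite lt0r nz //= leNgt; apply/negP => ht.
have ch : continuous h1 by exact: is_derive_continuous Hd.
have [||c /andP[c0 ct] /eqP] := @intermediate_value (fun s => - h1 s) 0 t 0 _ t0.
- by move=> s; apply: cvgN; exact: ch.
- by rewrite oppr_le0 oppr_ge0 !ltW.
by rewrite oppr_eq0; apply/negP; exact: nz.
Qed.

(** At the last time with [h <= 0] the function vanishes and is positive
    immediately afterwards, so its derivative there cannot be negative. *)
Lemma barrier h dh : (forall t, is_derive t (1 : R) h (dh t)) ->
  (forall t, h t = 0 -> dh t < 0) ->
  forall t0 t, t0 <= t -> h t0 <= 0 -> h t <= 0.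
Proof.
move=> Hd H t0 t t0t ht0; rewrite leNgt; apply/negP => ht.
have ch : continuous h by exact: is_derive_continuous Hd.
pose A := [set s | t0 <= s <= t /\ h s <= 0].
have A0 : A t0 by rewrite /A /= lexx t0t.
have supA : has_sup A by split; [exists t0 | exists t => s [/andP[_ +] _]].
pose m := sup A.
have mt0 : t0 <= m by exact: ub_le_sup (proj2 supA) _ A0.
have mt : m <= t by apply: ge_sup; [exists t0|move=> s [/andP[_ +] _]].
have hm : h m <= 0.
  rewrite leNgt; apply/negP => hm.
  have /nbhs_ballP[e /= e0 He] : \forall s \near m, 0 < h s.
    exact: (cvgr_gt _ (ch m)).
  have [s /[dup] As [_ hs] ms] := sup_adherent e0 supA.
  have sm : s <= m by exact: ub_le_sup (proj2 supA) _ As.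
  have : 0 < h s.
    by apply: He; rewrite /ball /= ger0_norm ?subr_ge0 // ltrBlDl addrC -ltrBlDl.
  by rewrite ltNge hs.
have mt' : m < t.
  by rewrite lt_neqAle mt andbT; apply/eqP => e; move: ht; rewrite -e ltNge hm.
have above s : m < s -> s <= t -> 0 < h s.
  move=> ms st; rewrite ltNge; apply/negP => hs.
  have : s <= m; last by rewrite leNgt ms.
  apply: ub_le_sup (proj2 supA) _ _; split => //.
  by rewrite st andbT (le_trans mt0) // ltW.
have hm0 : h m = 0.
  apply/eqP; rewrite eq_le hm /= leNgt; apply/negP => hm'.
  have /nbhs_ballP[e /= e0 He] : \forall s \near m, h s < 0.
    exact: (cvgr_lt _ (ch m)).
  pose s := Num.min t (m + e / 2).
  have ms : m < s by rewrite lt_min mt' ltrDl divr_gt0.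
  have : h s < 0.
    apply: He; rewrite /ball /= distrC ger0_norm ?subr_ge0 ?(ltW ms) //.
    rewrite ltrBlDl; apply: (@le_lt_trans _ _ (m + e / 2)).
      by rewrite ge_min lexx orbT.
    by rewrite ltrD2l; lra.
  by rewrite ltNge ltW // above // ge_min lexx.
have dm := H m hm0.
have [dv dvE] := Hd m.
have L : (fun k : R => k^-1 *: (h (k *: 1 + m) - h m)) @ 0^' --> dh m.
  by rewrite -dvE; exact: dv.
have N : \forall k \near (0 : R)^', k^-1 *: (h (k *: 1 + m) - h m) < 0.
  exact: cvgr_lt _ L _ dm.
have /nbhs_ballP[e /= e0 He] : \forall k \near (0 : R),
    k != 0 -> k^-1 *: (h (k *: 1 + m) - h m) < 0 by exact: N.
pose k := Num.min (t - m) (e / 2).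
have k0 : 0 < k by rewrite lt_min subr_gt0 mt' divr_gt0.
have : k^-1 *: (h (k *: 1 + m) - h m) < 0.
  apply: He; last by rewrite gt_eqF.
  rewrite /ball /= sub0r normrN gtr0_norm // (@le_lt_trans _ _ (e / 2)) //; last by lra.
  by rewrite ge_min lexx orbT.
rewrite hm0 subr0 [k%:A]mulr1 /GRing.scale /= pmulr_rlt0 ?invr_gt0 //.
rewrite ltNge ltW // above // ?ltrDr // -lerBrDr ge_min lexx //.
Qed.

(** As long as [1 - h >= e], the monotone function [h] has
    [h (1 - h) >= h(0) e] and so grows at least linearly; as [h < 1] this can
    only last for a bounded time. *)
Lemma tends_to_one h dh (k : R) : 0 < k ->
  (forall t, is_derive t (1 : R) h (dh t)) ->
  (forall t, 0 < h t < 1) ->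
  (forall t, k * (h t * (1 - h t)) ^+ 2 <= dh t) ->
  forall e, 0 < e -> exists T : R, forall t, T <= t -> 1 - h t < e.
Proof.
move=> k0 Hd h01 H e e0.
have dh0 t : 0 <= dh t.
  by apply: le_trans (H t); rewrite mulr_ge0 ?sqr_ge0 // ltW.
have mono (s t : R) : s <= t -> h s <= h t.
  by move=> st; apply: (le_of_derive_ge0 st Hd) => x _.
have /andP[a0 a1] := h01 0.
(* A lower bound for the slope as long as [1 - h >= e]. *)
pose m := k * (h 0 * e) ^+ 2.
have m0 : 0 < m by rewrite mulr_gt0 // exprn_gt0 // mulr_gt0.
exists m^-1 => t Tt; rewrite ltNge; apply/negP => et.
have t0 : 0 <= t by apply: le_trans Tt; rewrite invr_ge0 ltW.
have : h 0 - m * 0 <= h t - m * t.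
  apply: (@le_of_derive_ge0 _ (fun s => h s - m * s) (fun s => dh s - m)) => // s.
    apply: (is_derive_eq (der_D (Hd s) (der_N (der_M (der_cst m s) (der_id s))))).
    by ring.
  move=> /andP[s0 st]; rewrite subr_ge0; apply: le_trans (H s).
  rewrite ler_wpM2l ?(ltW k0) // ler_sqr ?nnegrE ?mulr_ge0 ?(ltW a0) ?(ltW e0) //.
  - apply: ler_pM; rewrite ?(ltW a0) ?(ltW e0) //; first exact: mono.
    by apply: le_trans et _; rewrite lerD2l lerN2; exact: mono.
  - by case/andP: (h01 s) => /ltW.
  - by case/andP: (h01 s) => _ /ltW; rewrite subr_ge0.
rewrite mulr0 subr0 => W.
have : 1 <= m * t by rewrite -ler_pdivrMl // mulr1.
by have /andP[_] := h01 t; lra.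
Qed.

End Dynamics.

(** * The potential and its gradient *)

Section DeriveFun.
Variables (R : realType) (V : normedModType R) (f g : V -> R) (p v : V).
Hypotheses (df : differentiable f p) (dg : differentiable g p).

Lemma deriveD_fun : 'D_v (fun x => f x + g x) p = 'D_v f p + 'D_v g p.
Proof. by apply: deriveD; exact: diff_derivable. Qed.

Lemma deriveM_fun : 'D_v (fun x => f x * g x) p = f p * 'D_v g p + g p * 'D_v f p.
Proof. by apply: deriveM; exact: diff_derivable. Qed.

Lemma differentiableM_fun : differentiable (fun x => f x * g x) p.
Proof. exact: differentiableM. Qed.

Lemma differentiableD_fun : differentiable (fun x => f x + g x) p.
Proof. exact: differentiableD. Qed.
End DeriveFun.

Section Potential.
Variables (R : realType) (rm rp : R).
Hypotheses (rm0 : 0 < rm) (rmp : rm < rp).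

Let rp0 : 0 < rp. Proof. exact: lt_trans rm0 rmp. Qed.

Definition qm : R := rm ^+ 2.
Definition qp : R := rp ^+ 2.
(** The amplitude is so small that the oscillating part of the potential never
    outweighs the step: [ampE] makes the part of the radial field that carries
    [cos psi] at most half of the radial field of the step, and keeps the
    potential strictly between [0] and [1]. *)
Definition amp : R := (3 * rp * (qp - qm) ^+ 2 + 2 * rp ^+ 3)^-1.
(** The frequency is so large that the oscillation nevertheless stops the
    radial motion once per turn: by [freqE] the term of the radial field that
    carries [sin psi] outweighs the step when [sin psi = -1]. *)
Definition freq : R := (amp * rm ^+ 3)^-1.

Lemma qmp : qm < qp.
Proof. by rewrite ltr_sqr ?nnegrE // ltW. Qed.

Lemma amp_gt0 : 0 < amp.
Proof.
rewrite invr_gt0 ltr_wpDl ?mulr_gt0 ?exprn_gt0 //.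
by rewrite mulr_ge0 ?sqr_ge0 // mulr_ge0 // ltW.
Qed.

Lemma ampE : 3 * amp * rp * (qp - qm) ^+ 2 + 2 * amp * rp ^+ 3 = 1.
Proof.
have /gt_eqF/negbT n0 := amp_gt0; rewrite invr_eq0 in n0.
by rewrite -[RHS](mulVf n0) -/amp; ring.
Qed.

Lemma freqE : amp * rm ^+ 3 * freq = 1.
Proof. by rewrite mulfV // gt_eqF // mulr_gt0 ?amp_gt0 // exprn_gt0. Qed.

Lemma freq_gt0 : 0 < freq.
Proof. by rewrite invr_gt0 mulr_gt0 ?amp_gt0 // exprn_gt0. Qed.

Local Notation f := (step qm qp).
Local Notation w1 := (wave1 qm qp freq).
Local Notation w2 := (wave2 qm qp freq).

Definition coeff1 (q : R) : R := amp * q * w1 q.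
Definition coeff2 (q : R) : R := amp * q * w2 q.

Lemma smooth_step_annulus : smooth f. Proof. exact: smooth_step qmp. Qed.

Lemma smooth_waves_annulus : smooth w1 /\ smooth w2. Proof. exact: smooth_waves qmp. Qed.

Lemma smooth_coeff : smooth coeff1 /\ smooth coeff2.
Proof.
have [s1 s2] := smooth_waves_annulus.
by split; apply: smoothM => //; apply: smoothM;
  [exact: smooth_cst | exact: smooth_id | exact: smooth_cst | exact: smooth_id].
Qed.

Definition potential (x y : R) : R :=
  f (x ^+ 2 + y ^+ 2) + (coeff1 (x ^+ 2 + y ^+ 2) * x + coeff2 (x ^+ 2 + y ^+ 2) * y).

(** The derivative in [q = x^2 + y^2] with the explicit factors [x], [y] of the
    two coefficients held fixed. *)
Definition radial (x y : R) : R := let q := x ^+ 2 + y ^+ 2 in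
  derive1 f q + (derive1 coeff1 q * x + derive1 coeff2 q * y).

Definition potential_x (x y : R) : R :=
  2 * x * radial x y + coeff1 (x ^+ 2 + y ^+ 2).
Definition potential_y (x y : R) : R :=
  2 * y * radial x y + coeff2 (x ^+ 2 + y ^+ 2).

Lemma smooth_potential_comp (V : normedModType R) (x y : V -> R) :
  smooth x -> smooth y -> smooth (fun p => potential (x p) (y p)).
Proof.
move=> sx sy; have [s1 s2] := smooth_coeff.
have sq : smooth (fun p => x p ^+ 2 + y p ^+ 2).
  by apply: smoothD; exact: smoothX.
apply: smoothD; first exact: (smooth_comp smooth_step_annulus sq).
by apply: smoothD; apply: smoothM => //; [exact: (smooth_comp s1 sq) | exact: (smooth_comp s2 sq)].
Qed.

Lemma derive_potential (V : normedModType R) (x y : V -> R) p v :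
  differentiable x p -> differentiable y p ->
  'D_v (fun p => potential (x p) (y p)) p =
  potential_x (x p) (y p) * 'D_v x p + potential_y (x p) (y p) * 'D_v y p.
Proof.
move=> dx dy; have [s1 s2] := smooth_coeff.
pose q p := x p ^+ 2 + y p ^+ 2.
have dx2 := differentiableM_fun dx dx; have dy2 := differentiableM_fun dy dy.
have dq : differentiable q p by exact: differentiableD_fun dx2 dy2.
have Dq : 'D_v q p = 2 * x p * 'D_v x p + 2 * y p * 'D_v y p.
  have -> : 'D_v q p = 'D_v (fun p => x p * x p + y p * y p) p by [].
  by rewrite (deriveD_fun _ dx2 dy2) (deriveM_fun _ dx dx) (deriveM_fun _ dy dy); ring.
have dc (g : R -> R) : smooth g -> differentiable (fun p => g (q p)) p.
  move=> sg; apply: (@differentiable_comp _ _ _ _ q g) => //.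
  exact: smooth_differentiable.
have Dc (g : R -> R) : smooth g -> 'D_v (fun p => g (q p)) p = derive1 g (q p) * 'D_v q p.
  by move=> sg; rewrite derive_comp_R //; exact: smooth_derivable.
have d0 := dc _ smooth_step_annulus; have d1 := dc _ s1; have d2 := dc _ s2.
have m1 := differentiableM_fun d1 dx; have m2 := differentiableM_fun d2 dy.
rewrite /potential (deriveD_fun _ d0 (differentiableD_fun m1 m2)).
rewrite (deriveD_fun _ m1 m2) (deriveM_fun _ d1 dx) (deriveM_fun _ d2 dy).
rewrite (Dc _ smooth_step_annulus) (Dc _ s1) (Dc _ s2) Dq.
rewrite /potential_x /potential_y /radial -/(q p); ring.
Qed.

Lemma derive1_coeff q : derive1 coeff1 q = amp * w1 q + amp * q * derive1 w1 q /\
  derive1 coeff2 q = amp * w2 q + amp * q * derive1 w2 q.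
Proof.
have [s1 s2] := smooth_waves_annulus.
have da := der_M (der_cst amp q) (der_id q).
split; apply: derive1_is_derive.
  apply: (is_derive_eq (der_M da (smooth_is_derive q s1))); ring.
by apply: (is_derive_eq (der_M da (smooth_is_derive q s2))); ring.
Qed.

(** Outside the open annulus everything is constant on a half-line of values of
    [q], up to and including the boundary circle. *)
Lemma flat_outside q : q <= qm \/ qp <= q ->
  [/\ derive1 f q = 0, coeff1 q = 0, coeff2 q = 0 &
      derive1 coeff1 q = 0 /\ derive1 coeff2 q = 0].
Proof.
have [s1 s2] := smooth_waves_annulus.
case=> h; have [e1 e2] : w1 q = 0 /\ w2 q = 0.
- exact: wave_left.
- have [-> ->] := derive1_coeff q; rewrite /coeff1 /coeff2 e1 e2 !mulr0 !add0r.
  rewrite (derive1_cst_left smooth_step_annulus (@step_left _ qm qp freq) h).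
  rewrite (derive1_cst_left (c := 0) (a := qm) s1) //; last by move=> x /(wave_left qp freq)[].
  rewrite (derive1_cst_left (c := 0) (a := qm) s2) //; last by move=> x /(wave_left qp freq)[].
  by rewrite !mulr0.
- exact: wave_right.
- have [-> ->] := derive1_coeff q; rewrite /coeff1 /coeff2 e1 e2 !mulr0 !add0r.
  rewrite (derive1_cst_right smooth_step_annulus (@step_right _ qm qp freq qmp) h).
  rewrite (derive1_cst_right (c := 0) (a := qp) s1) //; last by move=> x /(wave_right qm freq)[].
  rewrite (derive1_cst_right (c := 0) (a := qp) s2) //; last by move=> x /(wave_right qm freq)[].
  by rewrite !mulr0.
Qed.

Lemma critical_circles x y : x ^+ 2 + y ^+ 2 = qm \/ x ^+ 2 + y ^+ 2 = qp ->
  potential_x x y = 0 /\ potential_y x y = 0.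
Proof.
move=> h; have [|h1 h2 h3 [h4 h5]] := @flat_outside (x ^+ 2 + y ^+ 2).
  by case: h => ->; [left | right].
by rewrite /potential_x /potential_y /radial h1 h2 h3 h4 h5; split; ring.
Qed.

Lemma potential_circles x y : (x ^+ 2 + y ^+ 2 = qm -> potential x y = 0) /\
   (x ^+ 2 + y ^+ 2 = qp -> potential x y = 1).
Proof.
rewrite /potential; split=> ->.
  have [|_ -> -> _] := @flat_outside qm; first by left.
  by rewrite step_left // !mul0r !addr0.
have [|_ -> -> _] := @flat_outside qp; first by right.
by rewrite step_right ?qmp // !mul0r !addr0.
Qed.

(** ** The gradient flow in polar coordinates *)

Definition polar_a0 (r : R) : R := 2 * r * derive1 f (r ^+ 2).
Definition polar_a1 (r : R) : R := 2 * r ^+ 2 * derive1 coeff1 (r ^+ 2) + coeff1 (r ^+ 2).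
Definition polar_a2 (r : R) : R := 2 * r ^+ 2 * derive1 coeff2 (r ^+ 2) + coeff2 (r ^+ 2).
Definition polar_b1 (r : R) : R := amp * r * w1 (r ^+ 2).
Definition polar_b2 (r : R) : R := amp * r * w2 (r ^+ 2).

(** The components of [pi] times the gradient with respect to [d/dr] and
    [d/dphi].  In [field_phi] the division by [r] is absorbed into the factor
    [q = r^2] of the coefficients, so the field is smooth on the whole plane of
    parameters [(r, phi)]. *)
Definition field_r (r phi : R) : R :=
  pi * (polar_a0 r + (polar_a1 r * cos phi + polar_a2 r * sin phi)).
Definition field_phi (r phi : R) : R :=
  pi * (polar_b2 r * cos phi - polar_b1 r * sin phi).

Lemma smooth_polar : [/\ smooth polar_a0, smooth polar_a1, smooth polar_a2,
  smooth polar_b1 & smooth polar_b2].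
Proof.
have [s1 s2] := smooth_coeff; have [t1 t2] := smooth_waves_annulus.
have sq : smooth (fun r : R => r ^+ 2) by apply: smoothX; exact: smooth_id.
have sc (g : R -> R) : smooth g -> smooth (fun r : R => g (r ^+ 2)) by move=> sg; exact: smooth_comp.
have c2 (c : R) : smooth (fun _ : R => c) by exact: smooth_cst.
have si : smooth (fun r : R => r) by exact: smooth_id.
split.
- apply: smoothM; first exact: smoothM.
  by apply: (sc (derive1 f)); apply: smooth_derive1; exact: smooth_step_annulus.
- apply: smoothD; last exact: sc.
  by apply: smoothM; [exact: smoothM | apply: (sc (derive1 coeff1)); exact: smooth_derive1].
- apply: smoothD; last exact: sc.
  by apply: smoothM; [exact: smoothM | apply: (sc (derive1 coeff2)); exact: smooth_derive1].
- by apply: smoothM; [exact: smoothM | exact: sc].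
- by apply: smoothM; [exact: smoothM | exact: sc].
Qed.

Lemma polar_outside r : r ^+ 2 <= qm \/ qp <= r ^+ 2 ->
  [/\ polar_a0 r = 0, polar_a1 r = 0, polar_a2 r = 0, polar_b1 r = 0 & polar_b2 r = 0].
Proof.
move=> h; have [h1 h2 h3 [h4 h5]] := flat_outside h.
rewrite /polar_a0 /polar_a1 /polar_a2 /polar_b1 /polar_b2 h1 h2 h3 h4 h5.
have [-> ->] : w1 (r ^+ 2) = 0 /\ w2 (r ^+ 2) = 0.
  by case: h => h; [exact: wave_left | exact: wave_right].
by split; ring.
Qed.

Lemma trig_lipschitz (x y : R) :
  `|cos x - cos y| <= `|x - y| /\ `|sin x - sin y| <= `|x - y|.
Proof.
rewrite -[`|x - y|]mul1r; split; apply: derivable_bounded_lipschitz => t.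
- exact: derivable_cos.
- by rewrite derive1E derive_val normrN; exact: sin_max.
- exact: derivable_sin.
- by rewrite derive1E derive_val; exact: cos_max.
Qed.

(** The radial factors vanish outside the annulus and the trigonometric ones
    are periodic, hence the products are bounded and Lipschitz globally. *)
Lemma field_term (g tr : R -> R) : smooth g ->
  (forall r, r ^+ 2 <= qm \/ qp <= r ^+ 2 -> g r = 0) ->
  (forall x, `|tr x| <= 1) -> (forall x y, `|tr x - tr y| <= `|x - y|) ->
  exists2 K : R, 0 <= K & forall r p, `|g r * tr p| <= K /\
    forall r' p', `|g r * tr p - g r' * tr p'| <= K * (`|r - r'| + `|p - p'|).
Proof.
move=> sg g0 b1 l1.
have [x rpx|K K0 HK] := @smooth_support_lipschitz R g rp (ltW rp0) sg.
  apply: g0; right; rewrite -[x ^+ 2]real_normK ?num_real //.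
  by rewrite ler_sqr ?nnegrE ?normr_ge0 // ltW.
exists K => // r p; have [br lr] := HK r; split.
  by rewrite normrM; apply: le_trans (ler_pM _ _ br (b1 p)) _ => //; rewrite mulr1.
move=> r' p'.
have -> : g r * tr p - g r' * tr p' = g r * (tr p - tr p') + (g r - g r') * tr p' by ring.
apply: le_trans (ler_normD _ _) _; rewrite !normrM mulrDr addrC lerD //.
  by apply: le_trans (ler_pM _ _ (lr r') (b1 p')) _ => //; rewrite mulr1.
by apply: ler_pM.
Qed.

Lemma field_bounds : exists2 L : R, 0 < L &
  (forall r p, `|field_r r p| <= L /\ `|field_phi r p| <= L) /\
  (forall r p r' p', `|field_r r p - field_r r' p'| <= L * (`|r - r'| + `|p - p'|) /\
    `|field_phi r p - field_phi r' p'| <= L * (`|r - r'| + `|p - p'|)).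
Proof.
have [s0 s1 s2 s3 s4] := smooth_polar.
have c1 := @cos_max R; have c2 x y := (@trig_lipschitz x y).1.
have n1 := @sin_max R; have n2 x y := (@trig_lipschitz x y).2.
have [|||K0 K00 H0] := @field_term _ (fun=> 1) s0.
- by move=> r /polar_outside[].
- by move=> x; rewrite normr1.
- by move=> x y; rewrite subrr normr0 normr_ge0.
have [r /polar_outside[] //|K1 K10 H1] := field_term s1 _ c1 c2.
have [r /polar_outside[] //|K2 K20 H2] := field_term s2 _ n1 n2.
have [r /polar_outside[] //|K3 K30 H3] := field_term s3 _ n1 n2.
have [r /polar_outside[] //|K4 K40 H4] := field_term s4 _ c1 c2.
have pi0 := @pi_gt0 R.
have T (x y z a b c : R) : `|x| <= a -> `|y| <= b -> `|z| <= c ->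
    `|pi * (x + (y + z))| <= pi * (a + (b + c)).
  move=> h1 h2 h3; rewrite normrM gtr0_norm // ler_pM2l //.
  apply: le_trans (ler_normD _ _) _; apply: lerD => //.
  by apply: le_trans (ler_normD _ _) _; exact: lerD.
have KS : 0 <= K0 + K1 + K2 + K3 + K4 by rewrite !addr_ge0.
exists (pi * (K0 + K1 + K2 + K3 + K4 + 1)); first by rewrite mulr_gt0 // ltr_wpDl.
split=> r p.
  have [b0 _] := H0 r p; have [b1 _] := H1 r p; have [b2 _] := H2 r p.
  have [b3 _] := H3 r p; have [b4 _] := H4 r p; split.
    rewrite /field_r -[polar_a0 r]mulr1; apply: le_trans (T _ _ _ _ _ _ b0 b1 b2) _.
    by rewrite ler_pM2l //; lra.
  rewrite /field_phi -[_ - _]add0r.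
  have z : `|0 : R| <= 0 by rewrite normr0.
  rewrite -normrN in b3; apply: le_trans (T _ _ _ _ _ _ z b4 b3) _.
  by rewrite ler_pM2l //; lra.
move=> r' p'.
have [_ /(_ r' p') b0] := H0 r p; have [_ /(_ r' p') b1] := H1 r p.
have [_ /(_ r' p') b2] := H2 r p; have [_ /(_ r' p') b3] := H3 r p.
have [_ /(_ r' p') b4] := H4 r p.
set D := `|r - r'| + `|p - p'| in b0 b1 b2 b3 b4 *.
have D0 : 0 <= D by rewrite addr_ge0.
split.
  have -> : field_r r p - field_r r' p' = pi * ((polar_a0 r * 1 - polar_a0 r' * 1) +
    ((polar_a1 r * cos p - polar_a1 r' * cos p') + (polar_a2 r * sin p - polar_a2 r' * sin p'))).
    by rewrite /field_r; ring.
  apply: le_trans (T _ _ _ _ _ _ b0 b1 b2) _.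
  rewrite -mulrA ler_pM2l // !mulrDl mul1r.
  by have := mulr_ge0 K30 D0; have := mulr_ge0 K40 D0; lra.
have -> : field_phi r p - field_phi r' p' = pi * (0 +
  ((polar_b2 r * cos p - polar_b2 r' * cos p') + - (polar_b1 r * sin p - polar_b1 r' * sin p'))).
  by rewrite /field_phi; ring.
have z : `|0 : R| <= 0 by rewrite normr0.
rewrite -normrN in b3; apply: le_trans (T _ _ _ _ _ _ z b4 b3) _.
rewrite -mulrA ler_pM2l // !mulrDl mul1r.
by have := mulr_ge0 K00 D0; have := mulr_ge0 K10 D0; have := mulr_ge0 K20 D0; lra.
Qed.

End Potential.

(** * The gradient field inside the annulus *)

Section Spiral.
Variables (R : realType) (rm rp : R).
Hypotheses (rm0 : 0 < rm) (rmp : rm < rp).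

Let rp0 : 0 < rp. Proof. exact: lt_trans rm0 rmp. Qed.
Local Notation qm := (qm rm).
Local Notation qp := (qp rp).
Local Notation amp := (amp rm rp).
Local Notation freq := (freq rm rp).
Local Notation f := (step qm qp).
Local Notation T := (dtau qm qp).
Local Notation tau := (tau qm qp).
Local Notation V1 := (field_r rm rp).
Local Notation V2 := (field_phi rm rp).
Local Notation qmp := (qmp rm0 rmp).

Definition slope (q : R) : R := f q * (1 - f q).
(** The angle relative to the spiral along which the oscillation of the
    potential is in phase; every trajectory follows this spiral. *)
Definition phase (r phi : R) : R := phi - freq * tau (r ^+ 2).

Lemma annulus_sqr r : rm < r < rp -> qm < r ^+ 2 /\ r ^+ 2 < qp.
Proof.
move=> /andP[r1 r2]; have r0 : 0 < r by exact: lt_trans rm0 r1.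
by rewrite !ltr_sqr ?nnegrE ?(ltW r0) ?(ltW rm0) ?(ltW rp0).
Qed.

Section Inside.
Variable (r phi : R).
Hypothesis ri : rm < r < rp.
Let q := r ^+ 2.
Let psi := phase r phi.
Let S := slope q.

Let r0 : 0 < r. Proof. by case/andP: ri => r1 _; exact: lt_trans rm0 r1. Qed.
Let qi : qm < q /\ q < qp. Proof. exact: annulus_sqr. Qed.

Lemma slope_bounds : [/\ 0 < f q, f q < 1, 0 < S & S <= 1 - f q /\ S <= f q].
Proof.
have [q1 q2] := qi; have /andP[h1 h2] := step_gt0_lt1 freq q1 q2.
split=> //; first by rewrite mulr_gt0 // subr_gt0.
by rewrite /S /slope; split; nra.
Qed.

Lemma polar_waves :
  wave1 qm qp freq q * cos phi + wave2 qm qp freq q * sin phi = S * cos psi /\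
  wave2 qm qp freq q * cos phi - wave1 qm qp freq q * sin phi = - (S * sin psi).
Proof.
have [q1 q2] := qi; have [-> ->] := wave_inside freq qmp q1 q2.
by rewrite /psi /phase cosB sinB -/q /S /slope; split; ring.
Qed.

(** The oscillating terms depend on the angle through the phase [psi] only; the
    last summand is the only one that involves the frequency. *)
Lemma field_r_inside : V1 r phi = pi * (2 * r * S * T q +
  (amp * cos psi * (3 * r ^+ 2 * S + 2 * r ^+ 4 * S * T q * (1 - 2 * f q)) +
   2 * amp * r ^+ 4 * S * T q * freq * sin psi)).
Proof.
have [q1 q2] := qi.
have [d1 d2] := der_wave freq qmp q1 q2.
have [c1 c2] := derive1_coeff rm0 rmp q.
rewrite /field_r /polar_a0 /polar_a1 /polar_a2 -/q c1 c2.
rewrite (derive1_is_derive d1) (derive1_is_derive d2).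
rewrite (derive1_is_derive (der_step freq q1 q2)) /coeff1 /coeff2.
have [-> ->] := wave_inside freq qmp q1 q2.
rewrite /psi /phase cosB sinB -/q /S /slope /q; ring.
Qed.

Lemma field_phi_inside : V2 r phi = - (pi * amp * r * S * sin psi).
Proof.
rewrite /field_phi /polar_b1 /polar_b2 -/q; have [_ e] := polar_waves.
rewrite [pi * _](_ : _ = pi * amp * r * (wave2 qm qp freq q * cos phi - wave1 qm qp freq q * sin phi)); last by ring.
by rewrite e; ring.
Qed.

Lemma potential_inside : potential rm rp (r * cos phi) (r * sin phi) =
  f q + amp * r ^+ 3 * S * cos psi.
Proof.
have e : (r * cos phi) ^+ 2 + (r * sin phi) ^+ 2 = q.
  by rewrite !exprMn -mulrDr cos2Dsin2 mulr1.
have [h _] := polar_waves; rewrite /potential e /coeff1 /coeff2.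
rewrite -[amp * r ^+ 3 * S * cos psi]mulrA -h /q; ring.
Qed.

Lemma amp_bounds : [/\ 2 * amp * r ^+ 3 <= 1, 1 <= amp * r ^+ 3 * freq &
  amp * (3 * r ^+ 2 * S + 2 * r ^+ 4 * S * T q) <= r * S * T q].
Proof.
have /andP[r1 r2] := ri; have [q1 q2] := qi.
have a0 : 0 < amp by exact: amp_gt0.
have r3 : rm ^+ 3 <= r ^+ 3 by rewrite lerXn2r ?nnegrE ?(ltW r0) ?(ltW rm0) ?(ltW r1).
have r3' : r ^+ 3 <= rp ^+ 3 by rewrite lerXn2r ?nnegrE ?(ltW r0) ?(ltW rp0) ?(ltW r2).
have E := ampE rm0 rmp.
have w0 : 0 <= 3 * amp * rp * (qp - qm) ^+ 2.
  by rewrite mulr_ge0 ?sqr_ge0 // !mulr_ge0 // ltW.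
have e3 : 2 * amp * r ^+ 3 <= 2 * amp * rp ^+ 3 by rewrite ler_wpM2l // mulr_ge0 // ltW.
split.
- by lra.
- rewrite -(freqE rm0 rmp) ler_wpM2r //; first by rewrite ltW // freq_gt0.
  by rewrite ler_wpM2l // ltW.
have [_ _ S0 _] := slope_bounds.
have [T0 Tw _ _] := tau_bounds qmp q1 q2.
have -> : amp * (3 * r ^+ 2 * S + 2 * r ^+ 4 * S * T q) =
  r * S * (3 * amp * r + 2 * amp * r ^+ 3 * T q) by ring.
rewrite ler_wpM2l //; first by rewrite mulr_ge0 // ltW.
have h1 : 3 * amp * r <= 3 * amp * rp * (qp - qm) ^+ 2 * T q.
  have -> : 3 * amp * rp * (qp - qm) ^+ 2 * T q = 3 * amp * rp * (T q * (qp - qm) ^+ 2) by ring.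
  apply: (@le_trans _ _ (3 * amp * rp)).
    by rewrite ler_wpM2l ?(ltW r2) // mulr_ge0 // ltW.
  by rewrite ler_peMr // !mulr_ge0 // ltW.
have h2 : 2 * amp * r ^+ 3 * T q <= 2 * amp * rp ^+ 3 * T q by rewrite ler_wpM2r // ltW.
by have := lerD h1 h2; rewrite -mulrDl E mul1r.
Qed.

(** The oscillation without its high-frequency term costs at most half of the
    outward speed [2 r S T] produced by the step. *)
Lemma radial_part : `|amp * cos psi *
    (3 * r ^+ 2 * S + 2 * r ^+ 4 * S * T q * (1 - 2 * f q))| <= r * S * T q.
Proof.
have [_ _] := amp_bounds; apply: le_trans.
have [f0 f1 S0 _] := slope_bounds; have [q1 q2] := qi.
have [T0 _ _ _] := tau_bounds qmp q1 q2.
have a0 : 0 < amp by exact: amp_gt0.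
have ST : 0 <= 2 * r ^+ 4 * S * T q by apply/ltW; apply: mulr_gt0 => //; apply: mulr_gt0 => //; rewrite mulr_gt0 ?exprn_gt0.
rewrite -mulrA normrM gtr0_norm // ler_pM2l // normrM.
apply: le_trans (ler_wpM2r (normr_ge0 _) (cos_max psi)) _; rewrite mul1r.
apply: le_trans (ler_normD _ _) _.
have S3 : 0 <= 3 * r ^+ 2 * S.
  by apply: mulr_ge0 (ltW S0); rewrite mulr_ge0 // sqr_ge0.
rewrite (ger0_norm S3) lerD2l normrM (ger0_norm ST).
by rewrite ler_piMr // ler_norml; apply/andP; split; lra.
Qed.

Let pi0 := @pi_gt0 R.

(** Where [sin psi = 0] the angular field vanishes while the radius grows, so
    the phase decreases: [psi] crosses every multiple of [pi] downwards. *)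
Lemma crossing_down : sin psi = 0 -> V2 r phi - freq * (T q * (2 * r * V1 r phi)) < 0.
Proof.
move=> s0; have [q1 q2] := qi; have [T0 _ _ _] := tau_bounds qmp q1 q2.
have [_ _ S0 _] := slope_bounds.
have h : 0 < r * S * T q by apply: mulr_gt0 => //; exact: mulr_gt0.
rewrite field_phi_inside s0 !mulr0 oppr0 sub0r oppr_lt0.
apply: mulr_gt0; first exact: freq_gt0.
apply: mulr_gt0 => //; apply: mulr_gt0; first exact: mulr_gt0.
rewrite field_r_inside; apply: mulr_gt0 => //; rewrite s0 mulr0 addr0.
by have := radial_part; rewrite ler_norml => /andP[+ _]; lra.
Qed.

(** Where [sin psi = -1] the high-frequency term is at its most negative and the
    radius does not grow, while the angular field is positive: the phase
    increases.  Together with [crossing_down] this confines the phase. *)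
Lemma crossing_up : sin psi = -1 -> 0 < V2 r phi - freq * (T q * (2 * r * V1 r phi)).
Proof.
move=> s1; have [q1 q2] := qi; have [T0 _ _ _] := tau_bounds qmp q1 q2.
have [_ _ S0 _] := slope_bounds; have [_ a1 _] := amp_bounds.
have a0 : 0 < amp by exact: amp_gt0.
have c0 : cos psi = 0 by apply: sin1cos0; rewrite s1 normrN normr1.
have h : 0 < r * S * T q by apply: mulr_gt0 => //; exact: mulr_gt0.
rewrite field_phi_inside s1 mulrN1 opprK.
have h0 : 0 < pi * amp * r * S.
  by apply: mulr_gt0 => //; rewrite !mulr_gt0.
rewrite (ltr_pwDl h0) // oppr_ge0.
rewrite pmulr_rle0 ?freq_gt0 // pmulr_rle0 // pmulr_rle0 ?mulr_gt0 //.
rewrite field_r_inside c0 s1 pmulr_rle0 // mulr0 mul0r add0r mulrN1.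
have -> : 2 * r * S * T q - 2 * amp * r ^+ 4 * S * T q * freq =
  2 * (r * S * T q) * (1 - amp * r ^+ 3 * freq) by ring.
have h2 : 0 < 2 * (r * S * T q) by exact: mulr_gt0.
by rewrite (pmulr_rle0 _ h2) subr_le0.
Qed.

Definition rate : R := pi * rm ^+ 2 / ((qp - qm) ^+ 4 + 4 * rp ^+ 4 * freq ^+ 2) * (4 / 9) ^+ 2.

Lemma rate_gt0 : 0 < rate.
Proof.
have f0 := freq_gt0 rm0 rmp; have w0 : 0 < qp - qm by rewrite subr_gt0 qmp.
rewrite mulr_gt0 ?exprn_gt0 // mulr_gt0 ?mulr_gt0 ?exprn_gt0 // invr_gt0.
by rewrite addr_gt0 ?mulr_gt0 ?exprn_gt0.
Qed.

(** The oscillation is at most [S / 2 = f (1 - f) / 2], so the potential [P] and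
    [1 - P] are comparable to [f] and [1 - f].  In particular
    [P <= 3/2 f] and [1 - P <= 3/2 (1 - f)], whence the constant [4 / 9]. *)
Lemma potential_bounds (P := potential rm rp (r * cos phi) (r * sin phi)) :
  [/\ 0 < P < 1, P <= 2 * f q, 1 - P <= 2 * (1 - f q),
      f q <= 2 * P /\ 1 - f q <= 2 * (1 - P) & 4 / 9 * (P * (1 - P)) <= S].
Proof.
have [f0 f1 S0 [S1 S2]] := slope_bounds; have [a1 _ _] := amp_bounds.
have a0 : 0 < amp by exact: amp_gt0.
have r3 : 0 <= amp * r ^+ 3 by rewrite mulr_ge0 ?exprn_ge0 // ltW.
have : `|amp * r ^+ 3 * S * cos psi| <= S / 2.
  rewrite normrM; apply: le_trans (ler_wpM2l (normr_ge0 _) (cos_max psi)) _.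
  rewrite mulr1 ger0_norm; last exact: mulr_ge0 r3 (ltW S0).
  by rewrite mulrC ler_pM2l //; lra.
rewrite ler_norml /P potential_inside => /andP[h1 h2].
set e := amp * r ^+ 3 * S * cos psi in h1 h2 *.
split; [by apply/andP; split; lra | lra | lra | by split; lra | ].
have hS : S = f q * (1 - f q) by [].
have u1 : f q + e <= 3 / 2 * f q by lra.
have u2 : 1 - (f q + e) <= 3 / 2 * (1 - f q) by lra.
have := ler_pM _ _ u1 u2; rewrite hS => W.
have : (f q + e) * (1 - (f q + e)) <= 3 / 2 * f q * (3 / 2 * (1 - f q)).
  by apply: W; lra.
by lra.
Qed.

(** A lower bound for the squared gradient in terms of the potential itself.
    The radial field may vanish, but at such points the angular one does not: a
    suitable combination of both is free of the term with [sin psi] and is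
    bounded below by [radial_part].  The Cauchy-Schwarz inequality turns this
    into a bound for the sum of squares. *)
Lemma potential_rate (P := potential rm rp (r * cos phi) (r * sin phi)) :
  rate * (P * (1 - P)) ^+ 2 <= (V1 r phi ^+ 2 + (r * V2 r phi) ^+ 2) / pi.
Proof.
have [/andP[P0 P1] _ _ _ PS] := potential_bounds.
have [f0 f1 S0 _] := slope_bounds; have [q1 q2] := qi.
have [T0 Tw _ _] := tau_bounds qmp q1 q2.
have fr0 := freq_gt0 rm0 rmp; have w0 : 0 < qp - qm by rewrite subr_gt0 qmp.
pose X := V1 r phi / pi; pose Y := r * V2 r phi / pi.
have pn : pi != 0 :> R by rewrite gt_eqF.
(* The weight of [Y] is the one that cancels the term with [sin psi]. *)
have XY : r * S * T q <= X + 2 * r ^+ 2 * freq * T q * Y.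
  rewrite /X /Y field_r_inside field_phi_inside.
  set c := amp * cos psi * _.
  have := radial_part; rewrite -/c ler_norml => /andP[h _].
  rewrite [pi * _]mulrC mulfK //.
  have -> : r * - (pi * amp * r * S * sin psi) / pi = - (r ^+ 2 * amp * S * sin psi).
    rewrite [LHS](_ : _ = - (r ^+ 2 * amp * S * sin psi) * (pi / pi)); last by ring.
    by rewrite divff // mulr1.
  have := h; set z := r * S * T q; move=> h'.
  have -> : 2 * r * S * T q = 2 * z by rewrite /z; ring.
  have -> : 2 * r ^+ 2 * freq * T q * - (r ^+ 2 * amp * S * sin psi) =
    - (2 * amp * r ^+ 4 * S * T q * freq * sin psi) by ring.
  by lra.
(* The factor [T], which is unbounded near the circles, occurs on both sides of
   the Cauchy-Schwarz bound and cancels. *)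
set N := 2 * r ^+ 2 * freq * T q in XY.
have rST : 0 <= r * S * T q by rewrite ltW //; apply: mulr_gt0 => //; exact: mulr_gt0.
have CS : (r * S * T q) ^+ 2 <= (X ^+ 2 + Y ^+ 2) * (1 + N ^+ 2).
  apply: (@le_trans _ _ ((X + N * Y) ^+ 2)).
    by rewrite ler_sqr // nnegrE //; exact: le_trans XY.
  by have := sqr_ge0 (N * X - Y); nra.
set D := (qp - qm) ^+ 4 + 4 * rp ^+ 4 * freq ^+ 2.
have D0 : 0 < D by rewrite addr_gt0 ?mulr_gt0 ?exprn_gt0.
have ND : 1 + N ^+ 2 <= D * T q ^+ 2.
  rewrite /D mulrDl; apply: lerD.
    have -> : (qp - qm) ^+ 4 * T q ^+ 2 = (T q * (qp - qm) ^+ 2) ^+ 2 by ring.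
    by rewrite expr_ge1 // mulr_ge0 ?sqr_ge0 // ltW.
  have -> : N ^+ 2 = 4 * r ^+ 4 * freq ^+ 2 * T q ^+ 2 by rewrite /N; ring.
  rewrite ler_wpM2r ?sqr_ge0 // ler_wpM2r ?sqr_ge0 // ler_wpM2l //.
  rewrite lerXn2r ?nnegrE ?(ltW r0) ?(ltW rp0) //.
  by case/andP: ri => _ /ltW.
have XY0 : 0 <= X ^+ 2 + Y ^+ 2 by rewrite addr_ge0 ?sqr_ge0.
have main : r ^+ 2 * S ^+ 2 <= (X ^+ 2 + Y ^+ 2) * D.
  have T2 : 0 < T q ^+ 2 by rewrite exprn_gt0.
  rewrite -(ler_pM2r T2) -mulrA.
  have -> : r ^+ 2 * (S ^+ 2 * T q ^+ 2) = (r * S * T q) ^+ 2 by ring.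
  by apply: le_trans CS _; rewrite -mulrA ler_wpM2l.
have main2 : rm ^+ 2 * S ^+ 2 / D <= X ^+ 2 + Y ^+ 2.
  rewrite ler_pdivrMr //; apply: le_trans main.
  rewrite ler_wpM2r ?sqr_ge0 // ler_sqr ?nnegrE ?(ltW rm0) ?(ltW r0) //.
  by case/andP: ri => /ltW.
have -> : (V1 r phi ^+ 2 + (r * V2 r phi) ^+ 2) / pi = pi * (X ^+ 2 + Y ^+ 2).
  have -> : V1 r phi = pi * X by rewrite /X mulrCA divff // mulr1.
  have -> : r * V2 r phi = pi * Y by rewrite [RHS]mulrC mulfVK.
  clear -pn; move: X Y => X Y.
  rewrite [LHS](_ : _ = pi * (X ^+ 2 + Y ^+ 2) * (pi / pi)); last by ring.
  by rewrite divff // mulr1.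
apply: (@le_trans _ _ (pi * (rm ^+ 2 * S ^+ 2 / D))); last by rewrite ler_pM2l.
have -> : rate * (P * (1 - P)) ^+ 2 = pi * (rm ^+ 2 * (4 / 9 * (P * (1 - P))) ^+ 2 / D).
  by rewrite /rate -/D; ring.
rewrite ler_pM2l // ler_wpM2r ?invr_ge0 ?(ltW D0) // ler_wpM2l ?sqr_ge0 //.
by rewrite ler_sqr ?nnegrE ?(ltW S0) // !mulr_ge0 // ?subr_ge0 ltW.
Qed.

End Inside.
End Spiral.

(** * Spiralling gradient lines *)

Lemma polar_coordinates (R : realType) (x y : R) : exists phi : R,
  x = Num.sqrt (x ^+ 2 + y ^+ 2) * cos phi /\
  y = Num.sqrt (x ^+ 2 + y ^+ 2) * sin phi.
Proof.
set r := Num.sqrt _.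
have r2 : r ^+ 2 = x ^+ 2 + y ^+ 2 by rewrite sqr_sqrtr // addr_ge0 ?sqr_ge0.
have rge0 : 0 <= r by exact: sqrtr_ge0.
have [r0|rn0] := eqVneq r 0.
  have /eqP : x ^+ 2 + y ^+ 2 = 0 by rewrite -r2 r0 expr0n.
  rewrite paddr_eq0 ?sqr_ge0 // !sqrf_eq0 => /andP[/eqP -> /eqP ->].
  by exists 0; rewrite r0 !mul0r.
have rpos : 0 < r by rewrite lt0r rn0.
have xr : -1 <= x / r <= 1.
  rewrite -ler_norml -(@ler_pXn2r _ 2) ?nnegrE // expr1n real_normK ?num_real //.
  rewrite expr_div_n ler_pdivrMr ?exprn_gt0 // mul1r r2.
  by rewrite lerDl sqr_ge0.
have s2 : Num.sqrt (1 - (x / r) ^+ 2) = `|y| / r.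
  have -> : 1 - (x / r) ^+ 2 = (`|y| / r) ^+ 2.
    rewrite !expr_div_n real_normK ?num_real // -[1](divff (_ : r ^+ 2 != 0)) ?expf_neq0 //.
    by rewrite -mulrBl r2; congr (_ / _); ring.
  by rewrite sqrtr_sqr ger0_norm // divr_ge0.
have [y0|y0] := leP 0 y.
  exists (acos (x / r)); rewrite acosK // sin_acos // s2 ger0_norm //.
  by rewrite ![r * _]mulrC !divfK.
exists (- acos (x / r)); rewrite cosN sinN acosK // sin_acos // s2 ltr0_norm //.
by rewrite mulNr opprK ![r * _]mulrC !divfK.
Qed.

Section Barriers.
Variables (R : realType) (psi dpsi : R -> R).
Hypothesis Hd : forall t, is_derive t (1 : R) psi (dpsi t).
Hypothesis down : forall t, sin (psi t) = 0 -> dpsi t < 0.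
Hypothesis up : forall t, sin (psi t) = -1 -> 0 < dpsi t.

Lemma sin_period (x : R) n : sin (x + pi *+ 2 *+ n) = sin x.
Proof. exact: periodicn (@sinD2pi R) n x. Qed.

Lemma sin_periodN (x : R) n : sin (x - pi *+ 2 *+ n) = sin x.
Proof. by rewrite -[in RHS](subrK (pi *+ 2 *+ n) x) sin_period. Qed.

(** The zeros of [sin] are barriers from above and the points with [sin = -1]
    barriers from below for [t >= 0]; for [t <= 0] their roles are exchanged.
    Both kinds occur on either side of [psi 0]. *)
Lemma phase_trapped : exists K : R, forall t, `|psi t| <= K.
Proof.
have pi0 := @pi_gt0 R.
have sh : sin (- (pi / 2)) = -1 :> R by rewrite sinN sin_pihalf.
pose n := Num.truncn (`|psi 0|); have nP : `|psi 0| <= n.+1%:R.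
  by apply: ltW; exact: truncnS_gt.
(* A multiple of the period beyond [psi 0] on either side, with room for the
   shift of a quarter turn. *)
have big : `|psi 0| + pi / 2 <= pi *+ 2 *+ n.+1.
  have -> : pi *+ 2 *+ n.+1 = 2 * pi * n.+1%:R :> R by rewrite -mulr_natr mulr2n; ring.
  have p2 := @pi_ge2 R; have n1 : 1 <= n.+1%:R :> R by rewrite ler1n.
  have : 2 * pi * n.+1%:R = pi * n.+1%:R + pi * n.+1%:R :> R by ring.
  have : pi <= pi * n.+1%:R :> R by rewrite ler_peMr // ltW.
  have : 2 * n.+1%:R <= pi * n.+1%:R :> R by rewrite ler_wpM2r.
  by lra.
set N := pi *+ 2 *+ n.+1 in big.
have N0 : 0 <= N by apply: le_trans big; rewrite addr_ge0 // divr_ge0 // ltW.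
have [a1 a2] : psi 0 <= `|psi 0| /\ - `|psi 0| <= psi 0.
  by split; [exact: ler_norm | rewrite lerNl -normrN ler_norm].
have dB (b : R) t : is_derive t (1 : R) (fun s => psi s - b) (dpsi t).
  by apply: (is_derive_eq (der_D (Hd t) (der_cst (- b) t))); rewrite addr0.
have dB' (b : R) t : is_derive t (1 : R) (fun s => b - psi s) (- dpsi t).
  by apply: (is_derive_eq (der_D (der_cst b t) (der_N (Hd t)))); rewrite add0r.
exists (N + pi / 2) => t; rewrite ler_norml; have [t0|t0] := leP 0 t.
  have u := @barrier R _ _ (dB N) _ 0 t t0.
  have l := @barrier R _ _ (dB' (- (pi / 2) - N)) _ 0 t t0.
  apply/andP; split.
    suff : - (pi / 2) - N - psi t <= 0 by lra.
    apply: l => [s /eqP|]; last by lra.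
    by rewrite subr_eq0 => /eqP e; rewrite oppr_lt0; apply: up; rewrite -e sin_periodN.
  suff : psi t - N <= 0 by lra.
  apply: u => [s /eqP|]; last by lra.
  by rewrite subr_eq0 => /eqP e; apply: down; rewrite e -[N]add0r sin_period sin0.
have t0' : 0 <= - t by rewrite oppr_ge0 ltW.
have rev b := der_reverse (dB b); have rev' b := der_reverse (dB' b).
have u := @barrier R _ _ (rev (- (pi / 2) + N)) _ 0 (- t) t0'.
have l := @barrier R _ _ (rev' (- N)) _ 0 (- t) t0'.
rewrite !opprK !oppr0 in u l; apply/andP; split.
  suff : - N - psi t <= 0 by lra.
  apply: l => [s /eqP|]; last by lra.
  by rewrite subr_eq0 => /eqP e; rewrite opprK; apply: down; rewrite -e -[- N]add0r sin_periodN sin0.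
suff : psi t - (- (pi / 2) + N) <= 0 by lra.
apply: u => [s /eqP|]; last by lra.
by rewrite subr_eq0 => /eqP e; rewrite oppr_lt0; apply: up; rewrite e sin_period.
Qed.

End Barriers.

Section Trajectory.
Variables (R : realType) (rm rp : R).
Hypotheses (rm0 : 0 < rm) (rmp : rm < rp).

Let rp0 : 0 < rp. Proof. exact: lt_trans rm0 rmp. Qed.
Local Notation qm := (qm rm).
Local Notation qp := (qp rp).
Local Notation freq := (freq rm rp).
Local Notation f := (step qm qp).
Local Notation tau := (tau qm qp).
Local Notation V1 := (field_r rm rp).
Local Notation V2 := (field_phi rm rp).
Local Notation qmp := (qmp rm0 rmp).

Lemma field_cartesian (r phi : R) :
  V1 r phi * cos phi - r * V2 r phi * sin phi =
    pi * potential_x rm rp (r * cos phi) (r * sin phi) /\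
  V1 r phi * sin phi + r * V2 r phi * cos phi =
    pi * potential_y rm rp (r * cos phi) (r * sin phi).
Proof.
have e : (r * cos phi) ^+ 2 + (r * sin phi) ^+ 2 = r ^+ 2.
  by rewrite !exprMn -mulrDr cos2Dsin2 mulr1.
rewrite /potential_x /potential_y /radial e /field_r /field_phi.
rewrite /polar_a0 /polar_a1 /polar_a2.
have -> : r * (pi * (polar_b2 rm rp r * cos phi - polar_b1 rm rp r * sin phi)) =
  pi * (coeff2 rm rp (r ^+ 2) * cos phi - coeff1 rm rp (r ^+ 2) * sin phi).
  by rewrite /polar_b1 /polar_b2 /coeff1 /coeff2; ring.
have := cos2Dsin2 phi; move: (cos phi) (sin phi) => C S CS.
move: (derive1 f _) (derive1 (coeff1 _ _) _) (derive1 (coeff2 _ _) _) => d0 d1 d2.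
move: (coeff1 _ _ _) (coeff2 _ _ _) => k1 k2; split.
  rewrite -[k1 in RHS](mulr1) -CS; ring.
by rewrite -[k2 in RHS](mulr1) -CS; ring.
Qed.

(** Bootstrap: the derivatives are smooth functions of the solution. *)
Lemma flow_smooth (r phi : R -> R) :
  (forall t, is_derive t (1 : R) r (V1 (r t) (phi t))) ->
  (forall t, is_derive t (1 : R) phi (V2 (r t) (phi t))) ->
  smooth r /\ smooth phi.
Proof.
move=> dr dp; have [s0 s1 s2 s3 s4] := smooth_polar rm0 rmp.
suff H k : C_k k (r : R -> R) /\ C_k k (phi : R -> R).
  by split=> k; case: (H k).
elim: k => [|k [IHr IHp]].
  by split; [exact: is_derive_continuous dr | exact: is_derive_continuous dp].
have Cc : C_k k (fun t => cos (phi t)) by apply: C_k_comp IHp; exact: smooth_cos.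
have Cs : C_k k (fun t => sin (phi t)) by apply: C_k_comp IHp; exact: smooth_sin.
have Cg (g : R -> R) : smooth g -> C_k k (fun t => g (r t)).
  by move=> sg; apply: C_k_comp IHr; exact: sg.
split; apply: C_kS_R => [t|].
- by case: (dr t).
- apply: (eq_C_k (f := fun t => V1 (r t) (phi t))) => [t|].
    by rewrite (derive1_is_derive (dr t)).
  apply: C_kM; first exact: C_k_cst.
  by apply: C_kD; [exact: Cg | apply: C_kD; apply: C_kM => //; exact: Cg].
- by case: (dp t).
- apply: (eq_C_k (f := fun t => pi * (polar_b2 rm rp (r t) * cos (phi t) +
    -1 * (polar_b1 rm rp (r t) * sin (phi t))))) => [t|].
    by rewrite (derive1_is_derive (dp t)) mulN1r.
  apply: C_kM; first exact: C_k_cst.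
  apply: C_kD; first by apply: C_kM => //; exact: Cg.
  by apply: C_kM; [exact: C_k_cst | apply: C_kM => //; exact: Cg].
Qed.

(** The solution through the given point stays in the open annulus because the
    field vanishes on the boundary circles.  The potential rises along it from
    [0] to [1] by [potential_rate]; since the potential is comparable to the
    logistic function of [tau], this forces [tau] to run from minus to plus
    infinity, so the radius tends to the boundary circles.  As the phase
    [phi - freq tau] is bounded by [phase_trapped], the angle [phi] is dragged
    along and is unbounded at both ends. *)
Theorem spiral_trajectory (x0 y0 : R) :
  rm < Num.sqrt (x0 ^+ 2 + y0 ^+ 2) < rp ->
  exists r phi : R -> R,
  [/\ smooth r /\ smooth phi,
      r 0 * cos (phi 0) = x0 /\ r 0 * sin (phi 0) = y0,
      forall t, is_derive t (1 : R) (fun s => r s * cos (phi s))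
          (pi * potential_x rm rp (r t * cos (phi t)) (r t * sin (phi t))) /\
        is_derive t (1 : R) (fun s => r s * sin (phi s))
          (pi * potential_y rm rp (r t * cos (phi t)) (r t * sin (phi t))),
      (forall M, exists T, forall t, T <= t -> M <= phi t /\ phi (- t) <= - M) &
      (forall t, rm < r t < rp /\
        0 < potential rm rp (r t * cos (phi t)) (r t * sin (phi t)) < 1) /\
      forall e, 0 < e -> exists T, forall t, T <= t ->
        [/\ rp - r t < e, r (- t) - rm < e,
          1 - potential rm rp (r t * cos (phi t)) (r t * sin (phi t)) < e &
          potential rm rp (r (- t) * cos (phi (- t))) (r (- t) * sin (phi (- t))) < e]].
Proof.
have [phi0] := polar_coordinates x0 y0.
set r0 := Num.sqrt _ => -[ex ey] r0i.
have [L L0 [bnd lip]] := field_bounds rm0 rmp.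
have [r [phi [rE phiE dr dp]]] := global_solution L0 bnd lip r0 phi0.
have [sr sp] := flow_smooth dr dp.
(* A field that vanishes at [c] and is Lipschitz is [O(|r - c|)], the hypothesis
   of [stays_positive]. *)
have zero (c : R) : c ^+ 2 <= qm \/ qp <= c ^+ 2 -> forall p, V1 c p = 0.
  move=> h p; have [e0 e1 e2 _ _] := polar_outside rm0 rmp h.
  by rewrite /field_r e0 e1 e2 !mul0r !addr0 mulr0.
have near (c : R) t : (forall p, V1 c p = 0) -> `|V1 (r t) (phi t)| <= L * `|r t - c|.
  move=> V0; have [h _] := lip (r t) (phi t) c (phi t).
  by rewrite V0 subr0 subrr normr0 addr0 in h.
have ri t : rm < r t < rp.
  rewrite -subr_gt0 -[r t < _]subr_gt0; apply/andP; split; move: t.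
    apply: (@stays_positive R (fun t => r t - rm) (fun t => V1 (r t) (phi t)) L) => [t|t|].
    - by apply: (is_derive_eq (der_D (dr t) (der_cst (- rm) t))); rewrite addr0.
    - by apply: near; apply: zero; left.
    - by rewrite rE subr_gt0; case/andP: r0i.
  apply: (@stays_positive R (fun t => rp - r t) (fun t => - V1 (r t) (phi t)) L) => [t|t|].
  - by apply: (is_derive_eq (der_D (der_cst rp t) (der_N (dr t)))); rewrite add0r.
  - by rewrite normrN distrC; apply: near; apply: zero; right.
  - by rewrite rE subr_gt0; case/andP: r0i.
have qi t := annulus_sqr rm0 rmp (ri t).
have dx t : is_derive t (1 : R) (fun s => r s * cos (phi s))
    (pi * potential_x rm rp (r t * cos (phi t)) (r t * sin (phi t))).
  apply: (is_derive_eq (der_M (dr t) (der_cos (dp t)))).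
  by have [<- _] := field_cartesian (r t) (phi t); ring.
have dy t : is_derive t (1 : R) (fun s => r s * sin (phi s))
    (pi * potential_y rm rp (r t * cos (phi t)) (r t * sin (phi t))).
  apply: (is_derive_eq (der_M (dr t) (der_sin (dp t)))).
  by have [_ <-] := field_cartesian (r t) (phi t); ring.
(* Bounded phase: from here on the angle is [freq * tau] up to a constant. *)
pose psi t := phase rm rp (r t) (phi t).
have [K HK] : exists K, forall t, `|psi t| <= K.
  apply: (@phase_trapped R psi (fun t => V2 (r t) (phi t) -
     freq * (dtau qm qp (r t ^+ 2) * (2 * r t * V1 (r t) (phi t))))) => t.
  - have [q1 q2] := qi t.
    have d := @der_comp R tau (fun s => r s ^+ 2) t _ _ (der_tau q1 q2) (der_X 2 (dr t)).
    apply: (is_derive_eq (der_D (dp t) (der_N (der_M (der_cst freq t) d)))).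
    by rewrite mul0r add0r expr1.
  - exact: crossing_down.
  - exact: crossing_up.
(* Along a gradient line the derivative of the potential is the squared speed
   divided by [pi], which is what [potential_rate] bounds from below. *)
pose P t := potential rm rp (r t * cos (phi t)) (r t * sin (phi t)).
pose dP t := (V1 (r t) (phi t) ^+ 2 + (r t * V2 (r t) (phi t)) ^+ 2) / pi.
have pin : pi != 0 :> R by rewrite gt_eqF // pi_gt0.
have DP t : is_derive t (1 : R) P (dP t).
  have [ddx ex'] := dx t; have [ddy ey'] := dy t.
  have d1 : differentiable (fun s => r s * cos (phi s)) t by exact/derivable1_diffP.
  have d2 : differentiable (fun s => r s * sin (phi s)) t by exact/derivable1_diffP.
  have sP : smooth P.
    apply: smooth_potential_comp => //; apply: smoothM => //.
      exact: smooth_comp (@smooth_cos R) sp.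
    exact: smooth_comp (@smooth_sin R) sp.
  apply: DeriveDef; first exact: smooth_derivable.
  rewrite (derive_potential rm0 rmp _ d1 d2) ex' ey' /dP.
  have [c1 c2] := field_cartesian (r t) (phi t).
  have CS := cos2Dsin2 (phi t).
  rewrite -[V1 _ _ ^+ 2 + _]mulr1 -CS.
  move: c1 c2; set v1 := V1 _ _; set v2 := r t * _.
  move: (cos _) (sin _) v1 v2 (potential_x _ _ _ _) (potential_y _ _ _ _) => C S v1 v2 p1 p2 c1 c2.
  have -> : (v1 ^+ 2 + v2 ^+ 2) * (C ^+ 2 + S ^+ 2) =
    (v1 * C - v2 * S) ^+ 2 + (v1 * S + v2 * C) ^+ 2 by ring.
  rewrite c1 c2 [RHS](_ : _ = (p1 * (pi * p1) + p2 * (pi * p2)) * (pi / pi)); last by ring.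
  by rewrite divff // mulr1.
have PB t := potential_bounds rm0 rmp (phi t) (ri t).
have P01 t : 0 < P t < 1 by case: (PB t).
have Pr t := potential_rate rm0 rmp (phi t) (ri t).
have up := tends_to_one (rate_gt0 rm0 rmp) DP P01 Pr.
have dn : forall e, 0 < e -> exists T : R, forall t, T <= t -> 1 - (1 - P (- t)) < e.
  apply: (tends_to_one (dh := fun t => dP (- t)) (rate_gt0 rm0 rmp)).
  - move=> t; apply: (is_derive_eq (der_D (der_cst 1 t) (der_N (der_reverse DP t)))).
    by rewrite add0r opprK.
  - by move=> t; have /andP[h1 h2] := P01 (- t); apply/andP; split; lra.
  - by move=> t; rewrite subKr [_ * P _]mulrC; exact: Pr.
have tauE t : f (r t ^+ 2) = (1 + expR (- tau (r t ^+ 2)))^-1.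
  by have [q1 q2] := qi t; rewrite (step_inside freq).
(* [1 - f] and [f] are at most twice [1 - P] and [P], and
   [1 - f = 1 / (1 + e^tau)], [f = 1 / (1 + e^(-tau))]. *)
have taubig M : exists T, forall t, T <= t -> M < tau (r t ^+ 2) /\ tau (r (- t) ^+ 2) < - M.
  have eM : 0 < expR M by exact: expR_gt0.
  have e0 : 0 < (1 + expR M)^-1 / 2 by rewrite divr_gt0 // invr_gt0 addr_gt0.
  have [T1 H1] := up _ e0; have [T2 H2] := dn _ e0.
  exists (Num.max T1 T2) => t; rewrite ge_max => /andP[h1 h2]; split.
    have [_ _ _ [_ h] _] := PB t; have := H1 t h1; rewrite tauE in h.
    move: h; rewrite -/(P t) => h h'.
    have : 1 - (1 + expR (- tau (r t ^+ 2)))^-1 < (1 + expR M)^-1 by lra.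
    have -> : 1 - (1 + expR (- tau (r t ^+ 2)))^-1 = (1 + expR (tau (r t ^+ 2)))^-1.
      rewrite expRN; have := expR_gt0 (tau (r t ^+ 2)); set E := expR _ => E0.
      by field; rewrite !gt_eqF // addr_gt0.
    rewrite ltf_pV2 ?posrE ?addr_gt0 ?expR_gt0 //.
    by rewrite ltrD2l ltr_expR.
  have [_ _ _ [h _] _] := PB (- t); have := H2 t h2; rewrite tauE in h.
  move: h; rewrite -/(P (- t)) subKr => h h'.
  have : (1 + expR (- tau (r (- t) ^+ 2)))^-1 < (1 + expR M)^-1 by lra.
  rewrite ltf_pV2 ?posrE ?addr_gt0 ?expR_gt0 //.
  by rewrite ltrD2l ltr_expR ltrNr.
exists r, phi; split => //.
- by rewrite rE phiE -ex -ey.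
- move=> M; have [T HT] := taubig ((`|M| + K) / freq).
  have fr0 := freq_gt0 rm0 rmp.
  have aM := ler_norm M; have aM0 := normr_ge0 M.
  exists T => t /HT[h1 h2].
  have := HK t; have := HK (- t); rewrite !ler_norml /psi /phase => /andP[p1 p2] /andP[p3 p4].
  rewrite ltr_pdivrMr // mulrC in h1.
  rewrite ltrNr ltr_pdivrMr // mulNr ltrNr mulrC in h2.
  by split; lra.
- split=> [t|e e0]; first by split => //; exact: P01.
  have [T HT] := taubig (1 / (rm * e)).
  have [T1 H1] := up _ e0; have [T2 H2] := dn _ e0.
  have rme : 0 < rm * e by exact: mulr_gt0.
  exists (Num.max T (Num.max T1 T2)) => t; rewrite !ge_max => /and3P[/HT[h1 h2] /H1 h3 /H2].
  rewrite subKr => h4.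
  have M0 : 0 < 1 / (rm * e) by rewrite divr_gt0.
  split => //.
  - have [q1 q2] := qi t; have [_ _ + _] := tau_bounds qmp q1 q2.
    move=> /(_ (lt_trans M0 h1)) h.
    have : (tau (r t ^+ 2))^-1 < rm * e.
      by rewrite -[rm * e]invrK ltf_pV2 ?posrE ?invr_gt0 ?(lt_trans M0 h1) // -div1r.
    move=> /(lt_trans h); have /andP[r1 r2] := ri t.
    have -> : qp - r t ^+ 2 = (rp - r t) * (rp + r t) by rewrite /qp; ring.
    have hs : 0 <= rp - r t by rewrite subr_ge0 ltW.
    have hr : rm <= rp + r t by rewrite ltW // ltr_wpDr // ltW // (lt_trans rm0 r1).
    move=> h'; rewrite -(ltr_pM2l rm0); apply: le_lt_trans h'.
    by rewrite [leLHS]mulrC; exact: ler_wpM2l hs _ _ hr.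
  - have [q1 q2] := qi (- t); have [_ _ _] := tau_bounds qmp q1 q2.
    have neg : tau (r (- t) ^+ 2) < 0 by lra.
    move=> /(_ neg) h.
    have : (- tau (r (- t) ^+ 2))^-1 < rm * e.
      by rewrite -[rm * e]invrK ltf_pV2 ?posrE ?invr_gt0 ?oppr_gt0 // -div1r ltrNr.
    move=> /(lt_trans h); have /andP[r1 r2] := ri (- t).
    have -> : r (- t) ^+ 2 - qm = (r (- t) - rm) * (r (- t) + rm) by rewrite /qm; ring.
    have hs : 0 <= r (- t) - rm by rewrite subr_ge0 ltW.
    have hr : rm <= r (- t) + rm by rewrite lerDr ltW // (lt_trans rm0 r1).
    move=> h'; rewrite -(ltr_pM2l rm0); apply: le_lt_trans h'.
    by rewrite [leLHS]mulrC; exact: ler_wpM2l hs _ _ hr.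
Qed.

End Trajectory.

(** * Contact geometry of the conformally scaled form *)

Section Linear.
Variable R : realType.
Implicit Types V W : normedModType R.

Lemma derive_linear V W (l : V -> W) x v : linear l -> continuous l ->
  differentiable l x /\ 'D_v l x = l v.
Proof.
move=> ll cl.
pose L : {linear V -> W} := HB.pack l (GRing.isLinear.Build R V W *:%R l ll).
have dl : differentiable l x by exact: (@linear_differentiable _ _ _ L).
split=> //; rewrite deriveE //.
by have -> : 'd l x = l :> (V -> W) by exact: (@diff_lin _ _ _ L).
Qed.

Lemma derive_scale_vec V W (h : V -> R) (w : W) x v : differentiable h x ->
  'D_v (fun y => h y *: w) x = 'D_v h x *: w.
Proof.
move=> dh; rewrite deriveE; last exact: differentiableZl.
by rewrite diffZl // deriveE.
Qed.

Lemma derive_fst V W (x v : (V * W)%type) : 'D_v (fun y : (V * W)%type => y.1) x = v.1.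
Proof.
by have [] := @derive_linear _ _ (fst : (V * W)%type -> V) x v (@linearP _ _ _ _ _) (@continuous_fst _ V W).
Qed.

Lemma derive_snd V W (x v : (V * W)%type) : 'D_v (fun y : (V * W)%type => y.2) x = v.2.
Proof.
by have [] := @derive_linear _ _ (snd : (V * W)%type -> W) x v (@linearP _ _ _ _ _) (@continuous_snd _ V W).
Qed.

End Linear.

Section Contact.
Variables (R : realType) (n : nat).
Local Notation M := (Mcov R n).
Implicit Types (q v w : M).

Lemma smooth_coordinates (V : normedModType R) (Y : V -> M) : smooth Y ->
  [/\ smooth (fun x => (Y x).1 : R), forall i, smooth (fun x => (Y x).2.1 0 i : R) &
      forall i, smooth (fun x => (Y x).2.2 0 i : R)].
Proof.
move=> sY.
have s2 : smooth (fun x => (Y x).2) by move=> k; exact: C_k_snd (sY k).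
split=> [k|i k|i k]; first exact: C_k_fst (sY k).
  by apply: C_k_coord; exact: C_k_fst (s2 k).
by apply: C_k_coord; exact: C_k_snd (s2 k).
Qed.

Lemma smooth_alpha (V : normedModType R) (Y Z : V -> M) : smooth Y -> smooth Z ->
  smooth (fun x => alpha (Y x) (Z x)).
Proof.
move=> /smooth_coordinates[_ y1 y2] /smooth_coordinates[_ z1 z2] k.
apply: C_k_sum => i; apply: C_kD; first by apply: C_kM; [exact: y1 | exact: z2].
apply: (eq_C_k (f := fun x => -1 * ((Y x).2.2 0 i * (Z x).2.1 0 i))) => [x|].
  by rewrite mulN1r.
apply: C_kM; first exact: C_k_cst.
by apply: C_kM; [exact: y2 | exact: z1].
Qed.

Lemma alpha_linear_l w : linear (fun q => alpha q w).
Proof.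
move=> c u v; rewrite /alpha scaler_sumr -big_split; apply: eq_bigr => i _ /=.
by rewrite !mxE /GRing.scale /=; ring.
Qed.

Lemma alpha_linear_r q : linear (alpha q).
Proof.
move=> c u v; rewrite /alpha scaler_sumr -big_split; apply: eq_bigr => i _ /=.
by rewrite !mxE /GRing.scale /=; ring.
Qed.

Lemma alpha_scale q (c : R) v : alpha q (c *: v) = c * alpha q v.
Proof. by rewrite /alpha mulr_sumr; apply: eq_bigr => i _; rewrite !mxE; ring. Qed.

Lemma alpha_sub q v w : alpha q (v - w) = alpha q v - alpha q w.
Proof.
by rewrite /alpha -sumrB; apply: eq_bigr => i _; rewrite !mxE; ring.
Qed.

Lemma alphaC v w : alpha v w = - alpha w v.
Proof. by rewrite /alpha -sumrN; apply: eq_bigr => i _; ring. Qed.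

Lemma derive_lambda0 q v w :
  differentiable (fun y => lambda0 y w) q /\ 'D_v (fun y => lambda0 y w) q = alpha v w.
Proof.
have ca : continuous (fun q : M => alpha q w : R).
  by apply: smooth_continuous; apply: smooth_alpha; [exact: smooth_id | exact: smooth_cst].
have [da Da] := @derive_linear _ _ _ _ q v (alpha_linear_l w) ca.
split; first by apply: differentiableD => //; exact: differentiable_cst.
have -> : (fun y => lambda0 y w) = (fun y => cst w.1 y + alpha y w) by [].
by rewrite deriveD_fun ?derive_cst ?add0r //; exact: differentiable_cst.
Qed.

Lemma ext_d_lambda0 q v w : ext_d (@lambda0 R n) q v w = 2 * alpha v w.
Proof.
rewrite /ext_d (derive_lambda0 q v w).2 (derive_lambda0 q w v).2 [alpha w v]alphaC.
ring.
Qed.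

(** [d(e^F lambda0) = e^F (dF /\ lambda0 + d lambda0)]. *)
Lemma ext_d_exp_scaled (F : M -> R) q v w : differentiable F q ->
  ext_d (exp_scaled F (@lambda0 R n)) q v w =
  expR (F q) * ('D_v F q * lambda0 q w - 'D_w F q * lambda0 q v + 2 * alpha v w).
Proof.
move=> dF.
have de : differentiable (fun y => expR (F y)) q.
  apply: (@differentiable_comp _ _ _ _ F expR) => //.
  by apply/derivable1_diffP; exact: derivable_expR.
have De u : 'D_u (fun y => expR (F y)) q = expR (F q) * 'D_u F q.
  rewrite (derive_comp_R _ dF); last exact: derivable_expR.
  by rewrite derive1E derive_val.
have [d1 D1] := derive_lambda0 q v w; have [d2 D2] := derive_lambda0 q w v.
rewrite /ext_d /exp_scaled (deriveM_fun _ de d1) (deriveM_fun _ de d2).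
rewrite (De v) (De w) D1 D2 [alpha w v]alphaC.
by move: (expR _) ('D_v F q) ('D_w F q) (lambda0 q w) (lambda0 q v) (alpha v w) => *; ring.
Qed.

(** ** The standard complex structure, lifted to the contact hyperplanes *)

(** The projection to the [(x, y)]-coordinates identifies each contact
    hyperplane with Euclidean space; this is the standard complex structure
    transported by that identification. *)
Definition lifted_J q v : M := (- alpha q (0, (- v.2.2, v.2.1)), (- v.2.2, v.2.1)).

Definition dot v w : R := \sum_(i < n) (v.2.1 0 i * w.2.1 0 i + v.2.2 0 i * w.2.2 0 i).

(** The standard complex structure turns the symplectic form into the Euclidean
    scalar product, whence the compatibility. *)
Lemma alpha_J q v w : alpha v (lifted_J q w) = dot v w.
Proof. by apply: eq_bigr => i _; rewrite /= !mxE; ring. Qed.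

Lemma dot_ge0_eq0 v : 0 <= dot v v /\ (dot v v = 0 -> v.2 = 0).
Proof.
have nn i : 0 <= v.2.1 0 i * v.2.1 0 i + v.2.2 0 i * v.2.2 0 i.
  by rewrite -!expr2 addr_ge0 ?sqr_ge0.
split; first by apply: sumr_ge0 => i _.
move=> /eqP; rewrite psumr_eq0 => [/allP H|i _]; last exact: nn.
have Z i : v.2.1 0 i = 0 /\ v.2.2 0 i = 0.
  have := H i (mem_index_enum i); rewrite /= -!expr2 paddr_eq0 ?sqr_ge0 // !sqrf_eq0.
  by case/andP => /eqP -> /eqP ->.
case: v {nn H} Z => a [b c] /= Z; congr (_, _); apply/rowP => i;
  by rewrite mxE; case: (Z i).
Qed.

Lemma compatible_lifted_J : compatible_cs (@lambda0 R n) lifted_J.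
Proof.
split.
- by [].
- move=> Y sY _.
  have [_ Y1 Y2] := smooth_coordinates sY.
  have s2 : smooth (fun x => (Y x).2) by move=> k; exact: C_k_snd (sY k).
  have sN : smooth (fun x => - (Y x).2.2).
    move=> k; apply: (eq_C_k (f := fun x => (-1) *: (Y x).2.2)) => [x|].
      by rewrite scaleN1r.
    apply: (@C_k_linear_comp _ _ _ _ k (GRing.scale (-1))).
    - exact: linearP.
    - exact: scaler_continuous.
    - exact: C_k_snd (s2 k).
  have sP : smooth (fun x => (0, (- (Y x).2.2, (Y x).2.1)) : M).
    move=> k; apply: C_k_pair; first exact: C_k_cst.
    by apply: C_k_pair; [exact: sN | exact: C_k_fst (s2 k)].
  move=> k; apply: C_k_pair.
    by apply: smoothN; apply: smooth_alpha => //; exact: smooth_id.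
  by apply: C_k_pair; [exact: sN | exact: C_k_fst (s2 k)].
- move=> q c v w _ _; rewrite /lifted_J /=.
  have -> : (0, (- (c *: v.2.2 + w.2.2), c *: v.2.1 + w.2.1)) =
     c *: (0, (- v.2.2, v.2.1)) + (0, (- w.2.2, w.2.1)) :> M.
    by congr (_, (_, _)); rewrite /= ?scaler0 ?addr0 // opprD scalerN.
  rewrite alpha_linear_r; congr (_, (_, _)) => /=.
    by rewrite opprD scalerN.
  by rewrite opprD scalerN.
- move=> q v l0; split.
    rewrite /lambda0 /lifted_J /=.
    by rewrite [X in _ + X](_ : _ = alpha q (0, (- v.2.2, v.2.1))) ?addNr.
  rewrite /lifted_J /=.
  have -> : alpha q (0, (- v.2.1, - v.2.2)) = - alpha q v.
    by rewrite /alpha -sumrN; apply: eq_bigr => i _; rewrite /= !mxE; ring.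
  rewrite opprK; move: l0; rewrite /lambda0 => /eqP; rewrite addrC addr_eq0 => /eqP ->.
  by case: v => a [b c].
split.
- move=> q v w _ _; rewrite !ext_d_lambda0 !alpha_J; congr (2 * _).
  by apply: eq_bigr => i _; ring.
- move=> q v l0 v0; rewrite ext_d_lambda0 alpha_J mulr_gt0 //.
  have [d0 dz] := dot_ge0_eq0 v; rewrite lt0r d0 andbT.
  apply: contra v0 => /eqP /dz v2.
  have v1 : v.1 = 0.
    move: l0; rewrite /lambda0 [alpha q v](_ : _ = 0) ?addr0 //.
    by rewrite /alpha big1 // => i _; rewrite v2 /= !mxE; ring.
  by apply/eqP; case: v v1 v2 {l0 d0 dz} => a [b c] /= -> ->.
Qed.

End Contact.

Section Reeb.
Variables (R : realType) (n : nat).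
Local Notation M := (Mcov R n.+1).
Implicit Types (q v w : M).

Definition zdir : 'rV[R]_n.+1 := delta_mx 0 ord_max.

Lemma alpha_zdir q (c a b : R) : alpha q (c, (a *: zdir, b *: zdir)) =
  q.2.1 0 ord_max * b - q.2.2 0 ord_max * a.
Proof.
rewrite /alpha (bigD1 ord_max) //= big1 => [|i ni].
  by rewrite !mxE !eqxx !mulr1 addr0.
by rewrite !mxE (negbTE ni) andbF !mulr0 subr0.
Qed.

Lemma alpha_nondegenerate v : (forall w, alpha v w = 0) -> v.2 = 0.
Proof.
move=> H; have [_] := dot_ge0_eq0 v; apply.
by rewrite -(alpha_J v v v) H.
Qed.

(** Up to the scaling, the Reeb field is [d/dtheta] plus the contact lift of half
    the gradient of [F] rotated by a quarter turn.  Uniqueness: pairing with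
    [d/dtheta] shows that [F] is constant along any solution, and then the
    nondegeneracy of [alpha] determines it. *)
Lemma reeb_exp_scaled (F : M -> R) q (A B : R) : differentiable F q ->
  (forall v, 'D_v F q = A * v.2.1 0 ord_max + B * v.2.2 0 ord_max) ->
  reeb (exp_scaled F (@lambda0 R n.+1)) q = expR (- F q) *:
   ((1 + (q.2.1 0 ord_max * A + q.2.2 0 ord_max * B) / 2,
    ((B / 2) *: zdir, (- (A / 2)) *: zdir)) : M).
Proof.
move=> dF DF; set X := RHS.
pose l := exp_scaled F (@lambda0 R n.+1).
have eK : expR (F q) * expR (- F q) = 1 by rewrite expRN divff // gt_eqF ?expR_gt0.
have aX w : 2 * alpha X w = expR (- F q) * 'D_w F q.
  by rewrite alphaC /X alpha_scale alpha_zdir DF; field.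
have lX : lambda0 q X = expR (- F q).
  rewrite /lambda0 /X alpha_scale alpha_zdir /=.
  by rewrite /GRing.scale /=; field.
have dX : 'D_X F q = 0.
  by rewrite DF /X /= !mxE !eqxx /=; ring.
have PX : (forall v, ext_d l q X v = 0) /\ l q X = 1.
  split=> [v|]; last by rewrite /l /exp_scaled lX.
  by rewrite ext_d_exp_scaled // lX dX aX; ring.
have uniq Z : (forall v, ext_d l q Z v = 0) /\ l q Z = 1 -> Z = X.
  move=> [Z1 Z2]; have e0 : expR (F q) != 0 by rewrite gt_eqF ?expR_gt0.
  have lZ : lambda0 q Z = expR (- F q).
    by apply: (mulfI e0); rewrite eK; exact: Z2.
  have H v : 'D_Z F q * lambda0 q v - 'D_v F q * lambda0 q Z + 2 * alpha Z v = 0.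
    by apply: (mulfI e0); rewrite -ext_d_exp_scaled // mulr0; exact: Z1.
  (* The pairing with [d/dtheta]. *)
  have dZ : 'D_Z F q = 0.
    have := H (1, (0, 0)).
    have -> : 'D_(1, (0, 0)) F q = 0 by rewrite DF /= !mxE !mulr0 addr0.
    rewrite mul0r subr0.
    have -> : alpha Z (1, (0, 0)) = 0 by rewrite /alpha big1 // => i _; rewrite /= !mxE; ring.
    have -> : lambda0 q (1, (0, 0)) = 1.
      by rewrite /lambda0 /alpha big1 ?addr0 // => i _; rewrite /= !mxE; ring.
    by rewrite mulr1 mulr0 addr0.
  have aZ v : alpha (Z - X) v = 0.
    have : 2 * alpha Z v = 2 * alpha X v.
      rewrite aX; have := H v; rewrite dZ lZ mul0r add0r addrC => /eqP.
      by rewrite subr_eq0 => /eqP ->; rewrite mulrC.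
    rewrite [alpha (Z - X) v]alphaC alpha_sub [alpha Z v]alphaC [alpha X v]alphaC.
    by move: (alpha v Z) (alpha v X) => a b; clear; lra.
  have Z2' := alpha_nondegenerate aZ.
  apply/eqP; rewrite -subr_eq0; apply/eqP.
  have : lambda0 q (Z - X) = 0.
    rewrite /lambda0 alpha_sub -[(Z - X).1]/(Z.1 - X.1).
    have : lambda0 q Z = lambda0 q X by rewrite lZ lX.
    rewrite /lambda0; move: Z.1 X.1 (alpha q Z) (alpha q X); clear => a b c d; lra.
  rewrite /lambda0 [alpha q _](_ : _ = 0); last first.
    by rewrite /alpha big1 // => i _; rewrite Z2' /= !mxE; ring.
  rewrite addr0; case: (Z - X) Z2' => a b /= -> ->.
  done.
apply: uniq.
exact: (@xgetPex _ 0 [set X : M | (forall v, ext_d l q X v = 0) /\ l q X = 1]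
  (ex_intro _ X PX)).
Qed.

End Reeb.

(** * The cylinder over a gradient line *)

Section PairDerive.
Variables (R : realType) (V W W' : normedModType R).
Variables (f : V -> W) (g : V -> W') (x v : V).
Hypotheses (df : differentiable f x) (dg : differentiable g x).

Lemma derive_pair : 'D_v (fun y => (f y, g y)) x = ('D_v f x, 'D_v g x).
Proof.
rewrite deriveE; last exact: differentiable_pair.
by rewrite diff_pair // !deriveE.
Qed.
End PairDerive.

Section Conformal.
Variables (R : realType) (n : nat) (rm rp : R).
Hypotheses (rm0 : 0 < rm) (rmp : rm < rp).
Local Notation M := (Mcov R n.+1).
Local Notation px := (potential_x rm rp).
Local Notation py := (potential_y rm rp).

Definition conformal (q : M) : R :=
  potential rm rp (q.2.1 0 ord_max) (q.2.2 0 ord_max).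

Local Notation lam := (exp_scaled conformal (@lambda0 R n.+1)).

Lemma smooth_conformal_comp (V : normedModType R) (Y : V -> M) :
  smooth Y -> smooth (fun x => conformal (Y x)).
Proof.
by move=> /smooth_coordinates[_ y1 y2]; apply: smooth_potential_comp.
Qed.

Lemma smooth_conformal : smooth_function conformal.
Proof. by split => //; apply: smooth_conformal_comp; exact: smooth_id. Qed.

Lemma derive_conformal (q v : M) : 'D_v conformal q =
  px (q.2.1 0 ord_max) (q.2.2 0 ord_max) * v.2.1 0 ord_max +
  py (q.2.1 0 ord_max) (q.2.2 0 ord_max) * v.2.2 0 ord_max.
Proof.
have [_ s1 s2] := @smooth_coordinates R n.+1 M _ (@smooth_id R M).
have L1 : linear (fun q : M => q.2.1 0 ord_max : R) by move=> c a b; rewrite /= !mxE.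
have L2 : linear (fun q : M => q.2.2 0 ord_max : R) by move=> c a b; rewrite /= !mxE.
have [d1 D1] := @derive_linear _ _ _ _ q v L1 (smooth_continuous (s1 ord_max)).
have [d2 D2] := @derive_linear _ _ _ _ q v L2 (smooth_continuous (s2 ord_max)).
by rewrite (derive_potential rm0 rmp _ d1 d2) D1 D2.
Qed.

Lemma differentiable_conformal (q : M) : differentiable conformal q.
Proof. by apply: smooth_differentiable; have [] := smooth_conformal. Qed.

Lemma reeb_conformal (q : M)
  (A := px (q.2.1 0 ord_max) (q.2.2 0 ord_max))
  (B := py (q.2.1 0 ord_max) (q.2.2 0 ord_max)) :
  reeb lam q = expR (- conformal q) *:
   ((1 + (q.2.1 0 ord_max * A + q.2.2 0 ord_max * B) / 2,
    ((B / 2) *: zdir R n, (- (A / 2)) *: zdir R n)) : M).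
Proof.
apply: reeb_exp_scaled; first exact: differentiable_conformal.
by move=> v; exact: derive_conformal.
Qed.

Section Cylinder.
Variables (q0 : M) (xs ys gs as_ : R -> R).
Hypotheses (sx : smooth xs) (sy : smooth ys) (sg : smooth gs) (sa : smooth as_).
Hypothesis dx : forall t, is_derive t (1 : R) xs (pi * px (xs t) (ys t)).
Hypothesis dy : forall t, is_derive t (1 : R) ys (pi * py (xs t) (ys t)).
Hypothesis dg : forall t, is_derive t (1 : R) gs
  (pi * (ys t * px (xs t) (ys t) - xs t * py (xs t) (ys t))).
Hypothesis da : forall t, is_derive t (1 : R) as_
  (2 * pi * expR (potential rm rp (xs t) (ys t))).

Definition base_x : 'rV[R]_n.+1 := q0.2.1 - q0.2.1 0 ord_max *: zdir R n.
Definition base_y : 'rV[R]_n.+1 := q0.2.2 - q0.2.2 0 ord_max *: zdir R n.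

(** The function [gs] makes the [d/ds]-derivative tangent to the contact
    hyperplanes, so that [lambda0] pulls back to a multiple of [dt]. *)
Definition cyl (x : Ccov R) : M :=
  (2 * pi * x.2 + gs x.1, (base_x + xs x.1 *: zdir R n, base_y + ys x.1 *: zdir R n)).

Definition cyl_a (x : Ccov R) : R := as_ x.1.

Lemma cyl_coord x : (cyl x).2.1 0 ord_max = xs x.1 /\ (cyl x).2.2 0 ord_max = ys x.1.
Proof.
rewrite /cyl /base_x /base_y /zdir /= !mxE !eqxx /=.
by split; ring.
Qed.

Lemma conformal_cyl x : conformal (cyl x) = potential rm rp (xs x.1) (ys x.1).
Proof. by rewrite /conformal; have [-> ->] := cyl_coord x. Qed.

Lemma smooth_fst_comp (h : R -> R) : smooth h -> smooth (fun x : Ccov R => h x.1).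
Proof. by move=> sh; apply: smooth_comp => // k; apply: C_k_fst; exact: C_k_id. Qed.

Lemma derive_fst_comp (h dh : R -> R) (x v : Ccov R) : smooth h ->
  (forall t, is_derive t (1 : R) h (dh t)) ->
  'D_v (fun y : Ccov R => h y.1) x = dh x.1 * v.1.
Proof.
move=> sh Hd.
have s1 : smooth (fun y : Ccov R => y.1 : R) by move=> k; apply: C_k_fst; exact: C_k_id.
rewrite (derive_comp_R _ (smooth_differentiable _ s1)); last exact: smooth_derivable.
by rewrite (derive1_is_derive (Hd _)) derive_fst.
Qed.

Lemma smooth_angle : smooth (fun x : Ccov R => 2 * pi * x.2 + gs x.1 : R).
Proof.
apply: smoothD; last exact: smooth_fst_comp.
apply: smoothM; first exact: smooth_cst.
by move=> k; apply: C_k_snd; exact: C_k_id.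
Qed.

Lemma smooth_row (h : R -> R) (b : 'rV[R]_n.+1) : smooth h ->
  smooth (fun x : Ccov R => b + h x.1 *: zdir R n).
Proof.
move=> sh; apply: smoothD; first exact: smooth_cst.
by move=> k; apply: C_kZl; exact: smooth_fst_comp.
Qed.

Lemma smooth_cyl : smooth cyl.
Proof.
move=> k; apply: C_k_pair; first exact: smooth_angle.
by apply: C_k_pair; exact: smooth_row.
Qed.

Lemma derive_row (h dh : R -> R) (b : 'rV[R]_n.+1) (x v : Ccov R) : smooth h ->
  (forall t, is_derive t (1 : R) h (dh t)) ->
  'D_v (fun x : Ccov R => b + h x.1 *: zdir R n) x = (dh x.1 * v.1) *: zdir R n.
Proof.
move=> sh Hd.
have dh1 : differentiable (fun x : Ccov R => h x.1) x.
  by apply: smooth_differentiable; exact: smooth_fst_comp.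
rewrite (@deriveD _ _ _ (fun=> b) (fun x : Ccov R => h x.1 *: zdir R n)); last 2 first.
- by apply: diff_derivable; exact: differentiable_cst.
- by apply: diff_derivable; exact: differentiableZl.
by rewrite derive_cst add0r derive_scale_vec // (derive_fst_comp _ _ sh Hd).
Qed.

Lemma derive_angle (x v : Ccov R) : 'D_v (fun x : Ccov R => 2 * pi * x.2 + gs x.1 : R) x =
  2 * pi * v.2 + pi * (ys x.1 * px (xs x.1) (ys x.1) - xs x.1 * py (xs x.1) (ys x.1)) * v.1.
Proof.
have s2 : smooth (fun x : Ccov R => x.2 : R) by move=> k; apply: C_k_snd; exact: C_k_id.
have d2 := smooth_differentiable x s2.
have d1 := smooth_differentiable x (smooth_fst_comp sg).
have dc : differentiable (fun _ : Ccov R => 2 * pi : R) x by exact: differentiable_cst.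
rewrite (deriveD_fun _ (differentiableM_fun dc d2) d1) (deriveM_fun _ dc d2).
by rewrite derive_cst mulr0 addr0 derive_snd (derive_fst_comp _ _ sg dg).
Qed.

Lemma diff_cyl x v : 'd cyl x v =
  (2 * pi * v.2 + pi * (ys x.1 * px (xs x.1) (ys x.1) - xs x.1 * py (xs x.1) (ys x.1)) * v.1,
   ((pi * px (xs x.1) (ys x.1) * v.1) *: zdir R n,
    (pi * py (xs x.1) (ys x.1) * v.1) *: zdir R n)).
Proof.
have d0 := smooth_differentiable x smooth_angle.
have d1 := smooth_differentiable x (smooth_row base_x sx).
have d2 := smooth_differentiable x (smooth_row base_y sy).
rewrite -deriveE; last by apply: smooth_differentiable; exact: smooth_cyl.
rewrite (derive_pair v d0 (differentiable_pair d1 d2)) (derive_pair v d1 d2).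
by rewrite derive_angle (derive_row _ _ _ sx dx) (derive_row _ _ _ sy dy).
Qed.

Lemma pullback_cyl x v : pullback cyl lam x v =
  2 * pi * expR (potential rm rp (xs x.1) (ys x.1)) * v.2.
Proof.
rewrite /pullback /exp_scaled conformal_cyl diff_cyl /lambda0 alpha_zdir.
by have [-> ->] := cyl_coord x; rewrite /=; ring.
Qed.

Lemma smooth_cylinder_cyl : smooth_cylinder_map cyl_a cyl.
Proof.
split => //; first exact: smooth_fst_comp; first exact: smooth_cyl.
by move=> k x; exists k; rewrite /deck /cyl /cyl_shift /=; congr (_, _); ring.
Qed.

Lemma diff_cyl_a x v : 'd cyl_a x v =
  2 * pi * expR (potential rm rp (xs x.1) (ys x.1)) * v.1.
Proof.
rewrite -deriveE; first exact: derive_fst_comp sa da.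
by apply: smooth_differentiable; exact: smooth_fst_comp.
Qed.

(** With [z = (xs, ys)]: [d/ds] projects to the lift of [z' = pi grad F], and
    [d/dt], after the removal of its Reeb component, to the lift of
    [pi i grad F].  Hence [pseudoholomorphic_cyl]. *)
Lemma proj_xi_cyl x v : proj_xi lam (cyl x) ('d cyl x v) =
  let A := px (xs x.1) (ys x.1) in let B := py (xs x.1) (ys x.1) in
  (pi * (ys x.1 * A - xs x.1 * B) * v.1 - pi * v.2 * (xs x.1 * A + ys x.1 * B),
   ((pi * A * v.1 - pi * v.2 * B) *: zdir R n, (pi * B * v.1 + pi * v.2 * A) *: zdir R n)).
Proof.
rewrite /proj_xi; set A := px _ _; set B := py _ _.
have -> : lam (cyl x) ('d cyl x v) = 2 * pi * v.2 * expR (conformal (cyl x)).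
  by rewrite [LHS]pullback_cyl conformal_cyl; ring.
rewrite reeb_conformal scalerA.
have -> : 2 * pi * v.2 * expR (conformal (cyl x)) * expR (- conformal (cyl x)) = 2 * pi * v.2.
  by rewrite expRN mulfK // gt_eqF ?expR_gt0.
have [-> ->] := cyl_coord x; rewrite diff_cyl -/A -/B.
congr (_, (_, _)); rewrite /=.
- by rewrite /GRing.scale /=; field.
- by rewrite scalerA -scalerBl; congr (_ *: _); field.
- by rewrite scalerA -scalerBl; congr (_ *: _); field.
Qed.

Lemma pseudoholomorphic_cyl : pseudoholomorphic lam (@lifted_J R n.+1) cyl_a cyl.
Proof.
split=> x v; last by rewrite pullback_cyl diff_cyl_a.
rewrite !proj_xi_cyl /lifted_J /= -[- (_ *: zdir R n)]scaleNr alpha_zdir.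
have [] := cyl_coord x; rewrite /= => -> ->.
by congr (_, (_ *: _, _ *: _)); ring.
Qed.

End Cylinder.
End Conformal.

(** * Hofer energy *)

Section StripIntegral.
Variable R : realType.
Local Notation mu := (@lebesgue_measure R).

(** The fundamental theorem on the intervals from [-n] to [n] and monotone
    convergence. *)
Lemma integral_derive_le (h dh : R -> R) (K : R) : continuous dh ->
  (forall s, 0 <= dh s) -> (forall s, is_derive s (1 : R) h (dh s)) ->
  (forall s, 0 <= h s <= K) -> (\int[mu]_x (dh x)%:E <= K%:E)%E.
Proof.
move=> cdh dh0 Hd hK.
have ch : continuous h by exact: is_derive_continuous Hd.
pose A (n : nat) : set (measurableTypeR R) := `[- n%:R, n%:R]%classic.
have mdh (D : set (measurableTypeR R)) : measurable D ->
    measurable_fun D (EFin \o (dh : measurableTypeR R -> R)).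
  move=> mD; apply/measurable_EFinP; apply: measurable_funS (@subsetT _ D) _ => //.
  exact: continuous_measurable_fun.
have nA : nondecreasing_seq A.
  move=> i j ij; apply/subsetPset => x; rewrite /A /= !in_itv /= => /andP[a b].
  have le : i%:R <= j%:R :> R by rewrite ler_nat.
  by rewrite (le_trans _ a) ?(le_trans b) // lerN2.
have UA : \bigcup_i A i = setT by exact: (bigcup_itvT true false).
have L : (\int[mu]_(x in A i) (dh x)%:E)%E @[i --> \oo] --> (\int[mu]_x (dh x)%:E)%E.
  rewrite -UA; apply: (@ge0_nondecreasing_set_cvg_integral _ (measurableTypeR R) R A (fun x => (dh x)%:E)) => // i.
  - exact: measurable_itv.
  - by apply: mdh; exact: measurable_itv.
  - by move=> x _; rewrite lee_fin.
have cL := cvg_lim (@ereal_hausdorff R) L.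
rewrite -cL; apply: lime_le; first by apply/cvg_ex; eexists; exact: L.
apply: nearW => n; case: n => [|n].
  have -> : A 0%N = [set 0].
    by rewrite /A oppr0 set_itv1.
  rewrite integral_set1 lee_fin; by case/andP: (hK 0); exact: le_trans.
have nn : - n.+1%:R < n.+1%:R :> R by rewrite gtrN // ltr0n.
rewrite (continuous_FTC2 nn (F := h)).
- rewrite -EFinB lee_fin.
  by case/andP: (hK (- n.+1%:R)) (hK n.+1%:R) => a b /andP[c d]; lra.
- exact: continuous_subspaceT.
- split=> [x _||].
  + by case: (Hd x).
  + exact: cvg_at_right_filter (ch _).
  + exact: cvg_at_left_filter (ch _).
- by move=> x _; rewrite (derive1_is_derive (Hd x)).
Qed.

(** Tonelli: the fundamental domain has width one in the second variable, on
    which the integrand does not depend. *)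
Lemma strip_integral_le (h dh : R -> R) (K : R) : continuous dh ->
  (forall s, 0 <= dh s) -> (forall s, is_derive s (1 : R) h (dh s)) ->
  (forall s, 0 <= h s <= K) ->
  (\int[mu \x mu]_(x in [set x : R * R | (0 <= x.2 < 1)%R]) (dh x.1)%:E <= K%:E)%E.
Proof.
move=> cdh dh0 Hd hK.
rewrite integral_mkcond.
pose g (z : R * R) : \bar R := (dh z.1 * \1_(`[0, 1[%classic : set R) z.2)%:E.
rewrite (_ : _ \_ _ = g); last first.
  apply/funext => z; rewrite patchE /g indicE.
  case: ifPn => [/set_mem /= zD|zD].
    by rewrite mem_set ?mulr1 //= in_itv.
  rewrite memNset ?mulr0 //= in_itv /= => h'.
  by move/negP: zD; apply; exact: mem_set.
have mg : measurable_fun setT g.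
  apply/measurable_EFinP; apply: measurable_funM.
    apply: measurableT_comp; last exact: measurable_fst.
    exact: continuous_measurable_fun.
  apply: measurableT_comp; last exact: measurable_snd.
  by apply: measurable_indic; exact: measurable_itv.
have g0 z : (0 <= g z)%E by rewrite lee_fin mulr_ge0.
rewrite fubini_tonelli1 // /fubini_F.
rewrite [X in (X <= _)%E](_ : _ = \int[mu]_x (dh x)%:E)%E.
  exact: integral_derive_le Hd hK.
apply: eq_integral => x _; rewrite /g /=.
under eq_integral do rewrite EFinM.
rewrite ge0_integralZl //; last 2 first.
- by apply: measurableT_comp => //; apply: measurable_indic; exact: measurable_itv.
- by rewrite lee_fin.
rewrite integral_indic // setIT [X in (_ * X)%E](_ : _ = 1%E) ?mule1 //.
have := @lebesgue_measure_itv R `[0, 1[; rewrite /= lte_fin ltr01 oppr0 adde0.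
by move=> <-.
Qed.

End StripIntegral.

Section Energy.
Variables (R : realType) (n : nat) (rm rp : R).
Hypotheses (rm0 : 0 < rm) (rmp : rm < rp).
Local Notation M := (Mcov R n.+1).
Local Notation px := (potential_x rm rp).
Local Notation py := (potential_y rm rp).
Local Notation lam := (exp_scaled (@conformal R n rm rp) (@lambda0 R n.+1)).
Variables (q0 : M) (xs ys gs as_ : R -> R).
Hypotheses (sx : smooth xs) (sy : smooth ys) (sg : smooth gs) (sa : smooth as_).
Hypothesis dx : forall t, is_derive t (1 : R) xs (pi * px (xs t) (ys t)).
Hypothesis dy : forall t, is_derive t (1 : R) ys (pi * py (xs t) (ys t)).
Hypothesis dg : forall t, is_derive t (1 : R) gs
  (pi * (ys t * px (xs t) (ys t) - xs t * py (xs t) (ys t))).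
Hypothesis da : forall t, is_derive t (1 : R) as_
  (2 * pi * expR (potential rm rp (xs t) (ys t))).
Hypothesis Ple1 : forall t, potential rm rp (xs t) (ys t) <= 1.
Local Notation P := (fun t => potential rm rp (xs t) (ys t)).
Local Notation u := (cyl q0 xs ys gs).
Local Notation a := (cyl_a as_).

Let smooth_P : smooth (P : R -> R).
Proof. exact: smooth_potential_comp. Qed.

Let der_P t : is_derive t (1 : R) P (pi * (px (xs t) (ys t) ^+ 2 + py (xs t) (ys t) ^+ 2)).
Proof.
apply: DeriveDef; first exact: smooth_derivable.
have [dx1 ex] := dx t; have [dy1 ey] := dy t.
have d1 : differentiable xs t by exact/derivable1_diffP.
have d2 : differentiable ys t by exact/derivable1_diffP.
by rewrite (derive_potential rm0 rmp _ d1 d2) ex ey; ring.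
Qed.

(** The pullback form is [2 pi e^P dt] with [P] the potential along the
    trajectory, so the integrand is the [s]-derivative of
    [phi(a) 2 pi e^P].  It is nonnegative because [phi], [a] and [P] increase,
    and its integral is at most [2 pi e] because [phi <= 1] and [P <= 1]. *)
Lemma hofer_energy_finite : (hofer_energy lam a u < +oo)%E.
Proof.
apply: (@le_lt_trans _ _ (2 * pi * expR 1)%:E); last by rewrite ltry.
apply: ge_ereal_sup => _ [phi [sphi p01 dp0 _ _] <-].
pose H s := phi (as_ s) * (2 * pi * expR (P s)).
have sE : smooth (fun s => 2 * pi * expR (P s) : R).
  apply: smoothM; first exact: smooth_cst.
  by apply: smooth_comp smooth_P; exact: smooth_expR.
have sH : smooth H by apply: smoothM => //; exact: smooth_comp.
have pi0 := @pi_gt0 R.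
have DH s : is_derive s (1 : R) H (derive1 H s) by exact: smooth_is_derive.
rewrite [X in (X <= _)%E](_ : _ = \int[lebesgue_measure \x lebesgue_measure]_(x in
    [set x : R * R | (0 <= x.2 < 1)%R]) (derive1 H x.1)%:E)%E.
  apply: (@strip_integral_le _ H).
  - by apply: smooth_continuous; exact: smooth_derive1.
  - move=> s; have d1 := der_comp (smooth_is_derive (as_ s) sphi) (da s).
    have d2 := der_M d1 (der_M (der_cst (2 * pi) s) (der_expR (der_P s))).
    rewrite (derive1_is_derive d2) mul0r add0r.
    have /andP[p0 _] := p01 (as_ s).
    have e0 := expR_ge0 (P s); have q0' := addr_ge0 (sqr_ge0 (px (xs s) (ys s))) (sqr_ge0 (py (xs s) (ys s))).
    have tpE : 0 <= 2 * pi * expR (P s) by rewrite mulr_ge0 // mulr_ge0 // ltW.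
    apply: addr_ge0; first exact: mulr_ge0 (mulr_ge0 (dp0 _) tpE) tpE.
    apply: mulr_ge0 => //; rewrite mulrA; apply: mulr_ge0 => //.
    exact: mulr_ge0 (ltW pi0) q0'.
  - move=> s; have /andP[p0 p1] := p01 (as_ s).
    have E0 : 0 <= 2 * pi * expR (P s) by rewrite !mulr_ge0 ?expR_ge0 // ltW.
    rewrite mulr_ge0 //= -[leRHS]mul1r ler_pM // ler_pM2l ?mulr_gt0 //.
    by rewrite ler_expR.
apply: eq_integral => x _; congr (_%:E); rewrite /ext_d.
have e1 : (fun y => phi (a y) * pullback u lam y ((0 : R), (1 : R))) = (fun y : Ccov R => H y.1).
  by apply/funext => y; rewrite pullback_cyl //= mulr1.
have e2 : (fun y => phi (a y) * pullback u lam y ((1 : R), (0 : R))) = (fun y : Ccov R => 0).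
  by apply/funext => y; rewrite pullback_cyl //= !mulr0.
rewrite e1 e2 derive_cst subr0.
by rewrite (derive_fst_comp _ _ sH DH) mulr1.
Qed.

End Energy.

(** * Cylindrical ends and loops along the circle factor *)

Section Orientation.
Variable R : realType.

Definition end_sign (z0 : bool) : R := if z0 then 1 else -1.

Lemma end_sign_sqr z0 : end_sign z0 * end_sign z0 = 1.
Proof. by case: z0; rewrite /end_sign ?mulr1 ?mulrNN ?mulr1. Qed.

Lemma end_sign_neq0 z0 : end_sign z0 != 0.
Proof. by case: z0; rewrite /end_sign ?oppr_eq0 oner_eq0. Qed.

Definition end_signz (z0 : bool) : int := if z0 then 1 else -1.

Lemma end_signzE z0 : (end_signz z0)%:~R = end_sign z0 :> R.
Proof. by case: z0; rewrite /= ?intrN. Qed.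

(** The half-turn at the negative puncture is holomorphic, unlike a reflection
    in [s] alone; this is why the sign also appears in the second coordinate. *)
Definition standard_end (z0 : bool) (x : Ccov R) : Ccov R :=
  (end_sign z0 * x.1, end_sign z0 * x.2).

Lemma cylindrical_standard_end z0 : cylindrical_coordinates z0 (standard_end z0).
Proof.
have L : linear (standard_end z0).
  move=> c u v; rewrite /standard_end; congr (_, _).
    by rewrite -[LHS]/(end_sign z0 * (c * u.1 + v.1)) -[RHS]/(c * (end_sign z0 * u.1) + end_sign z0 * v.1); ring.
  by rewrite -[LHS]/(end_sign z0 * (c * u.2 + v.2)) -[RHS]/(c * (end_sign z0 * u.2) + end_sign z0 * v.2); ring.
have C : continuous (standard_end z0).
  apply: (@smooth_continuous R (Ccov R) (Ccov R)) => k.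
  apply: C_k_pair; (apply: C_kM; first exact: C_k_cst).
    by apply: C_k_fst; exact: C_k_id.
  by apply: C_k_snd; exact: C_k_id.
have D x : differentiable (standard_end z0) x /\
    forall v, 'd (standard_end z0) x v = standard_end z0 v.
  have [d _] := @derive_linear R _ _ _ x 0 L C; split=> // v.
  by rewrite -deriveE //; have [] := @derive_linear R _ _ _ x v L C.
have ss := end_sign_sqr z0; have s0 := end_sign_neq0 z0.
split.
- exists 1 => // x _; have [d dE] := D x; split => // v.
  by rewrite !dE /standard_end /cyl_j /= mulrN.
- move=> x _ k; exists (end_signz z0 * k).
  by rewrite /standard_end /cyl_shift /= intrM end_signzE mulrDr.
- move=> x y _ _ [m]; rewrite /standard_end /cyl_shift /= => -[e1 e2].
  exists (end_signz z0 * m); rewrite intrM end_signzE.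
  case: x y e1 e2 => x1 x2 [y1 y2] /= e1 e2; congr (_, _).
    exact: (mulfI s0).
  by apply: (mulfI s0); rewrite e2 mulrDr mulrA ss mul1r.
- move=> x v _ v0; have [_ ->] := D x; apply: contra v0.
  case: v => v1 v2; rewrite /standard_end /= => /eqP[/eqP].
  rewrite mulf_eq0 (negbTE s0) /= => /eqP -> /eqP.
  by rewrite mulf_eq0 (negbTE s0) /= => /eqP ->.
- move=> A; near=> s; move=> t; rewrite /standard_end /end_sign.
  have As : A < s by near: s; apply: nbhs_pinfty_gt; exact: num_real.
  by case: z0 {L C D ss s0}; rewrite ?mul1r ?mulN1r ?opprK.
Unshelve. all: by end_near. Qed.

Lemma hits_angle (Phi : R -> R) : continuous Phi ->
  (forall K, exists T, forall t, T <= t -> K <= Phi t) ->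
  forall c N, exists t, N <= t /\ exists m : nat, Phi t = c + pi *+ 2 *+ m.
Proof.
move=> cP H c N.
have pi2 : 1 <= pi *+ 2 :> R by rewrite mulr2n; have := @pi_ge2 R; lra.
pose m := (Num.truncn `|Phi N - c|).+1.
have mP : Phi N <= c + pi *+ 2 *+ m.
  have h : `|Phi N - c| <= m%:R by apply: ltW; exact: truncnS_gt.
  have : m%:R <= pi *+ 2 *+ m :> R by rewrite -[pi *+ 2 *+ m]mulr_natr ler_peMl.
  by have := ler_norm (Phi N - c); lra.
have [T HT] := H (c + pi *+ 2 *+ m).
have [||t /andP[Nt _] e] := @intermediate_value R Phi N (Num.max N T) (c + pi *+ 2 *+ m) cP.
- by rewrite le_max lexx.
- by rewrite mP HT // le_max lexx orbT.
by exists t; split => //; exists m.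
Qed.

Lemma trig_period (x : R) m : cos (x + pi *+ 2 *+ m) = cos x /\ sin (x + pi *+ 2 *+ m) = sin x.
Proof. by split; [exact: periodicn (@cosD2pi R) m x | exact: sin_period]. Qed.

End Orientation.

Section Loops.
Variables (R : realType) (n : nat) (rm rp : R).
Hypotheses (rm0 : 0 < rm) (rmp : rm < rp).
Local Notation M := (Mcov R n.+1).
Local Notation lam := (exp_scaled (@conformal R n rm rp) (@lambda0 R n.+1)).

(** The sign [e] is [-1] at the negative puncture, where the positively oriented
    loops around the puncture run backwards along the circle factor. *)
Definition fibre_loop (e c : R) (w : ('rV[R]_n.+1 * 'rV[R]_n.+1)%type) (t : R) : M :=
  (e * (2 * pi) * t + c, w).

Lemma fibre_loopE e c w : fibre_loop e c w =
  (fun t => t *: ((e * (2 * pi), 0) : M) + ((c, w) : M)).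
Proof.
apply/funext => t; rewrite /fibre_loop; congr (_, _) => /=.
  by rewrite /GRing.scale /=; ring.
by rewrite scaler0 add0r.
Qed.

Lemma smooth_fibre_loop e c w : smooth (fibre_loop e c w : R -> M).
Proof.
rewrite fibre_loopE; apply: smoothD; last exact: smooth_cst.
by move=> k; apply: C_kZl; exact: C_k_id.
Qed.

Lemma derive1_fibre_loop e c w t : derive1 (fibre_loop e c w) t = ((e * (2 * pi), 0) : M).
Proof.
rewrite fibre_loopE derive1E.
have di : differentiable (fun t : R => t) t by apply: ex_diff.
rewrite (@deriveD _ _ _ (fun t : R => t *: ((e * (2 * pi), 0) : M)) (fun=> ((c, w) : M))).
- by rewrite derive_scale_vec // derive_cst addr0 derive_id scale1r.
- by apply: diff_derivable; exact: differentiableZl.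
- by apply: diff_derivable; exact: differentiable_cst.
Qed.

(** Loops along the circle factor differ by translations, so only the difference
    of order [0] matters for their smooth convergence. *)
Lemma derive1n_shift m (G : R -> M) (w : M) : smooth G ->
  forall t, derive1n m (fun t => G t + w) t - derive1n m G t = if m is 0 then w else 0.
Proof.
move=> sG t; case: m => [|m].
  by rewrite /derive1n /= addrAC subrr add0r.
rewrite !derive1Sn.
have -> : derive1 (fun t => G t + w) = derive1 G.
  apply/funext => s; rewrite !derive1E.
  rewrite (@deriveD _ _ _ G (fun=> w)) ?derive_cst ?addr0 //.
  exact: smooth_derivable.
by rewrite subrr.
Qed.

Lemma fibre_loop_shift (e c c' : R) w w' k t :
  deck k (fibre_loop e c w t) = fibre_loop e c' w' t + ((c + k%:~R * (2 * pi) - c', w - w') : M).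
Proof.
rewrite /deck /fibre_loop; congr (_, _) => /=; first by ring.
by rewrite addrCA subrr addr0.
Qed.

Lemma loop_cvg (e : R) (c : nat -> R) (w : nat -> ('rV[R]_n.+1 * 'rV[R]_n.+1)%type)
   (k : nat -> int) (c' : R) w' :
  (c i + (k i)%:~R * (2 * pi)) @[i --> \oo] --> c' -> w i @[i --> \oo] --> w' ->
  Cinfty_loop_cvg (fun i => fibre_loop e (c i) (w i)) (fibre_loop e c' w').
Proof.
move=> hc hw; exists k => m d d0.
have : ((c i + (k i)%:~R * (2 * pi) - c', w i - w') : M) @[i --> \oo] --> ((c' - c', w' - w') : M).
  have h1 : (c i + (k i)%:~R * (2 * pi) - c') @[i --> \oo] --> c' - c'.
    by apply: cvgB => //; exact: cvg_cst.
  have h2 : (w i - w') @[i --> \oo] --> w' - w'.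
    by apply: cvgB => //; exact: cvg_cst.
  exact: cvg_pair h1 h2.
rewrite !subrr => /cvgrPdist_lt /(_ d d0) H.
near=> i; move=> t.
have -> : (fun t0 => deck (k i) (fibre_loop e (c i) (w i) t0)) =
   (fun t0 => fibre_loop e c' w' t0 + ((c i + (k i)%:~R * (2 * pi) - c', w i - w') : M)).
  by apply/funext => t0; exact: fibre_loop_shift.
rewrite derive1n_shift; last exact: smooth_fibre_loop.
case: m; last by rewrite normr0.
by rewrite -normrN -[X in `|X|]add0r; near: i; exact: H.
Unshelve. all: by end_near. Qed.

Lemma lam_fibre e c w t : lam (fibre_loop e c w t) ((e * (2 * pi), 0) : M) =
  expR (conformal rm rp (fibre_loop e c w t)) * (e * (2 * pi)).
Proof.
rewrite /exp_scaled /lambda0 /alpha big1 ?addr0 // => i _.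
by rewrite /= !mxE; ring.
Qed.

Lemma mass_fibre e c w : \int[lebesgue_measure]_(t in `[0, 1])
   pullback (fibre_loop e c w) lam t 1 =
   expR (potential rm rp (w.1 0 ord_max) (w.2 0 ord_max)) * (e * (2 * pi)).
Proof.
set K := RHS.
have E t : pullback (fibre_loop e c w) lam t 1 = K.
  rewrite /pullback -derive1E'; last first.
    by apply: smooth_differentiable; exact: smooth_fibre_loop.
  by rewrite derive1_fibre_loop lam_fibre.
rewrite (@eq_Rintegral _ _ _ _ _ (fun=> K)); last by move=> t _; rewrite E.
rewrite Rintegral_cst //.
have := @lebesgue_measure_itv R `[0, 1]; rewrite /= lte_fin ltr01 oppr0 adde0 => ->.
by rewrite mulr1.
Qed.

(** On the boundary circles the gradient of the potential vanishes, and the Reeb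
    field is a multiple of [d/dtheta]. *)
Lemma periodic_fibre z0 c (w : ('rV[R]_n.+1 * 'rV[R]_n.+1)%type) :
  let q := (w.1 0 ord_max) ^+ 2 + (w.2 0 ord_max) ^+ 2 in
  q = qm rm \/ q = qp rp ->
  periodic_orbit lam
    (expR (potential rm rp (w.1 0 ord_max) (w.2 0 ord_max)) * (end_sign R z0 * (2 * pi)))
    (fibre_loop (end_sign R z0) c w).
Proof.
move=> q hq; split.
- exact: smooth_fibre_loop.
- move=> t; exists (end_signz z0).
  by rewrite /deck /fibre_loop end_signzE; congr (_, _) => /=; ring.
- move=> t; rewrite derive1_fibre_loop reeb_conformal //.
  have [z1 z2] := @critical_circles R rm rp rm0 rmp (w.1 0 ord_max) (w.2 0 ord_max) hq.
  rewrite [(fibre_loop _ _ _ _).2]/= z1 z2.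
  rewrite !(mulr0, mul0r, oppr0, addr0, scale0r) scalerA.
  have -> : expR (potential rm rp (w.1 0 ord_max) (w.2 0 ord_max)) * (end_sign R z0 * (2 * pi)) *
     expR (- conformal rm rp (fibre_loop (end_sign R z0) c w t)) = end_sign R z0 * (2 * pi).
    by rewrite mulrAC /conformal /= expRN divff ?mul1r // gt_eqF ?expR_gt0.
  congr (_, _) => /=; first by rewrite [_ *: 1]mulr1.
  by congr (_, _) => /=; rewrite scaler0.
Qed.

End Loops.

(** * The limit set *)

Lemma smooth_of_is_derive (R : realType) (h dh : R -> R) : smooth (dh : R -> R) ->
  (forall t, is_derive t (1 : R) h (dh t)) -> smooth (h : R -> R).
Proof.
move=> sd Hd; apply/smooth1P; split; first by move=> t; case: (Hd t).
by move=> k; apply: eq_C_k (sd k) => t; rewrite (derive1_is_derive (Hd t)).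
Qed.

Lemma smooth_potential_partials (R : realType) (rm rp : R) (V : normedModType R) (x y : V -> R) :
  0 < rm -> rm < rp -> smooth x -> smooth y ->
  smooth (fun p => potential_x rm rp (x p) (y p)) /\
  smooth (fun p => potential_y rm rp (x p) (y p)).
Proof.
move=> rm0 rmp sx sy; have [s1 s2] := smooth_coeff rm0 rmp; have s0 := smooth_step_annulus rm0 rmp.
have sq : smooth (fun p => x p ^+ 2 + y p ^+ 2).
  by apply: smoothD; exact: smoothX.
have sr : smooth (fun p => radial rm rp (x p) (y p)).
  apply: smoothD; first exact: smooth_comp (smooth_derive1 s0) sq.
  by apply: smoothD; apply: smoothM => //; [exact: smooth_comp (smooth_derive1 s1) sq
    | exact: smooth_comp (smooth_derive1 s2) sq].
have c2 : smooth (fun _ : V => 2 : R) by exact: smooth_cst.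
split; apply: smoothD.
- by apply: smoothM => //; exact: smoothM.
- exact: smooth_comp s1 sq.
- by apply: smoothM => //; exact: smoothM.
- exact: smooth_comp s2 sq.
Qed.

Section LimitSet.
Variables (R : realType) (n : nat) (rm rp : R).
Hypotheses (rm0 : 0 < rm) (rmp : rm < rp).
Let rp0 : 0 < rp. Proof. exact: lt_trans rm0 rmp. Qed.
Local Notation M := (Mcov R n.+1).
Local Notation lam := (exp_scaled (@conformal R n rm rp) (@lambda0 R n.+1)).
Local Notation sgn := (end_sign R).
Variables (q0 : M) (r phi gs : R -> R).
Let xs t := r t * cos (phi t).
Let ys t := r t * sin (phi t).
Local Notation u := (cyl q0 xs ys gs).
Local Notation P := (fun t => potential rm rp (r t * cos (phi t)) (r t * sin (phi t))).
Hypothesis cphi : continuous phi.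
Hypothesis angle : forall K, exists T, forall t, T <= t -> K <= phi t /\ phi (- t) <= - K.
Hypothesis ends : forall e, 0 < e -> exists T, forall t, T <= t ->
  [/\ rp - r t < e, r (- t) - rm < e, 1 - P t < e & P (- t) < e].
Hypothesis inside : forall t, rm < r t < rp /\ 0 < P t < 1.

Definition end_radius z0 : R := if z0 then rp else rm.
Definition end_value (z0 : bool) : R := if z0 then 1 else 0.

Lemma end_limits z0 e : 0 < e -> exists T, forall t, T <= t ->
  `|r (sgn z0 * t) - end_radius z0| < e /\ `|P (sgn z0 * t) - end_value z0| < e.
Proof.
move=> e0; have [T HT] := ends e0; exists T => t /HT[h1 h2 h3 h4].
case: z0; rewrite /end_sign /end_radius /end_value ?mul1r ?mulN1r.
  have [/andP[a b] /andP[c d]] := inside t.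
  by split; rewrite distrC ger0_norm ?subr_ge0 // ltW.
have [/andP[a b] /andP[c d]] := inside (- t).
by split; rewrite ger0_norm ?subr0 ?subr_ge0 // ltW.
Qed.

Lemma end_radius_cvg z0 (s : nat -> R) : s i @[i --> \oo] --> +oo ->
  r (sgn z0 * s i) @[i --> \oo] --> end_radius z0.
Proof.
move=> hs; apply/cvgrPdist_lt => e e0; have [T HT] := end_limits z0 e0.
near=> i; rewrite distrC; apply: (HT _ _).1.
by near: i; move/cvgryPge : hs; exact.
Unshelve. all: by end_near. Qed.

Lemma u_standard_end z0 s t : u (standard_end z0 (s, t)) =
  fibre_loop (sgn z0) (gs (sgn z0 * s))
    (base_x q0 + xs (sgn z0 * s) *: zdir R n, base_y q0 + ys (sgn z0 * s) *: zdir R n) t.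
Proof. by rewrite /cyl /fibre_loop /standard_end /=; congr (_, _); ring. Qed.

Lemma base_coord (x y : R) :
  (base_x q0 + x *: zdir R n) 0 ord_max = x /\ (base_y q0 + y *: zdir R n) 0 ord_max = y.
Proof. by rewrite /base_x /base_y /zdir !mxE !eqxx /=; split; ring. Qed.

Lemma same_p_base (q : M) : same_p q q0 ->
  q.2 = (base_x q0 + q.2.1 0 ord_max *: zdir R n, base_y q0 + q.2.2 0 ord_max *: zdir R n).
Proof.
move=> H; case: q H => a [b c] /= H; congr (_, _); apply/rowP => i;
  have [->|ni] := eqVneq i ord_max; rewrite /base_x /base_y /zdir !mxE ?eqxx ?(negbTE ni) ?andbF /=.
- by ring.
- by have [/= -> _] := H i ni; ring.
- by ring.
- by have [/= _ ->] := H i ni; ring.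
Qed.

(** The angle is unbounded along each end, so it takes every value modulo
    [2 pi] at arbitrarily late times. *)
Lemma approach z0 (phis : R) : exists s : nat -> R,
  [/\ forall i, i%:R <= s i,
      forall i, xs (sgn z0 * s i) = r (sgn z0 * s i) * cos phis &
      forall i, ys (sgn z0 * s i) = r (sgn z0 * s i) * sin phis].
Proof.
have ss := end_sign_sqr R z0.
have cP : continuous (fun t => sgn z0 * phi (sgn z0 * t)).
  move=> t; apply: cvgMr; apply: (@continuous_comp _ _ _ (fun t => sgn z0 * t) phi).
    by apply: cvgMr; exact: cvg_id.
  exact: cphi.
have H K : exists T, forall t, T <= t -> K <= sgn z0 * phi (sgn z0 * t).
  have [T HT] := angle K; exists T => t /HT[h1 h2].
  by case: z0 {ss cP}; rewrite /end_sign ?mul1r ?mulN1r // lerNr.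
have step i : exists t, i%:R <= t /\ cos (phi (sgn z0 * t)) = cos phis /\
    sin (phi (sgn z0 * t)) = sin phis.
  have [t [it [m e]]] := hits_angle cP H (sgn z0 * phis) i%:R.
  exists t; split => //.
  have {}e : phi (sgn z0 * t) = phis + sgn z0 * (pi *+ 2 *+ m).
    by rewrite -[LHS]mul1r -ss -mulrA e mulrDr mulrA ss mul1r.
  rewrite e; case: z0 {ss cP H it e}; rewrite /end_sign ?mul1r ?mulN1r.
    by have [-> ->] := trig_period phis m.
  by have [<- <-] := trig_period (phis - pi *+ 2 *+ m) m; rewrite subrK.
have [s sP] := choice step; exists s; split=> i; have [h1 [h2 h3]] := sP i => //.
- by rewrite /xs h2.
- by rewrite /ys h3.
Qed.

(** At times at which the angle agrees with that of [q] the base point of the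
    loop tends to that of [q], since the radius tends to [norm_z q].  The offsets
    along the circle factor, reduced modulo [2 pi], subconverge by compactness;
    the limit loop covers the whole fibre and so passes through [q]. *)
Lemma tori_in_limit_set z0 (q : M) : same_p q q0 -> norm_z q = end_radius z0 ->
  limit_set lam u q.
Proof.
move=> /same_p_base q2E nq.
have R0 : 0 < end_radius z0 by rewrite /end_radius; case: (z0).
have [phis [ex ey]] := polar_coordinates (q.2.1 0 ord_max) (q.2.2 0 ord_max).
rewrite -/(norm_z q) nq in ex ey.
have [s [si xsE ysE]] := approach z0 phis.
(* The deck translations that bring the offsets between [0] and [2 pi]. *)
pose k i : int := - Num.floor (gs (sgn z0 * s i) / (2 * pi)).
pose gam i := gs (sgn z0 * s i) + (k i)%:~R * (2 * pi).
have pi0 := @pi_gt0 R.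
have tp0 : 0 < 2 * pi :> R by rewrite mulr_gt0.
have gb : bounded_fun gam.
  exists (2 * pi); split; first exact: num_real.
  move=> N hN i _; apply: le_trans (ltW hN); rewrite /gam /k.
  set a := gs _; have e : a = a / (2 * pi) * (2 * pi) by rewrite divfK // gt_eqF.
  rewrite intrN mulNr {1}e -mulrBl normrM (gtr0_norm tp0).
  have := Num.Theory.floor_le_tmp (a / (2 * pi)).
  have := Num.Theory.floorD1_gt (a / (2 * pi)).
  rewrite intrD => h1 h2; rewrite ger0_norm ?subr_ge0 //.
  by rewrite ler_piMl ?(ltW tp0) //; lra.
have [f finc /cvg_ex[/= c gc]] := bolzano_weierstrass gb.
have fi i : (i <= f i)%N.
  elim: i => // i IH; apply: leq_ltn_trans IH _.
  have := finc i.+1 i; rewrite !leEnat ltnn => h; by rewrite ltnNge h.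
pose s' i := s (f i).
have s'oo : s' i @[i --> \oo] --> +oo.
  apply/cvgryPge => A; near=> i; apply: le_trans (si (f i)).
  apply: (@le_trans _ _ i%:R); first by near: i; exact: nbhs_infty_ger.
  by rewrite ler_nat; exact: fi.
pose w i := (base_x q0 + xs (sgn z0 * s' i) *: zdir R n, base_y q0 + ys (sgn z0 * s' i) *: zdir R n).
have rc := end_radius_cvg (z0 := z0) s'oo.
have wc : w i @[i --> \oo] --> q.2.
  have wx : base_x q0 + xs (sgn z0 * s' i) *: zdir R n @[i --> \oo] -->
      base_x q0 + (end_radius z0 * cos phis) *: zdir R n.
    apply: cvgD; first exact: cvg_cst.
    by apply: cvgZr_tmp; under eq_fun do rewrite xsE; exact: cvgMl rc.
  have wy : base_y q0 + ys (sgn z0 * s' i) *: zdir R n @[i --> \oo] -->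
      base_y q0 + (end_radius z0 * sin phis) *: zdir R n.
    apply: cvgD; first exact: cvg_cst.
    by apply: cvgZr_tmp; under eq_fun do rewrite ysE; exact: cvgMl rc.
  by rewrite q2E ex ey; exact: cvg_pair wx wy.
have nz : q.2.1 0 ord_max ^+ 2 + q.2.2 0 ord_max ^+ 2 = end_radius z0 ^+ 2.
  by rewrite -nq sqr_sqrtr // addr_ge0 ?sqr_ge0.
have hq : q.2.1 0 ord_max ^+ 2 + q.2.2 0 ord_max ^+ 2 = qm rm \/
          q.2.1 0 ord_max ^+ 2 + q.2.2 0 ord_max ^+ 2 = qp rp.
  by rewrite nz /end_radius; case: (z0); [right | left].
have Pq : potential rm rp (q.2.1 0 ord_max) (q.2.2 0 ord_max) = end_value z0.
  have [p1 p2] := potential_circles rm0 rmp (q.2.1 0 ord_max) (q.2.2 0 ord_max).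
  by move: nz; rewrite /end_radius /end_value; case: (z0) => [/p2|/p1].
pose T := expR (end_value z0) * (sgn z0 * (2 * pi)).
exists (fibre_loop (sgn z0) c q.2); last first.
  exists ((q.1 - c) / (sgn z0 * (2 * pi))), 0.
  have tp : sgn z0 * (2 * pi) != 0 by rewrite mulf_neq0 ?end_sign_neq0 // gt_eqF.
  rewrite /deck /fibre_loop mulrC divfK //= mul0r addr0 subrK.
  by case: (q).
exists z0, (standard_end z0), T, (fun i => `|s' i|); split.
- exact: cylindrical_standard_end.
- split; last by rewrite mulf_neq0 ?mulf_neq0 ?end_sign_neq0 ?gt_eqF ?expR_gt0.
  rewrite /has_mass.
  have -> : (fun s => \int[lebesgue_measure]_(t in `[0, 1])
      pullback (fun t => u (standard_end z0 (s, t))) lam t 1) =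
    (fun s => expR (P (sgn z0 * s)) * (sgn z0 * (2 * pi))).
    apply/funext => s1.
    have -> : (fun t => u (standard_end z0 (s1, t))) =
        fibre_loop (sgn z0) (gs (sgn z0 * s1)) (base_x q0 + xs (sgn z0 * s1) *: zdir R n,
          base_y q0 + ys (sgn z0 * s1) *: zdir R n).
      by apply/funext => t; exact: u_standard_end.
    by rewrite mass_fibre //=; have [-> ->] := base_coord (xs (sgn z0 * s1)) (ys (sgn z0 * s1)).
  apply: cvgMl; apply: (@cvg_comp _ _ _ (fun s => P (sgn z0 * s)) expR).
    2: exact: continuous_expR.
  apply/cvgrPdist_lt => e e0; have [T1 HT] := end_limits z0 e0.
  near=> t; rewrite distrC; apply: (HT _ _).2.
  by near: t; apply: nbhs_pinfty_ge; exact: num_real.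
- by have := periodic_fibre rm0 rmp z0 c hq; rewrite Pq.
- split; first by move=> i; exact: normr_ge0.
  apply/cvgryPge => A; near=> i; apply: le_trans (ler_norm _).
  by near: i; move/cvgryPge : s'oo; exact.
- have s'0 i : `|s' i| = s' i by rewrite ger0_norm //; apply: le_trans (si _).
  have -> : (fun i t => u (standard_end z0 (`|s' i|, t))) =
     (fun i => fibre_loop (sgn z0) (gs (sgn z0 * s' i)) (w i)).
    by apply/funext => i; apply/funext => t; rewrite s'0 u_standard_end.
  exact: (@loop_cvg _ _ _ _ _ (fun i => k (f i)) _ _ gc wc).
Unshelve. all: by end_near. Qed.

(** Convergence at a single parameter value suffices: the radius tends to [rm]
    or [rp] along any sequence that goes to a puncture, and the remaining
    coordinates [p] are constant on the cylinder. *)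
Lemma limit_set_in_tori (q : M) : limit_set lam u q ->
  same_p q q0 /\ (norm_z q = rm \/ norm_z q = rp).
Proof.
move=> [G [z0 [psi [T [s [[_ _ _ _ ps] _ _ [_ soo] [k cv]]]]]] [t [m qE]]].
pose v i : M := deck (k i) (u (psi (s i, t))).
have vc : v i @[i --> \oo] --> G t.
  apply/cvgrPdist_lt => e e0; have := cv 0%N e e0; apply: filterS => i /(_ t).
  by rewrite distrC.
have [_ c1 c2] := smooth_coordinates (@smooth_id R M).
have v1 i : (v j).2.1 0 i @[j --> \oo] --> (G t).2.1 0 i.
  have h : continuous (fun q : M => q.2.1 0 i) := smooth_continuous (c1 i).
  exact: (@cvg_comp _ _ _ v (fun q : M => q.2.1 0 i) _ _ _ vc (h (G t))).
have v2 i : (v j).2.2 0 i @[j --> \oo] --> (G t).2.2 0 i.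
  have h : continuous (fun q : M => q.2.2 0 i) := smooth_continuous (c2 i).
  exact: (@cvg_comp _ _ _ v (fun q : M => q.2.2 0 i) _ _ _ vc (h (G t))).
have q2 : q.2 = (G t).2 by rewrite qE.
pose a i : R := sgn z0 * (psi (s i, t)).1.
have aoo : a i @[i --> \oo] --> +oo.
  apply/cvgryPge => A.
  have [N [_ HN]] := ps A; near=> i.
  have Ni : N < s i by near: i; move/cvgryPgt : soo; exact.
  have := HN _ Ni t; rewrite /a /end_sign.
  by case: (z0); rewrite ?mul1r ?mulN1r => /ltW.
have aE i : (psi (s i, t)).1 = sgn z0 * a i.
  by rewrite /a mulrA end_sign_sqr mul1r.
have rc := end_radius_cvg (z0 := z0) aoo.
split.
  move=> i ni; rewrite q2; split.
    apply: (cvg_unique _ (v1 i)) => //.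
    have -> : (fun j => (v j).2.1 0 i) = (fun=> q0.2.1 0 i).
      by apply/funext => j; rewrite /v /deck /cyl /base_x /zdir /= !mxE (negbTE ni) /= !mulr0 subr0 addr0.
    exact: cvg_cst.
  apply: (cvg_unique _ (v2 i)) => //.
  have -> : (fun j => (v j).2.2 0 i) = (fun=> q0.2.2 0 i).
      by apply/funext => j; rewrite /v /deck /cyl /base_y /zdir /= !mxE (negbTE ni) /= !mulr0 subr0 addr0.
  exact: cvg_cst.
have nv i : (v i).2.1 0 ord_max ^+ 2 + (v i).2.2 0 ord_max ^+ 2 = r (sgn z0 * a i) ^+ 2.
  rewrite -aE /v /=; have [-> ->] := base_coord (xs (psi (s i, t)).1) (ys (psi (s i, t)).1).
  by rewrite !exprMn -mulrDr cos2Dsin2 mulr1.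
have n2 : (G t).2.1 0 ord_max ^+ 2 + (G t).2.2 0 ord_max ^+ 2 = end_radius z0 ^+ 2.
  have l1 : ((v i).2.1 0 ord_max ^+ 2 + (v i).2.2 0 ord_max ^+ 2) @[i --> \oo] -->
     (G t).2.1 0 ord_max ^+ 2 + (G t).2.2 0 ord_max ^+ 2.
    by apply: cvgD; apply: cvgM; [exact: v1 | exact: v1 | exact: v2 | exact: v2].
  rewrite (funext nv) in l1; apply: (cvg_unique _ l1) => //.
  by apply: cvgM; exact: rc.
rewrite /norm_z q2 n2 sqrtr_sqr gtr0_norm; last by rewrite /end_radius; case: (z0).
by rewrite /end_radius; case: (z0); [right | left].
Unshelve. all: by end_near. Qed.

End LimitSet.

(* The dimension parameter n >= 1 of the source is written n.+1. *)
Theorem theorem5p1 (R : realType) (n : nat) (rplus rminus : R)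
    (hminus : 0 < rminus) (hplus : rminus < rplus) :
  exists (F : Mcov R n.+1 -> R) (J : Mcov R n.+1 -> Mcov R n.+1 -> Mcov R n.+1),
    [/\ smooth_function F,
        compatible_cs (@lambda0 R n.+1) J &
        forall q0 : Mcov R n.+1, rminus < norm_z q0 < rplus ->
          exists (a : Ccov R -> R) (u : Ccov R -> Mcov R n.+1),
            [/\ finite_energy_cylinder (exp_scaled F (@lambda0 R n.+1)) J a u,
                exists x : Ccov R, same_point (u x) q0 &
                limit_set (exp_scaled F (@lambda0 R n.+1)) u =
                  union_of_tori q0 rminus rplus]].
Proof.
exists (@conformal R n rminus rplus), (@lifted_J R n.+1); split.
- exact: smooth_conformal.
- exact: compatible_lifted_J.
move=> q0 /(spiral_trajectory hminus hplus)[r [phi [[sr sp] [x0 y0] dxy angle [inside ends]]]].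
pose xs t := r t * cos (phi t); pose ys t := r t * sin (phi t).
have sx : smooth (xs : R -> R) by apply: smoothM => //; exact: smooth_comp (@smooth_cos R) sp.
have sy : smooth (ys : R -> R) by apply: smoothM => //; exact: smooth_comp (@smooth_sin R) sp.
have dx t : is_derive t (1 : R) xs (pi * potential_x rminus rplus (xs t) (ys t)) := (dxy t).1.
have dy t : is_derive t (1 : R) ys (pi * potential_y rminus rplus (xs t) (ys t)) := (dxy t).2.
have [sA sB] := smooth_potential_partials hminus hplus sx sy.
have sdg : smooth (fun t => pi * (ys t * potential_x rminus rplus (xs t) (ys t) -
    xs t * potential_y rminus rplus (xs t) (ys t)) : R).
  apply: smoothM; first exact: smooth_cst.
  by apply: smoothD; [exact: smoothM | apply: smoothN; exact: smoothM].
have sda : smooth (fun t => 2 * pi * expR (potential rminus rplus (xs t) (ys t)) : R).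
  apply: smoothM; first exact: smooth_cst.
  apply: smooth_comp; first exact: smooth_expR.
  exact: smooth_potential_comp.
(* Tangency of the [d/ds]-derivative to the contact hyperplanes determines
   [gs], and the equation [u^* lambda o j = da] determines [a]. *)
have [gs [_ dg]] := antiderivative (smooth_continuous sdg).
have [a [_ da]] := antiderivative (smooth_continuous sda).
have sg := smooth_of_is_derive sdg dg; have sa := smooth_of_is_derive sda da.
exists (cyl_a a), (cyl q0 xs ys gs); split.
- split.
  + exact: (@smooth_cylinder_cyl R n q0 xs ys gs a sx sy sg sa).
  + exact: (@pseudoholomorphic_cyl R n _ _ hminus hplus q0 xs ys gs a sx sy sg sa dx dy dg da).
  + apply: (@hofer_energy_finite R n _ _ hminus hplus q0 xs ys gs a sx sy sg sa dx dy dg da) => t.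
    by have [_ /andP[_ /ltW]] := inside t.
- have tp : 2 * pi != 0 :> R by rewrite mulf_neq0 // gt_eqF // pi_gt0.
  exists (0, (q0.1 - gs 0) / (2 * pi)), 0.
  rewrite /deck /cyl /= mul0r addr0 mulrC divfK // subrK.
  by rewrite /xs /ys x0 y0 -(same_p_base (q0 := q0) (q := q0)) //; case: (q0).
have cphi : continuous phi := smooth_continuous sp.
apply/seteqP; split=> q.
  by move=> lq; apply: (@limit_set_in_tori R n _ _ hminus hplus q0 r phi gs ends inside q lq).
move=> [qp [nq|nq]].
  exact: (@tori_in_limit_set R n _ _ hminus hplus q0 r phi gs cphi angle ends inside false q qp nq).
exact: (@tori_in_limit_set R n _ _ hminus hplus q0 r phi gs cphi angle ends inside true q qp nq).
Qed.
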